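(* Let $1 < p < 2$. There exist two continuous functions $f, g : \mathbb{T} \to \mathbb{C}$ such that: (i) $\{t \in \mathbb{T} : f(t) = 0\} = \{t \in \mathbb{T} : g(t) = 0\}$; (ii) $F := \widehat{f}$ and $G := \widehat{g}$ are both in $\ell_p(\mathbb{Z})$; (iii) $G$ is a generator in $\ell_p(\mathbb{Z})$, but $F$ is not a generator in $\ell_p(\mathbb{Z})$.
   Context: $\mathbb{T} = \mathbb{R}/2\pi\mathbb{Z}$ is the circle, and $\widehat{f} = (\widehat{f}(n))_{n\in\mathbb{Z}}$ is the sequence of Fourier coefficients of $f$, so $f \sim \sum_n \widehat{f}(n) e^{int}$. An element $F \in \ell_p(\mathbb{Z})$ is called a generator (cyclic vector) in $\ell_p(\mathbb{Z})$ if the linear span of its translates $\{F(\cdot - k)\}_{k \in \mathbb{Z}}$ is dense in $\ell_p(\mathbb{Z})$. *)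

(* Defs.v *)
From mathcomp Require Import all_boot all_order all_algebra.
From mathcomp Require Import all_classical all_reals all_analysis.
From mathcomp Require Import complex.

Set Implicit Arguments.
Unset Strict Implicit.
Unset Printing Implicit Defensive.

Import Order.TTheory GRing.Theory Num.Theory.
Import numFieldNormedType.Exports.

Local Open Scope classical_set_scope.
Local Open Scope ring_scope.

(* [R[i]^o] is the field [R[i]] equipped with the topology of the modulus and
   seen as a vector space over [R[i]]; [R[i]] itself has no canonical topology. *)

(* A function on the circle R/2piZ is encoded as a 2pi-periodic function on R;
   it is continuous on the circle iff it is continuous on R. *)
Definition circle_continuous (R : realType) (f : R -> R[i]^o) : Prop :=
  continuous f /\ periodic f (2 * pi).

(* expi x = e^(i x) *)
Definition expi (R : realType) (x : R) : R[i] := Complex (cos x) (sin x).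

Definition Cintegral (R : realType) (D : set R) (f : R -> R[i]) : R[i] :=
  Complex (\int[lebesgue_measure]_(t in D) complex.Re (f t))
          (\int[lebesgue_measure]_(t in D) complex.Im (f t)).

Definition fourier_coef (R : realType) (f : R -> R[i]^o) (n : int) : R[i]^o :=
  Complex (2 * pi)^-1 0 *
  Cintegral `[0, 2 * pi] (fun t => f t * expi (- (n%:~R * t))).

(* [Normc.normc] is the modulus with values in [R], whereas [`|z|] has values
   in [R[i]]. *)
Definition lp_sum (R : realType) (p : R) (F : int -> R[i]^o) : \bar R :=
  \esum_(n in [set: int]) (Normc.normc (F n) `^ p)%:E.

Definition lp_norm (R : realType) (p : R) (F : int -> R[i]^o) : \bar R :=
  poweR (lp_sum p F) p^-1.

Definition lp (R : realType) (p : R) : set (int -> R[i]^o) :=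
  [set F | (lp_sum p F < +oo)%E].

Definition translate (R : realType) (k : int) (F : int -> R[i]^o) :
    int -> R[i]^o :=
  fun n => F (n - k).

Definition linear_span (K : pzRingType) (V : lmodType K) (A : set V) : set V :=
  [set u | exists (m : nat) (c : 'I_m -> K) (v : 'I_m -> V),
     (forall i, A (v i)) /\ u = \sum_(i < m) c i *: v i].

Definition lp_dense (R : realType) (p : R) (A : set (int -> R[i]^o)) : Prop :=
  forall H, lp p H -> forall e : R, 0 < e ->
    exists2 P, A P & (lp_norm p (H - P)%R < e%:E)%E.

(* Meant for [F] in [lp p]; its translates, and hence their linear span, are
   then in [lp p] as well. *)
Definition generator (R : realType) (p : R) (F : int -> R[i]^o) : Prop :=
  lp_dense p (linear_span [set translate k F | k in [set: int]]).

(* Main.v *)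
(* Let q > 2 be the exponent conjugate to p. The heart of the matter is a key
   lemma: for some beta > 0 depending only on p and every e > 0 there are Lipschitz
   X with |X| <= 1 and Fourier coefficients of l_p norm at most e, and Lipschitz u
   vanishing outside {X >= beta} whose Fourier coefficients are within e, in l_q
   norm, of the delta at 0. One takes X = (1/N) sum_(j < N) cos(9^j t), and for u a
   signed combination, with weights w_A of total variation at most 20^M, of the Riesz
   products prod_j (1 + 2 c_A cos(9^j t)), cut off smoothly near {X >= beta}. The
   coefficients of such a product are the powers c_A^k; the weights cancel the powers
   1 <= k <= M, and since q > 2 the remaining ones are small in l_q for N = M r^2 with
   r large. The part cut off is small by a Bernstein-type estimate, exponential in
   N b^2 = 100 M with b the size of the c_A, which beats the factor 20^(2M).

   Starting from g = 1, f = 0, S = 1 one iterates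
     g <- g - min(g, kappa^n) X / 2,   f <- f + eta max(beta - X, 0),   S <- S u
   with kappa = 1 - beta/2, so that f S = 0, g > 0, and g <= kappa^n wherever f = 0.
   In the limit f = 0 forces g = 0, so that f and g + f have the same zeros. The
   function g + f gives a generator because (g + f) / (g_n + f_n) tends to 1 in the
   norm of l_p. The coefficients of S_n are bounded in l_q, that at 0 stays away from
   0, and f S_n tends to 0 uniformly, so by duality those of f are not cyclic. *)

Require Import Defs.
From mathcomp Require Import all_boot all_order all_algebra.
From mathcomp Require Import all_classical all_reals all_analysis.
From mathcomp Require Import complex.
From mathcomp Require Import zify ring lra.

Import Order.TTheory GRing.Theory Num.Theory.
Import numFieldNormedType.Exports.

Local Open Scope classical_set_scope.
Local Open Scope ring_scope.

Set Implicit Arguments.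
Unset Strict Implicit.
Unset Printing Implicit Defensive.

Local Notation re := complex.Re.
Local Notation im := complex.Im.
Local Notation normc := Normc.normc.

(** Everything before the limit is done with Lipschitz functions: they are stable under products,
    extrema and inverses away from 0, and their Fourier coefficients are summable, so each of them
    acts boundedly on l_p by multiplication. The obstacle is that no uniform control is available on
    1/(g_n + f_n), which must blow up if g + f is to have zeros, nor on the size of S_n, while both
    conclusions need the later changes to remain small after multiplication by these functions.
    Hence each stage carries a budget, fixed once its functions are known, that limits all changes
    to come. The key lemma can meet any budget without degrading beta, and this uniformity of beta
    is what gives g a fixed rate of decay on the zeros of f. The truncation by kappa^n makes the
    decrements of g summable in the sup norm, whatever g is off these zeros; at the zeros it changes
    nothing. Convergence is handled throughout by bounds on arbitrary finite sums over distinct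
    frequencies, with p-th powers in place of norms. *)

(** * Mean values over a period *)

Definition mean (R : realType) (f : R -> R) : R :=
  (2 * pi)^-1 * \int[lebesgue_measure]_(t in `[0, 2 * pi]) f t.

Section Mean.
Variable R : realType.
Implicit Types (f g : R -> R).
Notation mu := (@lebesgue_measure R).

Lemma cst_cont (c : R) : continuous (fun _ : R => c).
Proof. exact: cst_continuous. Qed.

Lemma add_cont f g : continuous f -> continuous g -> continuous (fun t => f t + g t).
Proof. by move=> cf cg x; apply: continuousD; [exact: cf|exact: cg]. Qed.

Lemma opp_cont f : continuous f -> continuous (fun t => - f t).
Proof. by move=> cf x; apply: continuousN; exact: cf. Qed.

Lemma sub_cont f g : continuous f -> continuous g -> continuous (fun t => f t - g t).
Proof. by move=> cf cg; apply: add_cont => //; exact: opp_cont. Qed.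

Lemma mul_cont f g : continuous f -> continuous g -> continuous (fun t => f t * g t).
Proof. by move=> cf cg x; apply: continuousM; [exact: cf|exact: cg]. Qed.

Lemma eq_cont f g : f =1 g -> continuous f -> continuous g.
Proof. by move=> /funext ->. Qed.

Lemma twopi_gt0 : 0 < 2 * pi :> R.
Proof. by rewrite mulr_gt0 ?pi_gt0. Qed.

Lemma continuous_integrable_itv f (a b : R) : continuous f ->
  mu.-integrable `[a, b] (EFin \o f).
Proof.
move=> cf; apply: continuous_compact_integrable; first exact: segment_compact.
exact: continuous_subspaceT.
Qed.

Let mD : measurable (`[0, 2 * pi] : set (measurableTypeR R)).
Proof. exact: measurable_itv. Qed.

Let integ f : continuous f -> mu.-integrable `[0, 2 * pi] (EFin \o f).
Proof. exact: continuous_integrable_itv. Qed.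

Lemma meanD f g : continuous f -> continuous g ->
  mean (fun t => f t + g t) = mean f + mean g.
Proof.
by move=> cf cg; rewrite /mean (RintegralD mD (integ cf) (integ cg)) mulrDr.
Qed.

Lemma meanZ c f : continuous f -> mean (fun t => c * f t) = c * mean f.
Proof. by move=> cf; rewrite /mean (RintegralZl c mD (integ cf)) mulrCA. Qed.

Lemma mean_cst c : mean (fun=> c : R) = c.
Proof.
rewrite /mean Rintegral_cst//= lebesgue_measure_itv/= lte_fin twopi_gt0/=.
by rewrite oppr0 addr0 mulrCA mulVf ?mulr1// gt_eqF ?twopi_gt0.
Qed.

Lemma eq_mean f g : f =1 g -> mean f = mean g.
Proof. by move=> fg; congr mean; apply/funext. Qed.

Lemma ler_mean f g : continuous f -> continuous g -> (forall t, f t <= g t) ->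
  mean f <= mean g.
Proof.
move=> cf cg fg; rewrite /mean ler_pM2l ?invr_gt0 ?twopi_gt0//.
by apply: (le_Rintegral mD (integ cf) (integ cg)) => t _; exact: fg.
Qed.

Lemma mean_ge0 f : (forall t, 0 <= f t) -> 0 <= mean f.
Proof.
move=> f0; apply: mulr_ge0; first by rewrite invr_ge0 ltW ?twopi_gt0.
exact: Rintegral_ge0.
Qed.

Lemma meanN f : continuous f -> mean (fun t => - f t) = - mean f.
Proof.
by move=> cf; rewrite -mulN1r -meanZ//; apply: eq_mean => t; rewrite mulN1r.
Qed.

Lemma meanB f g : continuous f -> continuous g ->
  mean (fun t => f t - g t) = mean f - mean g.
Proof. by move=> cf cg; rewrite meanD ?meanN//; exact: opp_cont. Qed.

Lemma ler_norm_mean f B : continuous f -> (forall t, `|f t| <= B) ->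
  `|mean f| <= B.
Proof.
move=> cf fB; have cB (c : R) : continuous (fun _ : R => c) by exact: cst_continuous.
have {}fB t : -B <= f t /\ f t <= B by apply/andP; rewrite -ler_norml.
have := ler_mean cf (cB B) (fun t => (fB t).2).
have := ler_mean (cB (- B)) cf (fun t => (fB t).1).
by rewrite !mean_cst ler_norml => -> ->.
Qed.

Lemma Rintegral_shift f (a b h : R) : a <= b -> continuous f ->
  \int[mu]_(t in `[a + h, b + h]) f t = \int[mu]_(t in `[a, b]) f (t + h).
Proof.
move=> ab cf; rewrite /Rintegral; congr fine.
have d1 : derive1 (fun t : R => t + h) = cst 1.
  by apply/funext => t; rewrite derive1E deriveD// derive_id derive_cst addr0.
rewrite (@integration_by_substitution_increasing R (fun t => t + h))//.
- by apply: eq_integral => x _; rewrite fctE d1 mulr1.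
- by move=> x y _ _; rewrite ltrD2r.
- by rewrite d1 => x _; exact: cvg_cst.
- by rewrite d1; exact: is_cvg_cst.
- by rewrite d1; exact: is_cvg_cst.
- split.
  + by move=> x _; exact: derivableD.
  + by apply: cvg_at_right_filter; apply: cvgD => //; exact: cvg_cst.
  + by apply: cvg_at_left_filter; apply: cvgD => //; exact: cvg_cst.
- exact: continuous_subspaceT.
Qed.

Lemma Rintegral_itv_split f (a b c : R) : a <= b <= c -> continuous f ->
  \int[mu]_(t in `[a, c]) f t =
  \int[mu]_(t in `[a, b]) f t + \int[mu]_(t in `[b, c]) f t.
Proof.
move=> /andP[ab bc] cf.
have := @Rintegral_itvB R f (BLeft a) (BRight c) b (continuous_integrable_itv a c cf).
rewrite !bnd_simp => /(_ ab bc) e.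
rewrite -(@Rintegral_itv_obnd_cbnd _ b (BRight c)); last first.
  apply: integrableS (continuous_integrable_itv b c cf) => //.
  exact: subset_itv_oc_cc.
by rewrite -e addrC subrK.
Qed.

(** The shifted interval is cut at [2 * pi]; by periodicity the piece beyond it contributes the
    missing integral over [[0, h]]. *)
Lemma mean_shift f h : continuous f -> periodic f (2 * pi) -> 0 <= h <= 2 * pi ->
  mean (fun t => f (t + h)) = mean f.
Proof.
move=> cf pf /andP[h0 h2]; rewrite /mean; congr (_ * _).
have p0 := ltW twopi_gt0.
rewrite -Rintegral_shift//.
rewrite (@Rintegral_itv_split _ _ (2 * pi))//; last by rewrite add0r h2 lerDl.
rewrite [RHS](@Rintegral_itv_split _ _ h)//; last by rewrite h0.
have := Rintegral_shift (2 * pi) h0 cf; rewrite add0r [h + _]addrC => e.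
rewrite addrC add0r e; congr (_ + _).
by apply: eq_Rintegral => t _; rewrite pf.
Qed.
End Mean.

(** * Complex-valued functions, Fourier coefficients and Bessel's inequality *)

(** Continuity of the two real components is the form that the integral, itself taken componentwise,
    can use; it avoids choosing a topology on [R[i]]. *)
Definition ccontinuous (R : realType) (F : R -> R[i]) : Prop :=
  continuous (fun t => re (F t)) /\ continuous (fun t => im (F t)).

Definition cmean (R : realType) (F : R -> R[i]) : R[i] :=
  Complex (mean (fun t => re (F t))) (mean (fun t => im (F t))).

Definition fexp (R : realType) (n : int) (t : R) : R[i] := expi (n%:~R * t).

Definition fc (R : realType) (F : R -> R[i]) (n : int) : R[i] :=
  cmean (fun t => F t * fexp (- n) t).

Section ComplexMean.
Variable R : realType.
Implicit Types (F G : R -> R[i]) (z w : R[i]) (n m : int).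

Lemma reD z w : re (z + w) = re z + re w. Proof. by case: z w => ? ? []. Qed.
Lemma imD z w : im (z + w) = im z + im w. Proof. by case: z w => ? ? []. Qed.
Lemma reN z : re (- z) = - re z. Proof. by case: z. Qed.
Lemma imN z : im (- z) = - im z. Proof. by case: z. Qed.
Lemma reM z w : re (z * w) = re z * re w - im z * im w.
Proof. by case: z w => ? ? []. Qed.
Lemma imM z w : im (z * w) = re z * im w + im z * re w.
Proof. by case: z w => ? ? []. Qed.
Lemma complexP z w : re z = re w -> im z = im w -> z = w.
Proof. by case: z w => ? ? [? ?] /= -> ->. Qed.

Definition reimE := (reD, imD, reN, imN, reM, imM).

Lemma normcE z : normc z = Num.sqrt (re z ^+ 2 + im z ^+ 2).
Proof. by case: z. Qed.

Lemma normc_ge0 z : 0 <= normc z. Proof. by rewrite normcE sqrtr_ge0. Qed.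

Lemma sqr_normc z : normc z ^+ 2 = re z ^+ 2 + im z ^+ 2.
Proof. by rewrite normcE sqr_sqrtr// addr_ge0 ?sqr_ge0. Qed.

Lemma ler_normcD z w : normc (z + w) <= normc z + normc w.
Proof. by have := ler_normD z w; rewrite !normc_def -rmorphD/= lecR -!normcE. Qed.

Lemma normcN z : normc (- z) = normc z.
Proof. by rewrite !normcE reN imN !sqrrN. Qed.

Lemma normcB z w : normc (z - w) = normc (w - z).
Proof. by rewrite -normcN opprB. Qed.

Lemma ler_normc_sum (I : Type) (s : seq I) (P : pred I) (f : I -> R[i]) :
  normc (\sum_(i <- s | P i) f i) <= \sum_(i <- s | P i) normc (f i).
Proof.
elim/big_rec2: _ => [|i x y _ h]; first by rewrite Normc.normc0.
by apply: (le_trans (ler_normcD _ _)); rewrite lerD2l.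
Qed.

Lemma normc_real (x : R) : normc (Complex x 0) = `|x|.
Proof. by rewrite /= expr0n addr0 sqrtr_sqr. Qed.

Lemma ler_re_normc z : `|re z| <= normc z.
Proof. by rewrite normcE -sqrtr_sqr ler_wsqrtr// lerDl sqr_ge0. Qed.

Lemma ler_im_normc z : `|im z| <= normc z.
Proof. by rewrite normcE -sqrtr_sqr ler_wsqrtr// lerDr sqr_ge0. Qed.

Lemma ler_normc_reim z : normc z <= `|re z| + `|im z|.
Proof.
rewrite -[leRHS]ger0_norm ?addr_ge0// -sqrtr_sqr normcE ler_wsqrtr// sqrrD.
rewrite !real_normK ?num_real// lerD2r lerDl mulrn_wge0// mulr_ge0//.
Qed.

Lemma expiD (x y : R) : expi (x + y) = expi x * expi y.
Proof. by rewrite /expi cosD sinD; apply: complexP; rewrite reimE/= ?[_ * sin y + _]addrC. Qed.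

Lemma expi0 : expi 0 = 1 :> R[i].
Proof. by rewrite /expi cos0 sin0. Qed.

Lemma normc_expi (x : R) : normc (expi x) = 1.
Proof. by rewrite /= cos2Dsin2 sqrtr1. Qed.

Lemma fexpD n m (t : R) : fexp (n + m) t = fexp n t * fexp m t.
Proof. by rewrite /fexp rmorphD/= mulrDl expiD. Qed.

Lemma fexp0 (t : R) : fexp 0 t = 1.
Proof. by rewrite /fexp mul0r expi0. Qed.

Lemma fexpDr n (t h : R) : fexp n (t + h) = fexp n t * fexp n h.
Proof. by rewrite /fexp mulrDr expiD. Qed.

Lemma fexpNM n (t : R) : fexp (- n) t * fexp n t = 1.
Proof. by rewrite -fexpD addNr fexp0. Qed.

Lemma normc_fexp n (t : R) : normc (fexp n t) = 1.
Proof. exact: normc_expi. Qed.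

Lemma cos_periodic_int n (t : R) : cos (n%:~R * (t + 2 * pi)) = cos (n%:~R * t)
   /\ sin (n%:~R * (t + 2 * pi)) = sin (n%:~R * t).
Proof.
rewrite mulrDr; have pE (k : nat) : k%:R * (2 * pi) = (pi *+ 2) *+ k :> R.
  by rewrite -[RHS]mulr_natl -[pi *+ 2]mulr_natl.
case: n => k.
  by rewrite -pmulrn pE !periodicn//; [exact: sinD2pi|exact: cosD2pi].
rewrite NegzE mulrNz -pmulrn mulNr mulNr.
set u := k.+1%:R * t; rewrite -opprD !cosN !sinN pE.
by rewrite !periodicn//; [exact: sinD2pi|exact: cosD2pi].
Qed.

Lemma fexp_periodic n : periodic (@fexp R n) (2 * pi).
Proof. by move=> t; rewrite /fexp /expi; have [-> ->] := cos_periodic_int n t. Qed.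

Lemma continuous_fexp n : ccontinuous (@fexp R n).
Proof.
have cn : continuous (fun x : R => n%:~R * x).
  by move=> x; apply: continuousM => //; exact: cst_continuous.
split=> t.
  exact: (continuous_comp (cn t) (@continuous_cos R _)).
exact: (continuous_comp (cn t) (@continuous_sin R _)).
Qed.

Lemma ccontinuousD F G : ccontinuous F -> ccontinuous G -> ccontinuous (fun t => F t + G t).
Proof.
move=> [F1 F2] [G1 G2]; split.
  by apply: eq_cont (add_cont F1 G1) => t; rewrite reD.
by apply: eq_cont (add_cont F2 G2) => t; rewrite imD.
Qed.

Lemma ccontinuousM F G : ccontinuous F -> ccontinuous G -> ccontinuous (fun t => F t * G t).
Proof.
move=> [F1 F2] [G1 G2]; split.
  by apply: eq_cont (sub_cont (mul_cont F1 G1) (mul_cont F2 G2)) => t; rewrite reM.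
by apply: eq_cont (add_cont (mul_cont F1 G2) (mul_cont F2 G1)) => t; rewrite imM.
Qed.

Lemma ccontinuous_cst z : ccontinuous (fun _ : R => z).
Proof. by split; exact: cst_continuous. Qed.

Lemma ccontinuousZ z F : ccontinuous F -> ccontinuous (fun t => z * F t).
Proof. by move=> cF; apply: (ccontinuousM (ccontinuous_cst z) cF). Qed.

Lemma ccontinuousN F : ccontinuous F -> ccontinuous (fun t => - F t).
Proof.
move=> cF; rewrite (_ : (fun _ => _) = (fun t => (-1) * F t)) ?boolp.funeqE => [|t];
  by [exact: ccontinuousZ|rewrite mulN1r].
Qed.

Lemma ccontinuous_real (f : R -> R) : continuous f -> ccontinuous (fun t => Complex (f t) 0).
Proof. by move=> cf; split => //; exact: cst_continuous. Qed.

Lemma ccontinuous_sum (I : Type) (s : seq I) (F : I -> R -> R[i]) :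
  (forall i, ccontinuous (F i)) -> ccontinuous (fun t => \sum_(i <- s) F i t).
Proof.
move=> cF; elim: s => [|i s ih].
  by rewrite (_ : (fun _ => _) = fun=> 0) ?boolp.funeqE => [|t]; [exact: ccontinuous_cst|rewrite big_nil].
rewrite (_ : (fun _ => _) = fun t => F i t + \sum_(i <- s) F i t) ?boolp.funeqE => [|t];
  by [exact: ccontinuousD|rewrite big_cons].
Qed.

Lemma eq_cmean F G : F =1 G -> cmean F = cmean G.
Proof. by move=> FG; congr cmean; apply/funext. Qed.

Lemma cmeanD F G : ccontinuous F -> ccontinuous G ->
  cmean (fun t => F t + G t) = cmean F + cmean G.
Proof.
move=> [F1 F2] [G1 G2]; apply: complexP; rewrite reimE/= -meanD//;
by apply: eq_mean => t; rewrite reimE.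
Qed.

Lemma cmeanZ z F : ccontinuous F -> cmean (fun t => z * F t) = z * cmean F.
Proof.
move=> [F1 F2].
have cZ (c : R) (f : R -> R) : continuous f -> continuous (fun t => c * f t).
  by move=> cf; exact: (mul_cont (@cst_cont _ c) cf).
apply: complexP; rewrite reimE/= -!meanZ//.
  rewrite -(meanB (cZ _ _ F1) (cZ _ _ F2)).
  by apply: eq_mean => t; rewrite reimE.
rewrite -(meanD (cZ _ _ F2) (cZ _ _ F1)).
by apply: eq_mean => t; rewrite reimE.
Qed.

Lemma cmean_cst z : cmean (fun _ : R => z) = z.
Proof. by apply: complexP; rewrite /= mean_cst. Qed.

Lemma cmeanB F G : ccontinuous F -> ccontinuous G ->
  cmean (fun t => F t - G t) = cmean F - cmean G.
Proof.
move=> cF cG; rewrite cmeanD//; last exact: ccontinuousN.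
rewrite -[- cmean G]mulN1r -cmeanZ//; congr (_ + _).
by apply: eq_cmean => t; rewrite mulN1r.
Qed.

Lemma cmean_sum (I : Type) (s : seq I) (F : I -> R -> R[i]) :
  (forall i, ccontinuous (F i)) ->
  cmean (fun t => \sum_(i <- s) F i t) = \sum_(i <- s) cmean (F i).
Proof.
move=> cF; elim: s => [|i s ih].
  by rewrite big_nil -[RHS](cmean_cst 0); apply: eq_cmean => t; rewrite big_nil.
rewrite big_cons -ih -cmeanD//; last exact: ccontinuous_sum.
by apply: eq_cmean => t; rewrite big_cons.
Qed.

(** The factor 2 comes from bounding the real and imaginary parts separately; all later uses have
    room for it. *)
Lemma ler_normc_cmean F B : ccontinuous F -> (forall t, normc (F t) <= B) ->
  normc (cmean F) <= 2 * B.
Proof.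
move=> [F1 F2] FB; apply: (le_trans (ler_normc_reim _)); rewrite mulr_natl mulr2n/=.
by apply: lerD; apply: ler_norm_mean => // t; apply: le_trans (FB t);
  [exact: ler_re_normc|exact: ler_im_normc].
Qed.

Lemma cmean_shift F h : ccontinuous F -> periodic F (2 * pi) -> 0 <= h <= 2 * pi ->
  cmean (fun t => F (t + h)) = cmean F.
Proof.
move=> [F1 F2] pF h0; apply: complexP => /=.
  by apply: (@mean_shift _ (fun t => re (F t))) => // t; rewrite pF.
by apply: (@mean_shift _ (fun t => im (F t))) => // t; rewrite pF.
Qed.

(** For [n != 0], translation by [h = pi / |n|] multiplies e^(int) by -1 while preserving the mean,
    which is therefore its own opposite; no primitive has to be integrated. *)
Lemma cmean_fexp n : cmean (@fexp R n) = (n == 0)%:R.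
Proof.
have [->|n0] := eqVneq n 0.
  by rewrite -[RHS]cmean_cst; apply: eq_cmean => t; rewrite fexp0.
pose h : R := pi / `|n%:~R|.
have n1 : 1 <= `|n%:~R| :> R.
  rewrite -intr_norm -[1]/(1%:~R) ler_int; case: (n) n0 => [[|k]|k]//= _.
have hn : n%:~R * h = pi \/ n%:~R * h = - pi.
  rewrite /h; have [lt|gt|e] := ltrgtP 0 (n%:~R : R).
  - by left; rewrite gtr0_norm// mulrCA mulfV ?mulr1// gt_eqF.
  - by right; rewrite ltr0_norm// invrN mulrN mulrN mulrCA mulfV ?mulr1// lt_eqF.
  - by move: n0; rewrite -(intr_eq0 R) -e eqxx.
have eh : fexp n h = -1.
  rewrite /fexp /expi; case: hn => ->; rewrite ?cosN ?sinN cospi sinpi; apply: complexP; rewrite ?reimE/= ?oppr0//.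
have := @cmean_shift (@fexp R n) h (continuous_fexp n) (@fexp_periodic n).
rewrite divr_ge0 ?pi_ge0//= ler_pdivrMr ?(lt_le_trans _ n1)//.
have h2 : pi <= 2 * pi * `|n%:~R| :> R.
  by rewrite -[leLHS]mulr1 ler_pM ?pi_ge0// mulr_natl mulr2n lerDl pi_ge0.
move=> /(_ h2).
rewrite (@eq_cmean _ (fun t => -1 * fexp n t)); last by move=> t; rewrite fexpDr eh mulrC.
rewrite cmeanZ; last exact: continuous_fexp.
by rewrite mulN1r => /esym/eqP; rewrite -addr_eq0 -mulr2n mulrn_eq0/= => /eqP.
Qed.

Lemma fc_fexp n m : fc (@fexp R n) m = (n == m)%:R.
Proof.
rewrite -subr_eq0 -(cmean_fexp (n - m)).
by apply: eq_cmean => t; rewrite fexpD.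
Qed.

Lemma eq_fc F G n : F =1 G -> fc F n = fc G n.
Proof. by move=> FG; apply: eq_cmean => t; rewrite FG. Qed.

Lemma fcD F G n : ccontinuous F -> ccontinuous G ->
  fc (fun t => F t + G t) n = fc F n + fc G n.
Proof.
move=> cF cG; rewrite /fc -cmeanD; [|exact: ccontinuousM (continuous_fexp _)..].
by apply: eq_cmean => t; rewrite mulrDl.
Qed.

Lemma fcZ z F n : ccontinuous F -> fc (fun t => z * F t) n = z * fc F n.
Proof.
move=> cF; rewrite /fc -cmeanZ; last exact: ccontinuousM (continuous_fexp _).
by apply: eq_cmean => t; rewrite mulrA.
Qed.

Lemma fcB F G n : ccontinuous F -> ccontinuous G ->
  fc (fun t => F t - G t) n = fc F n - fc G n.
Proof.
move=> cF cG; rewrite /fc -cmeanB; [|exact: ccontinuousM (continuous_fexp _)..].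
by apply: eq_cmean => t; rewrite mulrBl.
Qed.

Lemma fc_sum (I : Type) (s : seq I) (F : I -> R -> R[i]) n :
  (forall i, ccontinuous (F i)) ->
  fc (fun t => \sum_(i <- s) F i t) n = \sum_(i <- s) fc (F i) n.
Proof.
move=> cF; rewrite /fc -cmean_sum; last first.
  by move=> i; exact: ccontinuousM (continuous_fexp _).
by apply: eq_cmean => t; rewrite mulr_suml.
Qed.

Lemma fc_mul_fexp F n m : fc (fun t => fexp m t * F t) n = fc F (n - m).
Proof.
by apply: eq_cmean => t; rewrite opprB fexpD mulrA (mulrC (F t)).
Qed.

Lemma ler_normc_fc F n B : ccontinuous F -> (forall t, normc (F t) <= B) ->
  normc (fc F n) <= 2 * B.
Proof.
move=> cF FB; apply: ler_normc_cmean; first exact: ccontinuousM (continuous_fexp _).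
by move=> t; rewrite Normc.normcM normc_fexp mulr1.
Qed.

Lemma fc_shift F n h : ccontinuous F -> periodic F (2 * pi) -> 0 <= h <= 2 * pi ->
  fc (fun t => F (t + h)) n = fexp n h * fc F n.
Proof.
move=> cF pF h0.
have cFn : ccontinuous (fun t => F t * fexp (- n) t) by exact: ccontinuousM (continuous_fexp _).
rewrite /fc -(@cmean_shift (fun t => F t * fexp (- n) t) h)//; last first.
  by move=> t; rewrite pF fexp_periodic.
rewrite -cmeanZ; last first.
  split=> x.
    apply: (@continuous_comp _ _ _ (fun t => t + h) (fun t => re (F t * fexp (- n) t))).
      by apply: continuousD => //; exact: cst_continuous.
    exact: cFn.1.
  apply: (@continuous_comp _ _ _ (fun t => t + h) (fun t => im (F t * fexp (- n) t))).
    by apply: continuousD => //; exact: cst_continuous.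
  exact: cFn.2.
apply: eq_cmean => t; rewrite (fexpDr (- n)).
rewrite -[LHS]mulr1 -(fexpNM n h).
by move: (F _) (fexp _ _) (fexp _ _) (fexp _ _) => *; ring.
Qed.

Lemma normc_sub_expi z w (x : R) : normc (z - w * expi x) ^+ 2 =
  re z * re z + im z * im z + (- 2 * re w * re (z * expi (- x)) +
    (- 2 * im w * im (z * expi (- x)) + normc w ^+ 2)).
Proof.
rewrite !sqr_normc !reimE /expi /= cosN sinN; have := cos2Dsin2 x.
move: (cos _) (sin _) (re z) (im z) (re w) (im w) => c s a b u v cs.
have -> : u ^+ 2 + v ^+ 2 = (u ^+ 2 + v ^+ 2) * (c ^+ 2 + s ^+ 2) by rewrite cs mulr1.
by ring.
Qed.

(** Pythagoras: once the square is expanded, the cross terms average to the real and imaginary parts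
    of the coefficient itself. *)
Lemma mean_sqr_sub F n : ccontinuous F ->
  mean (fun t => normc (F t - fc F n * fexp n t) ^+ 2) =
  mean (fun t => normc (F t) ^+ 2) - normc (fc F n) ^+ 2.
Proof.
move=> cF; set a := fc F n.
have cG : ccontinuous (fun t => F t * fexp (- n) t) by exact: ccontinuousM (continuous_fexp _).
have cc := @mul_cont R; have cd := @add_cont R; have ck := @cst_cont R.
rewrite (@eq_mean _ _ (fun t => (re (F t) * re (F t) + im (F t) * im (F t)) +
   ((- 2 * re a) * re (F t * fexp (- n) t) + ((- 2 * im a) * im (F t * fexp (- n) t) +
     normc a ^+ 2)))); last first.
  move=> t; rewrite normc_sub_expi; suff -> : fexp (- n) t = expi (- (n%:~R * t)) by [].
  by rewrite /fexp mulrNz mulNr.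
have c1 : continuous (fun t => re (F t) * re (F t) + im (F t) * im (F t)).
  exact: cd (cc _ _ cF.1 cF.1) (cc _ _ cF.2 cF.2).
have c2 : continuous (fun t => - 2 * re a * re (F t * fexp (- n) t)).
  exact: (cc _ _ (ck _) cG.1).
have c3 : continuous (fun t => - 2 * im a * im (F t * fexp (- n) t)).
  exact: (cc _ _ (ck _) cG.2).
rewrite (meanD c1 (cd _ _ c2 (cd _ _ c3 (ck _)))).
rewrite (meanD c2 (cd _ _ c3 (ck _))) (meanD c3 (ck _)).
rewrite meanZ; last exact: cG.1.
rewrite meanZ; last exact: cG.2.
rewrite mean_cst.
have -> : mean (fun t => re (F t * fexp (- n) t)) = re a by [].
have -> : mean (fun t => im (F t * fexp (- n) t)) = im a by [].
rewrite sqr_normc; congr (_ + _); last by ring.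
by apply: eq_mean => t; rewrite sqr_normc !expr2.
Qed.

(** One exponential is removed at a time: this lowers the mean square by exactly the squared modulus
    of its coefficient and leaves the other coefficients in [s] unchanged. *)
Lemma bessel F (s : seq int) : ccontinuous F -> uniq s ->
  \sum_(n <- s) normc (fc F n) ^+ 2 <= mean (fun t => normc (F t) ^+ 2).
Proof.
elim: s F => [|n s ih] F cF /=; first by rewrite big_nil => _; apply: mean_ge0 => t; exact: sqr_ge0.
move=> /andP[ns us]; rewrite big_cons.
have cE : ccontinuous (fun t => fc F n * fexp n t) by exact: ccontinuousZ (continuous_fexp _).
have cG : ccontinuous (fun t => F t - fc F n * fexp n t).
  by apply: ccontinuousD => //; exact: ccontinuousN.
have := ih _ cG us; rewrite mean_sqr_sub// lerBrDl; apply: le_trans.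
rewrite lerD2l le_eqVlt; apply/orP; left; apply/eqP.
rewrite !big_seq; apply: eq_bigr => m ms.
suff -> : fc (fun t => F t - fc F n * fexp n t) m = fc F m by [].
rewrite fcB// fcZ ?fc_fexp; last exact: continuous_fexp.
have -> : (n == m) = false by apply: contraNF ns => /eqP ->.
by rewrite mulr0 subr0.
Qed.
End ComplexMean.

(** * Periodic Lipschitz functions and their closure properties *)

(** A single [L] bounds both the values and the increments, which is what products and inverses
    need. *)
Definition lip (R : realType) (f : R -> R) : Prop :=
  periodic f (2 * pi) /\
  exists L, (forall x, `|f x| <= L) /\ (forall x y, `|f x - f y| <= L * `|x - y|).

Section Lip.
Variable R : realType.
Implicit Types (f g : R -> R).

Lemma sin_lip1 (x y : R) : `|sin x - sin y| <= `|x - y|.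
Proof.
wlog xy : x y / y <= x.
  by move=> h; have [|/ltW] := leP y x; [exact: h|rewrite distrC (distrC x); exact: h].
have [|c _ ->] := @MVT_segment R sin cos y x xy (fun x _ => is_derive_sin x).
  by apply: continuous_subspaceT; exact: continuous_sin.
by rewrite normrM ler_piMl// cos_max.
Qed.

Lemma cos_lip1 (x y : R) : `|cos x - cos y| <= `|x - y|.
Proof.
wlog xy : x y / y <= x.
  by move=> h; have [|/ltW] := leP y x; [exact: h|rewrite distrC (distrC x); exact: h].
have [|c _ ->] := @MVT_segment R cos (fun x => - sin x) y x xy (fun x _ => is_derive_cos x).
  by apply: continuous_subspaceT; exact: continuous_cos.
by rewrite normrM normrN ler_piMl// sin_max.
Qed.

(** By the mean value theorem sin x is cos c times x for some c in [0, 1]. This is the source of the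
    constant [cos 1] in the energy estimate, where |e^(2inh) - 1| = 2 |sin(nh)| has to be bounded
    from below. *)
Lemma sin_ge_cos1 (x : R) : 0 <= x <= 1 -> cos 1 * x <= sin x.
Proof.
move=> /andP[x0 x1].
have [|c] := @MVT_segment R sin cos 0 x x0 (fun x _ => is_derive_sin x).
  by apply: continuous_subspaceT; exact: continuous_sin.
rewrite in_itv/= sin0 !subr0 => /andP[c0 cx] ->; rewrite ler_wpM2r//.
have c1 : c <= 1 := le_trans cx x1.
have p1 : 1 <= pi :> R by rewrite (le_trans _ (pi_ge2 R))// ler1n.
have [->//|cn1] := eqVneq c 1.
by rewrite ltW// ltr_cos ?in_itv/= ?ler01 ?c0 ?(le_trans c1)//= lt_neqAle cn1.
Qed.

Lemma lip_bound f : lip f -> exists2 B, 0 <= B & forall x, `|f x| <= B.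
Proof. by move=> [_ [L [h _]]]; exists L => //; apply: le_trans (h 0). Qed.

Lemma lip_cont f : lip f -> continuous f.
Proof.
move=> [_ [L [h1 h2]]] x.
have L0 : 0 <= L by apply: le_trans (h1 0).
apply/cvgrPdist_le => /= e e0.
near=> y; apply: (le_trans (h2 _ _)).
apply: (@le_trans _ _ ((L + 1) * `|x - y|)); first by rewrite ler_wpM2r// lerDl.
rewrite mulrC -ler_pdivlMr ?ltr_pwDr//.
near: y; apply: cvgr_dist_le; first exact: cvg_id.
by rewrite divr_gt0// ltr_pwDr.
Unshelve. all: by end_near. Qed.

Lemma lip_cst c : lip (fun _ : R => c : R).
Proof.
split=> //; exists `|c|; split=> // x y; by rewrite subrr normr0 mulr_ge0.
Qed.

Lemma lipD f g : lip f -> lip g -> lip (fun t => f t + g t).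
Proof.
move=> [pf [L [f1 f2]]] [pg [M [g1 g2]]]; split=> [t|]; first by rewrite pf pg.
exists (L + M); split=> [x|x y]; first by rewrite (le_trans (ler_normD _ _)) ?lerD.
by rewrite opprD addrACA mulrDl (le_trans (ler_normD _ _)) ?lerD.
Qed.

Lemma lipM f g : lip f -> lip g -> lip (fun t => f t * g t).
Proof.
move=> [pf [L [f1 f2]]] [pg [M [g1 g2]]]; split=> [t|]; first by rewrite pf pg.
have L0 : 0 <= L by apply: le_trans (f1 0).
have M0 : 0 <= M by apply: le_trans (g1 0).
exists (2 * (L * M)); split=> [x|x y].
  rewrite normrM (@le_trans _ _ (L * M))//; first exact: ler_pM.
  by rewrite ler_peMl ?mulr_ge0// ler1n.
rewrite (_ : _ - _ = f x * (g x - g y) + (f x - f y) * g y); last by ring.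
apply: (le_trans (ler_normD _ _)); rewrite !normrM mulr_natl mulr2n mulrDl.
apply: lerD; first by rewrite -mulrA ler_pM.
by rewrite mulrAC ler_pM.
Qed.

Lemma lipZ c f : lip f -> lip (fun t => c * f t).
Proof. exact: lipM (lip_cst c). Qed.

Lemma lipN f : lip f -> lip (fun t => - f t).
Proof.
move=> lf; rewrite (_ : (fun _ => _) = (fun t => -1 * f t)); first exact: lipZ.
by apply/funext => t; rewrite mulN1r.
Qed.

Lemma lipB f g : lip f -> lip g -> lip (fun t => f t - g t).
Proof. by move=> lf lg; apply: lipD => //; exact: lipN. Qed.

Lemma lip_abs f : lip f -> lip (fun t => `|f t|).
Proof.
move=> [pf [L [f1 f2]]]; split=> [t|]; first by rewrite pf.
exists L; split=> [x|x y]; first by rewrite normr_id.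
exact: le_trans (ler_dist_dist _ _) (f2 _ _).
Qed.

Lemma lip_max f g : lip f -> lip g -> lip (fun t => Num.max (f t) (g t)).
Proof.
move=> lf lg.
rewrite (_ : (fun _ => _) = (fun t => 2^-1 * (f t + g t + `|f t - g t|))).
  by apply: lipZ; apply: lipD; [exact: lipD|apply: lip_abs; exact: lipB].
by apply/funext => t; rewrite maxr_absE mulrC.
Qed.

Lemma lip_min f g : lip f -> lip g -> lip (fun t => Num.min (f t) (g t)).
Proof.
move=> lf lg.
rewrite (_ : (fun _ => _) = (fun t => 2^-1 * (f t + g t - `|f t - g t|))).
  by apply: lipZ; apply: lipB; [exact: lipD|apply: lip_abs; exact: lipB].
by apply/funext => t; rewrite minr_absE mulrC.
Qed.

Lemma lip_inv f r : 0 < r -> (forall t, r <= f t) -> lip f -> lip (fun t => (f t)^-1).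
Proof.
move=> r0 rf [pf [L [f1 f2]]]; split=> [t|]; first by rewrite pf.
have L0 : 0 <= L by apply: le_trans (f1 0).
have f0 t : 0 < f t := lt_le_trans r0 (rf t).
have fr t : (f t)^-1 <= r^-1 by rewrite lef_pV2 ?posrE.
have fi t : 0 <= (f t)^-1 by rewrite invr_ge0 ltW.
exists (r^-1 + L * r^-1 * r^-1); split=> [x|x y].
  by rewrite ger0_norm// (le_trans (fr x))// lerDl !mulr_ge0// invr_ge0 ltW.
have -> : (f x)^-1 - (f y)^-1 = (f y - f x) * (f x)^-1 * (f y)^-1.
  by field; rewrite !gt_eqF.
rewrite !normrM !(ger0_norm (fi _)) distrC.
rewrite mulrDl; apply: (@le_trans _ _ (L * r^-1 * r^-1 * `|x - y|)); last first.
  by rewrite lerDr mulr_ge0// invr_ge0 ltW.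
rewrite (_ : L * _ * _ * _ = L * `|x - y| * r^-1 * r^-1); last by ring.
by apply: ler_pM => //; [exact: mulr_ge0|exact: ler_pM].
Qed.

Lemma lip_cosn (n : int) : lip (fun t : R => cos (n%:~R * t)).
Proof.
split=> [t|]; first by case: (cos_periodic_int n t).
exists (1 + `|n%:~R|); split=> [x|x y].
  by rewrite (le_trans (cos_max _))// lerDl.
by rewrite (le_trans (cos_lip1 _ _))// -mulrBr normrM ler_wpM2r// lerDr.
Qed.

Lemma lip_sinn (n : int) : lip (fun t : R => sin (n%:~R * t)).
Proof.
split=> [t|]; first by case: (cos_periodic_int n t).
exists (1 + `|n%:~R|); split=> [x|x y].
  by rewrite (le_trans (sin_max _))// lerDl.
by rewrite (le_trans (sin_lip1 _ _))// -mulrBr normrM ler_wpM2r// lerDr.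
Qed.

Lemma lip_sum (I : Type) (s : seq I) (F : I -> R -> R) :
  (forall i, lip (F i)) -> lip (fun t => \sum_(i <- s) F i t).
Proof.
move=> lF; elim: s => [|i s ih].
  rewrite (_ : (fun _ => _) = (fun=> 0)); first exact: lip_cst.
  by apply/funext => t; rewrite big_nil.
rewrite (_ : (fun _ => _) = (fun t => F i t + \sum_(i <- s) F i t)); first exact: lipD.
by apply/funext => t; rewrite big_cons.
Qed.

Lemma lip_prod (I : Type) (s : seq I) (F : I -> R -> R) :
  (forall i, lip (F i)) -> lip (fun t => \prod_(i <- s) F i t).
Proof.
move=> lF; elim: s => [|i s ih].
  rewrite (_ : (fun _ => _) = (fun=> 1)); first exact: lip_cst.
  by apply/funext => t; rewrite big_nil.
rewrite (_ : (fun _ => _) = (fun t => F i t * \prod_(i <- s) F i t)); first exact: lipM.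
by apply/funext => t; rewrite big_cons.
Qed.
End Lip.

(** * Decay and summability of the Fourier coefficients of Lipschitz functions *)

Definition creal (R : realType) (f : R -> R) : R -> R[i] := fun t => Complex (f t) 0.

Fixpoint zrange (N : nat) : seq int :=
  if N is N'.+1 then [:: N%:Z, - N%:Z & zrange N'] else [:: 0].

Section Fourier.
Variable R : realType.
Implicit Types (f g : R -> R).

Lemma mem_zrange N n : (n \in zrange N) = (`|n| <= N)%N.
Proof.
elim: N => [|N ih] /=; first by rewrite inE leqn0 absz_eq0.
by rewrite !inE ih; lia.
Qed.

Lemma zrange_uniq N : uniq (zrange N).
Proof. by elim: N => [|N ih] //=; rewrite inE !mem_zrange ih andbT; lia. Qed.

Lemma perm_filter_zrange N M : (N <= M)%N ->
  perm_eq [seq n <- zrange M | ~~ (N < `|n|)%N] (zrange N).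
Proof.
move=> NM; apply: uniq_perm; [exact: filter_uniq (zrange_uniq _)|exact: zrange_uniq|].
by move=> n; rewrite mem_filter !mem_zrange -leqNgt andb_idr// => /leq_trans; apply.
Qed.

Lemma size_zrange N : size (zrange N) = N.*2.+1.
Proof. by elim: N => //= N ->; lia. Qed.

Lemma big_zrangeS (V : zmodType) (F : int -> V) N :
  \sum_(n <- zrange N.+1) F n = F N.+1%:Z + (F (- N.+1%:Z) + \sum_(n <- zrange N) F n).
Proof. by rewrite /= !big_cons. Qed.

Lemma ler_sum_subset (I : eqType) (r s : seq I) (F : I -> R) : uniq s -> uniq r ->
  {subset s <= r} -> (forall i, 0 <= F i) -> \sum_(i <- s) F i <= \sum_(i <- r) F i.
Proof.
move=> us ur sr F0.
have : perm_eq (s ++ [seq x <- r | x \notin s]) r.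
  apply: uniq_perm => //.
    rewrite cat_uniq us filter_uniq// andbT /= -all_predC.
    by apply/allP => x; rewrite mem_filter => /andP[].
  by move=> x; rewrite mem_cat mem_filter; case: (boolP (x \in s)) => //= xs; rewrite (sr _ xs).
by move=> h; rewrite -(perm_big _ h) big_cat/= lerDl sumr_ge0.
Qed.

Lemma zrange_cover (s : seq int) : exists N, forall n, n \in s -> (`|n| <= N)%N.
Proof.
elim: s => [|m s [N h]]; first by exists 0%N.
exists (maxn `|m| N) => n; rewrite inE => /predU1P[->|/h nN]; first exact: leq_maxl.
by rewrite (leq_trans nN) ?leq_maxr.
Qed.

(** Comparison with a telescoping sum, 1/(x+1)^2 <= 1/x - 1/(x+1), after enlarging [s] to a
    symmetric range; the two signs give the factor 2. *)
Lemma sum_invsqr_tail N (s : seq int) : (0 < N)%N -> uniq s ->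
  (forall n, n \in s -> (N < `|n|)%N) ->
  \sum_(n <- s) (n%:~R ^+ 2)^-1 <= 2 / N%:R :> R.
Proof.
move=> N0 us sN; have [K hK] := zrange_cover s.
have F0 n : 0 <= (n%:~R ^+ 2)^-1 :> R by rewrite invr_ge0 sqr_ge0.
apply: (@le_trans _ _ (\sum_(n <- [seq n <- zrange (N + K) | (N < `|n|)%N]) (n%:~R ^+ 2)^-1)).
  apply: ler_sum_subset => //; first exact: filter_uniq (zrange_uniq _).
  by move=> n ns; rewrite mem_filter sN// mem_zrange (leq_trans (hK _ ns))// leq_addl.
rewrite big_filter.
suff : \sum_(i <- zrange (N + K) | (N < `|i|)%N) (i%:~R ^+ 2)^-1 <=
    2 / N%:R - 2 / (N + K)%:R :> R.
  by move/le_trans; apply; rewrite lerBlDr lerDl divr_ge0.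
elim: K {hK} => [|K ih].
  rewrite addn0 subrr big_seq_cond big_pred0// => n.
  by rewrite mem_zrange; case: leqP.
rewrite addnS /= !big_cons.
rewrite !abszN !absz_nat ltnS leq_addr mulrNz sqrrN -pmulrn.
set x : R := (N + K)%:R; have x0 : 0 < x by rewrite ltr0n; lia.
rewrite -[(N + K).+1%:R]natr1 -/x.
have h : ((x + 1) ^+ 2)^-1 <= x^-1 - (x + 1)^-1.
  rewrite (_ : x^-1 - (x + 1)^-1 = (x * (x + 1))^-1); last by field; lra.
  by rewrite lef_pV2 ?posrE; nra.
move: ih h; rewrite -/x; move: (\sum_(_ <- _ | _) _) ((_ ^+ 2)^-1) => S y.
move: (x^-1) ((x + 1)^-1) (N%:R^-1) => a b c.
lra.
Qed.

Lemma creal_ccont f : lip f -> ccontinuous (creal f).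
Proof. by move/lip_cont/ccontinuous_real. Qed.

Lemma normc_creal f (t : R) : normc (creal f t) = `|f t|.
Proof. exact: normc_real. Qed.

Lemma ler_fc_lip f n B : lip f -> (forall t, `|f t| <= B) -> normc (fc (creal f) n) <= 2 * B.
Proof.
by move=> lf fB; apply: ler_normc_fc => [|t]; [exact: creal_ccont|rewrite normc_creal].
Qed.

(* Bernstein: apply Bessel to f(t + 2h) - f(t) with h of the order of 1/max |n|. *)
Lemma lip_energy f L (s : seq int) : lip f -> (forall x y, `|f x - f y| <= L * `|x - y|) ->
  uniq s -> \sum_(n <- s) (n%:~R ^+ 2 * normc (fc (creal f) n) ^+ 2) <= (L / cos 1) ^+ 2.
Proof.
move=> lf fL us; have [K hK] := zrange_cover s.
pose h : R := K.+1%:R^-1.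
have h0 : 0 < h by rewrite invr_gt0 ltr0n.
have h1 : h <= 1 by rewrite invf_le1 ?ltr0n// ler1n.
have L0 : 0 <= L by have := le_trans (normr_ge0 _) (fL 1 0); rewrite subr0 normr1 mulr1.
have c1 : 0 < cos 1 :> R := cos1_gt0 R.
have cf := creal_ccont lf.
have pf : periodic (creal f) (2 * pi) by move=> t; rewrite /creal lf.1.
have p1 : 1 <= pi :> R by rewrite (le_trans _ (pi_ge2 R))// ler1n.
have h2 : 0 <= 2 * h <= 2 * pi.
  by rewrite mulr_ge0 ?(ltW h0)//= ler_pM2l// (le_trans h1).
have cfh : ccontinuous (fun t => creal f (t + 2 * h)).
  split; last exact: cst_cont.
  move=> t; apply: (@continuous_comp _ _ _ (fun t => t + 2 * h) f); last exact: lip_cont.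
  by apply: continuousD => //; exact: cst_continuous.
have := @bessel R _ s (ccontinuousD cfh (ccontinuousN cf)) us.
move=> B.
have {B} : \sum_(n <- s) normc (fc (fun t => creal f (t + 2 * h) - creal f t) n) ^+ 2 <= (2 * h * L) ^+ 2.
  apply: (le_trans B); apply: (le_trans (ler_norm _)); apply: ler_norm_mean.
    have [C1 C2] := ccontinuousD cfh (ccontinuousN cf).
    apply: eq_cont (add_cont (mul_cont C1 C1) (mul_cont C2 C2)) => t.
    by rewrite sqr_normc !expr2.
  move=> t; rewrite ger0_norm ?sqr_ge0// ler_sqr ?nnegrE ?normc_ge0 ?mulr_ge0 ?(ltW h0)//.
  rewrite (_ : creal f _ - _ = Complex (f (t + 2 * h) - f t) 0); last first.
    by apply: complexP; rewrite reimE//= subr0.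
  rewrite normc_real (le_trans (fL _ _))// addrAC subrr add0r ger0_norm ?mulr_ge0 ?(ltW h0)//.
  by rewrite mulrC.
rewrite expr_div_n ler_pdivlMr ?exprn_gt0// mulr_suml => B.
rewrite -(@ler_pM2l _ ((2 * h) ^+ 2)) ?exprn_gt0 ?mulr_gt0// -exprMn.
apply: le_trans B; rewrite mulr_sumr big_seq [leRHS]big_seq.
apply: ler_sum => n ns.
have -> : fc (fun t => creal f (t + 2 * h) - creal f t) n =
    (fexp n (2 * h) - 1) * fc (creal f) n.
  by rewrite fcB// fc_shift// mulrBl mul1r.
rewrite Normc.normcM.
set w := normc (fc _ n) ^+ 2; have w0 : 0 <= w by exact: sqr_ge0.
rewrite [leLHS](_ : _ = (2 * h) ^+ 2 * n%:~R ^+ 2 * cos 1 ^+ 2 * w); last by ring.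
rewrite [leRHS]exprMn; apply: ler_wpM2r => //.
rewrite sqr_normc !reimE /fexp /= oppr0 addr0.
set x : R := n%:~R.
have xK : `|x| * h <= 1.
  by rewrite ler_pdivrMr ?ltr0n// mul1r /x -intr_norm -abszE -pmulrn ler_nat ltnW// ltnS hK.
have -> : x * (2 * h) = (x * h) *+ 2 by rewrite mulrCA mulr_natl.
rewrite cos_mulr2n sin_mulr2n.
have -> : (cos (x * h) ^+ 2 *+ 2 - 1 - 1) ^+ 2 + ((cos (x * h) * sin (x * h)) *+ 2) ^+ 2 =
          4 * sin (x * h) ^+ 2.
  have := cos2sin2 (x * h); move: (cos _) (sin _) => c d c2.
  transitivity (4 * (c ^+ 2 - 1) ^+ 2 + 4 * c ^+ 2 * d ^+ 2); first by ring.
  by rewrite c2; ring.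
have : cos 1 * (`|x| * h) <= `|sin (x * h)|.
  have -> : `|sin (x * h)| = `|sin (`|x| * h)|.
    by case: (ger0P x) => _; rewrite ?mulNr ?sinN ?normrN.
  apply: le_trans (ler_norm _); apply: sin_ge_cos1.
  by rewrite mulr_ge0 ?(ltW h0).
rewrite -(@ler_sqr _ (cos 1 * _)) ?nnegrE ?mulr_ge0 ?(ltW h0) ?(ltW c1)//.
rewrite real_normK ?num_real// !exprMn real_normK ?num_real//.
move: (x ^+ 2) (h ^+ 2) (cos 1 ^+ 2) (sin _ ^+ 2) => a b c d.
by move=> ?; rewrite (_ : 2 ^+ 2 = 4); [lra|rewrite expr2; ring].
Qed.

Lemma lip_fc_decay f : lip f -> exists2 C, 0 <= C &
  forall n, `|n%:~R| * normc (fc (creal f) n) <= C.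
Proof.
move=> lf; have [_ [L [fB fL]]] := lf.
have c1 : 0 < cos 1 :> R := cos1_gt0 R.
have L0 : 0 <= L := le_trans (normr_ge0 _) (fB 0).
exists (L / cos 1) => [|n]; first by rewrite divr_ge0// ltW.
have := @lip_energy f L [:: n] lf fL isT; rewrite big_seq1 -[n%:~R ^+ 2]real_normK ?num_real//.
by rewrite -exprMn ler_sqr ?nnegrE ?mulr_ge0 ?normc_ge0 ?invr_ge0 ?(ltW c1).
Qed.

(** Each term is split by x <= l n^2 x^2 + 1/(2 l n^2): the first parts sum to at most [l] times the
    energy, the second ones to at most 1/(l N). The weight [l] stays free, so that it can be taken
    small first and N large afterwards. *)
Lemma lip_fc_tail f L (l : R) N (s : seq int) : lip f ->
  (forall x y, `|f x - f y| <= L * `|x - y|) -> 0 < l -> (0 < N)%N ->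
  uniq s -> (forall n, n \in s -> (N < `|n|)%N) ->
  \sum_(n <- s) normc (fc (creal f) n) <= l * (L / cos 1) ^+ 2 + (l * N%:R)^-1.
Proof.
move=> lf fL l0 N0 us sN.
have e := lip_energy lf fL us; have q := sum_invsqr_tail N0 us sN.
have N0' : 0 < N%:R :> R by rewrite ltr0n.
apply: (@le_trans _ _ (\sum_(n <- s) (l * (n%:~R ^+ 2 * normc (fc (creal f) n) ^+ 2) +
    (2 * l)^-1 * (n%:~R ^+ 2)^-1))).
  rewrite big_seq [leRHS]big_seq; apply: ler_sum => n /sN nN.
  have n0 : 0 < n%:~R ^+ 2 :> R.
    by rewrite exprn_even_gt0//= intr_eq0 -absz_eq0 -lt0n (leq_trans _ nN).
  move: (n%:~R ^+ 2 : R) n0 (normc _) => a a0 x.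
  have la : 0 < 2 * l * a by rewrite !mulr_gt0.
  rewrite -(ler_pM2r la) [leRHS]mulrDl (_ : _ * a^-1 * _ = 1); last by field; rewrite !gt_eqF.
  have := sqr_ge0 (2 * l * a * x - 1); nra.
rewrite big_split/= -!mulr_sumr; apply: lerD; first by rewrite ler_pM2l.
apply: (@le_trans _ _ ((2 * l)^-1 * (2 / N%:R))); first by rewrite ler_pM2l ?invr_gt0 ?mulr_gt0.
by rewrite (_ : (2 * l)^-1 * _ = (l * N%:R)^-1)//; field; rewrite !gt_eqF.
Qed.

Lemma lip_fc_sum f L B (l : R) N (s : seq int) : lip f ->
  (forall x y, `|f x - f y| <= L * `|x - y|) -> (forall x, `|f x| <= B) ->
  0 < l -> (0 < N)%N -> uniq s ->
  \sum_(n <- s) normc (fc (creal f) n) <=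
    N.*2.+1%:R * (2 * B) + (l * (L / cos 1) ^+ 2 + (l * N%:R)^-1).
Proof.
move=> lf fL fB l0 N0 us; rewrite (bigID (fun n : int => (`|n| <= N)%N))/=; apply: lerD; last first.
  rewrite -big_filter; apply: (lip_fc_tail lf fL) => //; first exact: filter_uniq.
  by move=> n; rewrite mem_filter -ltnNge => /andP[].
rewrite -big_filter.
apply: (@le_trans _ _ (\sum_(n <- zrange N) normc (fc (creal f) n))).
  apply: (@ler_sum_subset _ _ _ (fun n => normc (fc (creal f) n))).
  - exact: filter_uniq.
  - exact: zrange_uniq.
  - by move=> n; rewrite mem_filter mem_zrange => /andP[].
  - by move=> n; exact: normc_ge0.
apply: (@le_trans _ _ (\sum_(n <- zrange N) (2 * B))).
  by apply: ler_sum => n _; exact: ler_fc_lip.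
by rewrite big_const_seq count_predT iter_addr_0 size_zrange [leRHS]mulr_natl.
Qed.

(** Bernstein's theorem for Lipschitz functions, from the previous estimate with l = N = 1. It is
    what makes a Lipschitz function a multiplier of l_p. *)
Lemma lip_fc_summable f : lip f -> exists2 A, 0 <= A &
  forall s : seq int, uniq s -> \sum_(n <- s) normc (fc (creal f) n) <= A.
Proof.
move=> lf; have [_ [L [fB fL]]] := lf.
eexists; last by move=> s us; exact: (lip_fc_sum lf fL fB ltr01 (ltn0Sn 0) us).
have := lip_fc_sum lf fL fB ltr01 (ltn0Sn 0) (isT : uniq [::]).
by rewrite big_nil.
Qed.
End Fourier.

(** * Convergence of the Fourier series of a Lipschitz function *)

Section Inversion.
Variable R : realType.
Implicit Types (f g : R -> R) (G : R -> R[i]).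

Definition fpartial f (N : nat) (t : R) : R[i] :=
  \sum_(n <- zrange N) fc (creal f) n * fexp n t.

Lemma telescope_zrange (a : int -> R[i]) N :
  \sum_(n <- zrange N) (a (n - 1) - a n) = a (- N%:Z - 1) - a N%:Z.
Proof.
elim: N => [|N ih]; first by rewrite big_seq1.
rewrite big_zrangeS ih (_ : N.+1%:Z - 1 = N%:Z); last by lia.
rewrite (_ : - N.+1%:Z = - N%:Z - 1); last by lia.
by ring.
Qed.

Lemma lip_fc_cvg0 f (e : R) : lip f -> 0 < e -> exists N0 : nat, forall n : int,
  (N0 <= `|n|)%N -> normc (fc (creal f) n) <= e.
Proof.
move=> lf e0; have [C C0 hC] := lip_fc_decay lf.
exists (Num.bound (C / e)).+1 => n nN.
have n0 : 0 < `|n%:~R| :> R by rewrite normr_gt0 intr_eq0 -absz_eq0 -lt0n (leq_ltn_trans _ nN).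
rewrite -(ler_pM2l n0) (le_trans (hC n))// -ler_pdivrMr//.
apply: (le_trans (ltW (archi_boundP (divr_ge0 C0 (ltW e0))))).
by rewrite -intr_norm -abszE -pmulrn ler_nat ltnW.
Qed.

(* Chernoff: f = z H with z = e^(i(t - t0)) - 1, so that the partial sums at t0 telescope. *)
Lemma fpartial_vanish f t0 (eta e : R) : lip f -> 0 < eta ->
  (forall t, 1 - cos (t - t0) < eta -> f t = 0) -> 0 < e ->
  exists N0 : nat, forall N, (N0 <= N)%N -> normc (fpartial f N t0) <= e.
Proof.
move=> lf eta0 f0 e0.
(* [D] is |z|^2 = 2 (1 - cos (t - t0)), cut off below at [2 * eta]. Where the cutoff acts, f
   vanishes, so that H = f conj(z) / D has Lipschitz components and still satisfies f = z H. *)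
pose D t := Num.max (2 * (1 - cos (t - t0))) (2 * eta).
have lc : lip (fun t => cos (t - t0)).
  rewrite (_ : (fun _ => _) = (fun t => cos t0 * cos (1%:~R * t) + sin t0 * sin (1%:~R * t))).
    by apply: lipD; apply: lipZ; [exact: lip_cosn|exact: lip_sinn].
  by apply/funext => t; rewrite cosB mul1r; ring.
have ls : lip (fun t => sin (t - t0)).
  rewrite (_ : (fun _ => _) = (fun t => cos t0 * sin (1%:~R * t) - sin t0 * cos (1%:~R * t))).
    by apply: lipB; apply: lipZ; [exact: lip_sinn|exact: lip_cosn].
  by apply/funext => t; rewrite sinB mul1r; ring.
have lD : lip D.
  by apply: lip_max (lip_cst _); apply: lipZ; apply: lipB => //; exact: lip_cst.
have D0 t : 0 < 2 * eta <= D t by rewrite mulr_gt0//= le_max lexx orbT.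
have lDi : lip (fun t => (D t)^-1).
  by apply: (@lip_inv _ _ (2 * eta)) => // [|t]; [rewrite mulr_gt0|have /andP[]:= D0 t].
pose h1 t := f t * ((cos (t - t0) - 1) * (D t)^-1).
pose h2 t := f t * (- sin (t - t0) * (D t)^-1).
have lh1 : lip h1 by apply: lipM => //; apply: lipM => //; apply: lipB => //; exact: lip_cst.
have lh2 : lip h2 by apply: lipM => //; apply: lipM => //; exact: lipN.
pose H t := Complex (h1 t) (h2 t).
have cH : ccontinuous H by split; [exact: lip_cont lh1|exact: lip_cont lh2].
have HE n : fc H n = fc (creal h1) n + Complex 0 1 * fc (creal h2) n.
  rewrite -fcZ; last exact: creal_ccont. rewrite -fcD; [|exact: creal_ccont|]; last first.
    by apply: ccontinuousZ; exact: creal_ccont.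
  by apply: eq_fc => t; apply: complexP; rewrite !reimE/=; ring.
have cHe : ccontinuous (fun t => fexp 1 t * H t) by apply: ccontinuousM => //; exact: continuous_fexp.
have fE t : creal f t = fexp (-1) t0 * (fexp 1 t * H t) - H t.
  rewrite mulrA -{2}[H t]mul1r -mulrBl.
  have -> : fexp (-1) t0 * fexp 1 t = expi (t - t0).
    by rewrite /fexp mulrNz mulNr !mul1r -expiD addrC.
  have cs := cos2Dsin2 (t - t0); have De : f t * (2 * (1 - cos (t - t0))) * (D t)^-1 = f t.
    have [/f0 ->|h] := ltP (1 - cos (t - t0)) eta; first by rewrite !mul0r.
    rewrite /D max_l ?ler_pM2l// -mulrA mulfV ?mulr1// mulf_neq0// gt_eqF//.
    exact: lt_le_trans h.
  apply: complexP; rewrite !reimE /expi /= ?subr0 /h1 /h2; last by ring.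
  rewrite -{1}De; move: (cos _) (sin _) ((D t)^-1) cs => c s d cs.
  transitivity (f t * (2 - 2 * c + (c ^+ 2 + s ^+ 2 - 1)) * d); first by rewrite cs; ring.
  by ring.
pose a n := fexp n t0 * fc H n.
have aE n : fc (creal f) n * fexp n t0 = a (n - 1) - a n.
  rewrite (eq_fc _ fE) fcB//; last exact: ccontinuousZ.
  rewrite fcZ// fc_mul_fexp /a fexpD; ring.
have e2 : 0 < e / 4 by rewrite divr_gt0.
have [N1 hN1] := lip_fc_cvg0 lh1 e2; have [N2 hN2] := lip_fc_cvg0 lh2 e2.
have an n : (maxn N1 N2 <= `|n|)%N -> normc (a n) <= e / 2.
  rewrite geq_max => /andP[n1 n2]; rewrite Normc.normcM normc_fexp mul1r HE.
  apply: (le_trans (ler_normcD _ _)); rewrite Normc.normcM (_ : normc (Complex 0 1) = 1 :> R).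
    by have := hN1 _ n1; have := hN2 _ n2; lra.
  by rewrite /= expr0n add0r expr1n sqrtr1.
exists (maxn N1 N2) => N NN; rewrite /fpartial.
under eq_bigr do rewrite aE.
rewrite telescope_zrange (le_trans (ler_normcD _ _))// normcN.
have := an N%:Z NN; have := an (- N%:Z - 1).
have -> : (maxn N1 N2 <= `|(- N%:Z - 1)%R|)%N by lia.
by move=> /(_ isT); lra.
Qed.

Lemma periodic_int f (T t : R) (k : int) : periodic f T -> f (t + T *~ k) = f t.
Proof.
move=> pf; case: k => k; first by rewrite -pmulrn periodicn.
by rewrite NegzE mulrNz -pmulrn -[LHS](periodicn pf k.+1) subrK.
Qed.

Lemma circle_reduce (t t0 : R) : exists k : int, `|t + (2 * pi) *~ k - t0| <= pi.
Proof.
have p0 := twopi_gt0 R.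
pose k := Num.floor ((t - t0 + pi) / (2 * pi)).
exists (- k).
have := floor_itv ((t - t0 + pi) / (2 * pi)); rewrite -/k intrD.
rewrite ler_pdivlMr// ltr_pdivrMr// mulrNz -[(2 * pi) *~ k]mulrzl.
rewrite [(_ + _) * (2 * pi)]mulrDl mul1r.
move: (k%:~R * (2 * pi)) => u /andP[h1 h2].
by rewrite ler_norml; apply/andP; split; lra.
Qed.

(** Nearness on the circle is measured by [1 - cos (t - t0)], which does not see periods. Once t is
    moved to within pi of t0, the monotonicity of cos on [0, pi] turns it into nearness on the
    line. *)
Lemma lip_near f t0 (d : R) : lip f -> 0 < d -> exists2 eta, 0 < eta &
  forall t, 1 - cos (t - t0) < eta -> `|f t - f t0| <= d.
Proof.
move=> [pf [L [fB fL]]] d0; have L0 : 0 <= L := le_trans (normr_ge0 _) (fB 0).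
have p1 : 1 <= pi :> R by rewrite (le_trans _ (pi_ge2 R))// ler1n.
pose r : R := Num.min 1 (d / (L + 1)).
have r0 : 0 < r by rewrite lt_min ltr01 divr_gt0// ltr_pwDr.
have r1 : r <= 1 by rewrite ge_min lexx.
have rp : r <= pi by exact: le_trans p1.
have Lr : L * r <= d.
  apply: (@le_trans _ _ ((L + 1) * r)); first by rewrite ler_wpM2r ?ltW// ltrDl.
  by rewrite mulrC -ler_pdivlMr ?ltr_pwDr// ge_min lexx orbT.
exists (1 - cos r).
  by rewrite subr_gt0 -cos0 ltr_cos ?in_itv/= ?lexx ?pi_ge0 ?(ltW r0).
move=> t; have [k hk] := circle_reduce t t0.
rewrite ltrD2l ltrN2 -(@periodic_int f (2 * pi) t k)//.
have -> : cos (t - t0) = cos `|t + (2 * pi) *~ k - t0|.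
  rewrite cos_norm addrAC (@periodic_int cos (2 * pi))// => u.
  by rewrite mulr_natl cosD2pi.
rewrite ltr_cos ?in_itv/= ?normr_ge0 ?hk ?(ltW r0)// => h.
by rewrite (le_trans (fL _ _))// (le_trans _ Lr)// ler_wpM2l// ltW.
Qed.

Lemma fc_cst (c : R) n : fc (creal (fun=> c)) n = (n == 0)%:R * Complex c 0.
Proof.
rewrite (@eq_fc _ _ (fun t => Complex c 0 * fexp 0 t)); last by move=> t; rewrite fexp0 mulr1.
by rewrite fcZ ?fc_fexp 1?eq_sym 1?mulrC//; exact: continuous_fexp.
Qed.

Lemma fpartial_cst (c : R) N t : fpartial (fun=> c) N t = Complex c 0.
Proof.
rewrite /fpartial (bigD1_seq 0) ?zrange_uniq ?mem_zrange//= big1 ?addr0.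
  by rewrite fc_cst eqxx mul1r fexp0 mulr1.
by move=> n n0; rewrite fc_cst (negPf n0) !mul0r.
Qed.

Lemma fpartialD f g N t : lip f -> lip g ->
  fpartial (fun t => f t + g t) N t = fpartial f N t + fpartial g N t.
Proof.
move=> lf lg; rewrite /fpartial -big_split/=; apply: eq_bigr => n _.
rewrite -mulrDl -fcD; try exact: creal_ccont.
by congr (_ * _); apply: eq_fc => u; apply: complexP; rewrite reimE//= addr0.
Qed.

Lemma ler_fpartial f N t (e : R) :
  \sum_(n <- zrange N) normc (fc (creal f) n) <= e -> normc (fpartial f N t) <= e.
Proof.
apply: le_trans; apply: (le_trans (ler_normc_sum _ _ _)); apply: ler_sum => n _.
by rewrite Normc.normcM normc_fexp mulr1.
Qed.

(** For a fixed [L], smallness in the sup norm gives smallness of the l_1 norm of the coefficients: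
    a small [l] and then a large [N] bound the tail by two thirds of [e] for all such functions at
    once, and [d] is chosen against the 2N + 1 low frequencies. *)
Lemma lip_fc_small (L e : R) : 0 < e -> exists2 d, 0 < d & forall f, lip f ->
  (forall x y, `|f x - f y| <= L * `|x - y|) -> (forall x, `|f x| <= d) ->
  forall s : seq int, uniq s -> \sum_(n <- s) normc (fc (creal f) n) <= e.
Proof.
move=> e0; pose E := (L / cos 1) ^+ 2; have E0 : 0 <= E by exact: sqr_ge0.
pose l := e / (3 * (E + 1)).
have E1 : 0 < E + 1 by rewrite ltr_pwDr.
have l0 : 0 < l by rewrite divr_gt0// mulr_gt0.
have lE : l * E <= e / 3.
  rewrite (_ : l * E = e / 3 * (E / (E + 1))); last by rewrite /l; field; rewrite gt_eqF.
  rewrite ler_piMr//; first by rewrite divr_ge0// ltW.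
  by rewrite ler_pdivrMr// mul1r lerDl.
pose N := (Num.bound (3 / (l * e))).+1.
have N0 : 0 < N%:R :> R by rewrite ltr0n.
have lN : (l * N%:R)^-1 <= e / 3.
  have h : 3 / (l * e) <= N%:R.
    apply: (@le_trans _ _ (Num.bound (3 / (l * e)))%:R).
      by apply: ltW; apply: archi_boundP; rewrite divr_ge0 // (mulr_ge0 (ltW l0) (ltW e0)).
    by rewrite ler_nat.
  move: h; rewrite (ler_pdivrMr _ _ (mulr_gt0 l0 e0)) => h.
  rewrite -div1r (ler_pdivrMr _ _ (mulr_gt0 l0 N0)) (_ : e / 3 * _ = N%:R * (l * e) / 3); last by ring.
  by lra.
pose d := e / (6 * N.*2.+1%:R); exists d.
  by rewrite divr_gt0// mulr_gt0// ltr0n.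
move=> f lf fL fd s us; have N1 : (0 < N)%N by [].
apply: (le_trans (lip_fc_sum lf fL fd l0 N1 us)); rewrite -/E; have -> : N.*2.+1%:R * (2 * d) = e / 3.
  have K0 : N.*2.+1%:R != 0 :> R by rewrite pnatr_eq0.
  by rewrite /d; move: (_%:R) K0 => k K0; field.
lra.
Qed.

Lemma clamp_lip (d x y : R) :
  `|Num.max (- d) (Num.min x d) - Num.max (- d) (Num.min y d)| <= `|x - y|.
Proof.
have h u v : Num.max (- d) (Num.min u d) - Num.max (- d) (Num.min v d) <= `|u - v|.
  have := ler_norm (u - v); have := normr_ge0 (u - v); move: `|_| => w.
  rewrite !maxEle !minEle.
  by case: (leP u d) => ?; case: (leP v d) => ?;
    case: (leP (- d) _) => ?; rewrite ?lexx; (try case: (leP (- d) _) => ?); lra.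
by rewrite ler_norml h lerNl opprB distrC h.
Qed.

(** f - f(t0) is clamped to height [d]. Clamping keeps the Lipschitz constant, so the clamped part
    has small partial sums by [lip_fc_small]; the remainder vanishes near t0, and [fpartial_vanish]
    applies to it. *)
Lemma fourier_pointwise f t0 (e : R) : lip f -> 0 < e ->
  exists N0 : nat, forall N, (N0 <= N)%N -> normc (fpartial f N t0 - creal f t0) <= e.
Proof.
move=> lf e0; have [pf [L [fB fL]]] := lf.
have [d d0 hd] := @lip_fc_small L (e / 2) (divr_gt0 e0 (ltr0n _ 2)).
pose f1 t := f t - f t0.
have lf1 : lip f1 by apply: lipB => //; exact: lip_cst.
pose cl t := Num.max (- d) (Num.min (f1 t) d).
have lcl : lip cl by apply: lip_max (lip_min _ _) => //; exact: lip_cst.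
have clL x y : `|cl x - cl y| <= L * `|x - y|.
  apply: le_trans (fL x y); rewrite (_ : f x - f y = f1 x - f1 y); last by rewrite /f1; ring.
  exact: clamp_lip.
have cld x : `|cl x| <= d.
  rewrite ler_norml /cl le_max lexx/= ge_max ge_min lexx orbT andbT; lra.
have [eta eta0 heta] := lip_near t0 lf d0.
pose f2 t := f1 t - cl t.
have lf2 : lip f2 by exact: lipB.
have f20 t : 1 - cos (t - t0) < eta -> f2 t = 0.
  move=> /heta; rewrite -/(f1 t) ler_norml => /andP[h1 h2].
  by rewrite /f2 /cl min_l// max_r// subrr.
have [N0 hN0] := fpartial_vanish lf2 eta0 f20 (divr_gt0 e0 (ltr0n _ 2)).
exists N0 => N NN.
have -> : fpartial f N t0 = fpartial f2 N t0 + (fpartial cl N t0 + Complex (f t0) 0).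
  rewrite -(fpartial_cst (f t0) N t0) -(fpartialD N t0 lcl (lip_cst (f t0))).
  rewrite -(fpartialD N t0 lf2 (lipD lcl (lip_cst (f t0)))).
  by congr fpartial; apply/funext => t; rewrite /f2 /f1; ring.
rewrite addrA addrK (le_trans (ler_normcD _ _))//.
have := hN0 _ NN; have := @ler_fpartial cl N t0 (e / 2) (hd _ lcl clL cld _ (zrange_uniq N)).
lra.
Qed.

Lemma lip_fc_tail_small f (e : R) : lip f -> 0 < e -> exists N0 : nat,
  forall N (s : seq int), (N0 <= N)%N -> uniq s -> (forall n, n \in s -> (N < `|n|)%N) ->
  \sum_(n <- s) normc (fc (creal f) n) <= e.
Proof.
move=> lf e0.
have [_ [L [_ fL]]] := lf.
pose E := (L / cos 1) ^+ 2; have E0 : 0 <= E by exact: sqr_ge0.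
pose l := e / (2 * (E + 1)).
have E1 : 0 < E + 1 by rewrite ltr_pwDr.
have l0 : 0 < l by rewrite divr_gt0// mulr_gt0.
have lE : l * E <= e / 2.
  rewrite (_ : l * E = e / 2 * (E / (E + 1))); last by rewrite /l; field; rewrite gt_eqF.
  rewrite ler_piMr//; first by rewrite divr_ge0// ltW.
  by rewrite ler_pdivrMr// mul1r lerDl.
pose N0 := (Num.bound (2 / (l * e))).+1.
exists N0 => N s N0N us sN.
have N00 : 0 < N%:R :> R by rewrite ltr0n (leq_trans _ N0N).
have lN : (l * N%:R)^-1 <= e / 2.
  have h : 2 / (l * e) <= N%:R.
    apply: (@le_trans _ _ (Num.bound (2 / (l * e)))%:R).
      by apply: ltW; apply: archi_boundP; rewrite divr_ge0 // (mulr_ge0 (ltW l0) (ltW e0)).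
    by rewrite ler_nat (leq_trans _ N0N).
  move: h; rewrite (ler_pdivrMr _ _ (mulr_gt0 l0 e0)) => h.
  rewrite -div1r (ler_pdivrMr _ _ (mulr_gt0 l0 N00)) (_ : e / 2 * _ = N%:R * (l * e) / 2); last by ring.
  by lra.
have N1 : (0 < N)%N by rewrite (leq_trans _ N0N).
by apply: (le_trans (lip_fc_tail lf fL l0 N1 us sN)); rewrite -/E; lra.
Qed.

Lemma fpartial_cauchy f (e : R) : lip f -> 0 < e -> exists N0 : nat, forall N M t,
  (N0 <= N)%N -> (N <= M)%N -> normc (fpartial f M t - fpartial f N t) <= e.
Proof.
move=> lf e0; have [N0 hN0] := lip_fc_tail_small lf e0.
exists N0 => N M t N0N NM.
have -> : fpartial f M t - fpartial f N t =
    \sum_(n <- [seq n <- zrange M | (N < `|n|)%N]) fc (creal f) n * fexp n t.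
  rewrite /fpartial (bigID (fun n : int => (N < `|n|)%N))/= big_filter.
  by rewrite -[X in _ + X - _]big_filter (perm_big _ (perm_filter_zrange NM)) addrK.
apply: (le_trans (ler_normc_sum _ _ _)).
apply: (@le_trans _ _ (\sum_(n <- [seq n <- zrange M | (N < `|n|)%N]) normc (fc (creal f) n))).
  by apply: ler_sum => n _; rewrite Normc.normcM normc_fexp mulr1.
apply: (hN0 _ _ N0N); first exact: filter_uniq (zrange_uniq _).
by move=> n; rewrite mem_filter => /andP[].
Qed.

(** Summability makes the partial sums uniformly Cauchy; the pointwise result identifies their
    limit. *)
Lemma fourier_uniform f (e : R) : lip f -> 0 < e ->
  exists N0 : nat, forall N, (N0 <= N)%N ->
  forall t, normc (creal f t - fpartial f N t) <= e.
Proof.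
move=> lf e0; have e2 : 0 < e / 2 by rewrite divr_gt0.
have [N0 hN0] := fpartial_cauchy lf e2.
exists N0 => N NN t; have [N1 hN1] := fourier_pointwise t lf e2.
pose M := maxn N N1.
have := hN0 N M t NN (leq_maxl _ _); have := hN1 M (leq_maxr _ _).
rewrite normcB => h1 h2.
rewrite -(subrK (fpartial f M t) (creal f t)) -addrA (le_trans (ler_normcD _ _))//; lra.
Qed.

(** Uniform convergence lets [f] be replaced by a partial sum, whose product with [G] has a finite
    convolution as coefficients. Finite sums with an error term spare the handling of series, and
    one [N0] serves all frequencies [m]. *)
Lemma fc_mul f G B (e : R) : lip f -> ccontinuous G ->
  (forall t, normc (G t) <= B) -> 0 < e ->
  exists N0 : nat, forall N m, (N0 <= N)%N ->
  normc (fc (fun t => creal f t * G t) m -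
         \sum_(n <- zrange N) fc (creal f) n * fc G (m - n)) <= e.
Proof.
move=> lf cG GB e0; have B0 : 0 <= B := le_trans (normc_ge0 _) (GB 0).
have B1 : 0 < 2 * (B + 1) by rewrite mulr_gt0// ltr_pwDr.
have [N0 hN0] := fourier_uniform lf (divr_gt0 e0 B1).
exists N0 => N m /hN0 h.
have cterm n : ccontinuous (fun t => fc (creal f) n * (fexp n t * G t)).
  by apply: ccontinuousZ; apply: ccontinuousM => //; exact: continuous_fexp.
have -> : \sum_(n <- zrange N) fc (creal f) n * fc G (m - n) =
    fc (fun t => fpartial f N t * G t) m.
  rewrite (@eq_fc _ _ (fun t => \sum_(n <- zrange N) fc (creal f) n * (fexp n t * G t))).
    rewrite fc_sum//; apply: eq_bigr => n _; rewrite fcZ ?fc_mul_fexp//.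
    by apply: ccontinuousM => //; exact: continuous_fexp.
  by move=> t; rewrite /fpartial mulr_suml; apply: eq_bigr => n _; rewrite mulrA.
have cP : ccontinuous (fun t => fpartial f N t * G t).
  apply: ccontinuousM => //; apply: ccontinuous_sum => n.
  by apply: ccontinuousZ; exact: continuous_fexp.
have cf : ccontinuous (fun t => creal f t * G t) by apply: ccontinuousM => //; exact: creal_ccont.
rewrite -fcB//; apply: (@le_trans _ _ (2 * (e / (2 * (B + 1)) * B))).
  apply: ler_normc_fc => [|t]; first by apply: ccontinuousD => //; exact: ccontinuousN.
  by rewrite -mulrBl Normc.normcM ler_pM ?normc_ge0.
rewrite (_ : 2 * _ = e * (B / (B + 1))); last by field; rewrite gt_eqF// ltr_pwDr.
by rewrite ler_piMr ?(ltW e0)// ler_pdivrMr ?ltr_pwDr// mul1r lerDl.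
Qed.
End Inversion.

(* [B] bounds the p-th power of the l_p norm, not the norm itself. *)
Definition psum (R : realType) (p : R) (F : int -> R[i]) (B : R) : Prop :=
  forall s : seq int, uniq s -> \sum_(n <- s) normc (F n) `^ p <= B.

(** * Sums of p-th powers: Jensen, Young, Fatou and Hoelder inequalities *)

Section PSum.
Variable R : realType.
Implicit Types (F G : int -> R[i]) (p q : R).

Lemma powR_tangent p (x y : R) : 1 < p -> 0 <= x -> 0 <= y ->
  x `^ p + p * x `^ (p - 1) * (y - x) <= y `^ p.
Proof.
move=> p1 x0 y0; have p0 : 0 < p by exact: lt_trans p1.
have p10 : 0 < p - 1 by rewrite subr_gt0.
pose q := p / (p - 1); have q0 : 0 < q by rewrite divr_gt0.
have pq : p^-1 + q^-1 = 1.
  by rewrite /q invf_div; field; rewrite gt_eqF.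
have := @conjugate_powR R y (x `^ (p - 1)) p q y0 (powR_ge0 _ _) p0 q0 pq.
rewrite -powRrM (_ : (p - 1) * q = p); last by rewrite /q; field; rewrite gt_eqF.
rewrite -(ler_pM2l p0) mulrDr (_ : p * (_ / p) = y `^ p); last by field; rewrite gt_eqF.
rewrite (_ : p * (_ / q) = (p - 1) * x `^ p); last by rewrite /q; field; rewrite !gt_eqF.
have := mulr_powRB1 x0 p0; move: (x `^ p) (x `^ (p - 1)) (y `^ p) => a b c e.
rewrite mulrBr -[p * b * x]mulrA (mulrC b) e; lra.
Qed.

(** With T the weighted sum, the tangent inequality at T/C is summed against the weights. Their
    total may fall short of [C]; the deficit contributes a nonnegative multiple of p - 1. *)
Lemma jensen_powR p (I : Type) (s : seq I) (c y : I -> R) C : 1 < p ->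
  (forall i, 0 <= c i) -> (forall i, 0 <= y i) -> \sum_(i <- s) c i <= C -> 0 < C ->
  (\sum_(i <- s) c i * y i) `^ p <= C `^ (p - 1) * \sum_(i <- s) c i * y i `^ p.
Proof.
move=> p1 c0 y0 cC C0; have p0 : 0 < p by exact: lt_trans p1.
set T := \sum_(i <- s) c i * y i.
have T0 : 0 <= T by apply: sumr_ge0 => i _; exact: mulr_ge0.
pose x := T / C; have x0 : 0 <= x by rewrite divr_ge0// ltW.
have h : \sum_(i <- s) c i * (x `^ p + p * x `^ (p - 1) * (y i - x)) <= \sum_(i <- s) c i * y i `^ p.
  by apply: ler_sum => i _; rewrite ler_wpM2l// powR_tangent.
have e : \sum_(i <- s) c i * (x `^ p + p * x `^ (p - 1) * (y i - x)) =
    (\sum_(i <- s) c i) * (1 - p) * x `^ p + p * x `^ (p - 1) * T.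
  rewrite /T mulr_sumr !mulr_suml -big_split/=; apply: eq_bigr => i _.
  rewrite -(mulr_powRB1 x0 p0); ring.
have TE : T = C * x by rewrite /x mulrCA mulfV ?mulr1// gt_eqF.
have : C * x `^ p <= \sum_(i <- s) c i * y i `^ p.
  apply: le_trans h; rewrite e TE.
  rewrite (_ : p * _ * (C * x) = p * C * x `^ p); last by rewrite -(mulr_powRB1 x0 p0); ring.
  have := powR_ge0 x p; move: (x `^ p) cC => a; move: (\sum_(_ <- _) _) => d dC a0.
  have p1' : 0 <= p - 1 by rewrite subr_ge0 ltW.
  have dC' : 0 <= C - d by rewrite subr_ge0.
  by have := mulr_ge0 (mulr_ge0 p1' dC') a0; lra.
move=> {}h; rewrite TE powRM ?(ltW C0)// -(mulr_powRB1 (ltW C0) p0) [C * _]mulrC -mulrA.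
by rewrite ler_wpM2l ?powR_ge0.
Qed.

Lemma psum_ge0 p F B : psum p F B -> 0 <= B.
Proof. by move=> /(_ [::] isT); rewrite big_nil. Qed.

Lemma psum_le p F A B : psum p F A -> A <= B -> psum p F B.
Proof. by move=> h AB s us; apply: le_trans AB; exact: h. Qed.

Lemma eq_psum p F G B : F =1 G -> psum p F B -> psum p G B.
Proof. by move=> /funext ->. Qed.

Lemma psum_bound p F B n : psum p F B -> normc (F n) `^ p <= B.
Proof. by move=> /(_ [:: n] isT); rewrite big_seq1. Qed.

Lemma powRD_le p (x y : R) : 0 <= p -> 0 <= x -> 0 <= y ->
  (x + y) `^ p <= 2 `^ p * (x `^ p + y `^ p).
Proof.
move=> p0; wlog xy : x y / x <= y.
  move=> h x0 y0; have [|/ltW] := leP x y => xy; first exact: h.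
  by rewrite addrC [X in _ * X]addrC h.
move=> x0 y0; apply: (@le_trans _ _ ((2 * y) `^ p)).
  by apply: ge0_ler_powR; rewrite ?nnegrE ?addr_ge0 ?mulr_ge0// mulr_natl mulr2n lerD2r.
by rewrite powRM// ler_wpM2l ?powR_ge0// lerDr powR_ge0.
Qed.

Lemma ler_normc_powR p (z : R[i]) x : 0 <= p -> normc z <= x -> normc z `^ p <= x `^ p.
Proof.
by move=> p0 h; apply: ge0_ler_powR; rewrite // ?nnegrE ?(le_trans _ h) ?normc_ge0.
Qed.

Lemma psumD p F G A B : 0 <= p -> psum p F A -> psum p G B ->
  psum p (fun n => F n + G n) (2 `^ p * (A + B)).
Proof.
move=> p0 hF hG s us.
apply: (@le_trans _ _ (\sum_(n <- s) (2 `^ p * (normc (F n) `^ p + normc (G n) `^ p)))).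
  apply: ler_sum => n _; apply: le_trans (powRD_le p0 (normc_ge0 _) (normc_ge0 _)).
  by apply: ler_normc_powR => //; exact: ler_normcD.
by rewrite -mulr_sumr big_split/= ler_wpM2l ?powR_ge0// lerD ?hF ?hG.
Qed.

Lemma psumZ p F A (c : R[i]) : psum p F A -> psum p (fun n => c * F n) (normc c `^ p * A).
Proof.
move=> hF s us; under eq_bigr do rewrite Normc.normcM powRM ?normc_ge0//.
by rewrite -mulr_sumr ler_wpM2l ?powR_ge0// hF.
Qed.

Lemma psumN p F A : psum p F A -> psum p (fun n => - F n) A.
Proof. by move=> hF s us; under eq_bigr do rewrite normcN; exact: hF. Qed.

Lemma psum0 p : 0 < p -> psum p (fun=> 0) 0.
Proof. by move=> p0 s us; rewrite big1// => n _; rewrite Normc.normc0 powR0 ?gt_eqF. Qed.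

Lemma psum_translate p F A k : psum p F A -> psum p (fun n => F (n - k)) A.
Proof.
move=> hF s us; have := hF [seq n - k | n <- s]; rewrite big_map; apply.
by rewrite map_inj_uniq// => x y /addIr.
Qed.

(** Young's inequality for the convolution of l_1 with l_p: Jensen with the weights |a n|, then an
    exchange of sums and translation invariance. The case A = 0 is treated apart because Jensen
    divides by the bound on the total weight. *)
Lemma psum_young p (r : seq int) (a : int -> R[i]) F A B : 1 < p ->
  \sum_(n <- r) normc (a n) <= A -> psum p F B ->
  psum p (fun m => \sum_(n <- r) a n * F (m - n)) (A `^ p * B).
Proof.
move=> p1 aA hF s us; have p0 : 0 < p by exact: lt_trans p1.
have A0 : 0 <= A by apply: le_trans aA; apply: sumr_ge0 => n _; exact: normc_ge0.
have B0 := psum_ge0 hF.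
have [A00|A00] := eqVneq A 0.
  have a0 : \sum_(n <- r) normc (a n) = 0.
    apply/le_anti/andP; split; first by rewrite (le_trans aA) ?A00.
    by apply: sumr_ge0 => n _; exact: normc_ge0.
  rewrite big1 ?mulr_ge0 ?powR_ge0// => m _.
  suff -> : normc (\sum_(n <- r) a n * F (m - n)) = 0 by rewrite powR0// gt_eqF.
  apply/eqP; rewrite eq_le normc_ge0 andbT (le_trans (ler_normc_sum _ _ _))//.
  have C n : normc (F n) <= B `^ p^-1.
    have := psum_bound n hF; move/(@ge0_ler_powR R p^-1 _); rewrite -powRrM mulfV ?gt_eqF//.
    by rewrite powRr1 ?normc_ge0//; apply; rewrite ?invr_ge0 ?nnegrE ?powR_ge0// ltW.
  apply: (@le_trans _ _ (\sum_(n <- r) normc (a n) * B `^ p^-1)).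
    by apply: ler_sum => n _; rewrite Normc.normcM ler_wpM2l ?normc_ge0.
  by rewrite -mulr_suml a0 mul0r.
have {A00}A0' : 0 < A by rewrite lt_neqAle eq_sym A00.
apply: (@le_trans _ _ (\sum_(m <- s) A `^ (p - 1) * \sum_(n <- r) normc (a n) * normc (F (m - n)) `^ p)).
  apply: ler_sum => m _.
  apply: (@le_trans _ _ ((\sum_(n <- r) normc (a n) * normc (F (m - n))) `^ p)).
    apply: ler_normc_powR; first exact: ltW.
    apply: (le_trans (ler_normc_sum _ _ _)); apply: ler_sum => n _.
    by rewrite Normc.normcM.
  by apply: jensen_powR => // i; exact: normc_ge0.
rewrite -mulr_sumr exchange_big/= -(mulr_powRB1 A0 p0) [A * _]mulrC -mulrA.
rewrite ler_wpM2l ?powR_ge0//.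
apply: (@le_trans _ _ (\sum_(n <- r) normc (a n) * B)).
  apply: ler_sum => n _; rewrite -mulr_sumr ler_wpM2l ?normc_ge0//.
  exact: (psum_translate n hF).
by rewrite -mulr_suml ler_wpM2r.
Qed.

(** A Fatou principle: each bound concerns finitely many indices, so it passes to coefficientwise
    limits. The tangent inequality at |F n| bounds |F n|^p by |G n|^p plus a fixed multiple of the
    error. *)
Lemma psum_lim p F B : 1 < p ->
  (forall (s : seq int) (e : R), 0 < e -> exists2 G, psum p G B &
     forall m, m \in s -> normc (F m - G m) <= e) -> psum p F B.
Proof.
move=> p1 h s us; have p0 : 0 < p by exact: lt_trans p1.
pose K := \sum_(n <- s) p * normc (F n) `^ (p - 1).
have K0 : 0 <= K by apply: sumr_ge0 => n _; rewrite mulr_ge0 ?powR_ge0// ltW.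
apply/ler_addgt0Pr => e e0; have e1 : 0 < e / (K + 1) by rewrite divr_gt0// ltr_pwDr.
have [G hG FG] := h s _ e1.
apply: (@le_trans _ _ (\sum_(n <- s) (normc (G n) `^ p + p * normc (F n) `^ (p - 1) * (e / (K + 1))))).
  rewrite big_seq [leRHS]big_seq; apply: ler_sum => n /FG hn.
  have := powR_tangent p1 (normc_ge0 (F n)) (normc_ge0 (G n)).
  have hn2 : normc (F n) - normc (G n) <= e / (K + 1).
    apply: le_trans hn; rewrite lerBlDr.
    by rewrite -{1}(subrK (G n) (F n)) ler_normcD.
  have : p * normc (F n) `^ (p - 1) * (normc (F n) - normc (G n)) <=
         p * normc (F n) `^ (p - 1) * (e / (K + 1)).
    by rewrite ler_wpM2l// mulr_ge0 ?powR_ge0// ltW.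
  move: (e / _) (normc (F n)) (normc (G n)) => w u v; lra.
rewrite big_split/= -mulr_suml -/K; apply: lerD; first exact: hG.
by rewrite mulrCA ler_piMr ?(ltW e0)// ler_pdivrMr ?ltr_pwDr// mul1r lerDl.
Qed.

(** Young's inequality for the truncated convolutions, followed by a coefficientwise limit:
    multiplication by [f] acts on l_p with norm at most the l_1 norm of its coefficients. *)
Lemma psum_mul p (f : R -> R) (G : R -> R[i]) A B C : 1 < p -> lip f ->
  (forall s : seq int, uniq s -> \sum_(n <- s) normc (fc (creal f) n) <= A) ->
  ccontinuous G -> (forall t, normc (G t) <= C) -> psum p (fc G) B ->
  psum p (fc (fun t => creal f t * G t)) (A `^ p * B).
Proof.
move=> p1 lf fA cG GC GB; apply: psum_lim => // s e e0.
have [N hN] := fc_mul lf cG GC e0.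
exists (fun m => \sum_(n <- zrange N) fc (creal f) n * fc G (m - n)).
  by apply: psum_young => //; exact: fA (zrange_uniq N).
by move=> m _; exact: hN.
Qed.

Lemma psum_delta p : 0 < p -> psum p (fun n => (n == 0)%:R) 1.
Proof.
move=> p0 s us.
have h n : normc ((n == 0)%:R : R[i]) `^ p = (n == 0)%:R.
  by case: (n == 0); rewrite ?Normc.normc1 ?powR1// Normc.normc0 powR0 ?gt_eqF.
under eq_bigr do rewrite h.
rewrite -natr_sum -[leRHS]/(1%:R) ler_nat; elim: s us => [|n s ih] /=.
  by rewrite big_nil.
move=> /andP[ns us]; rewrite big_cons; have [n0|_] := eqVneq n 0; last by rewrite add0n ih.
rewrite big_seq big1// => m ms; case: eqP => // m0.
by move: ns; rewrite n0 -m0 ms.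
Qed.

Lemma psum_lip p (f : R -> R) : 1 < p -> lip f -> exists B, psum p (fc (creal f)) B.
Proof.
move=> p1 lf; have [A _ fA] := lip_fc_summable lf.
exists (A `^ p * 1).
have := @psum_mul p f (creal (fun=> 1)) A 1 1 p1 lf fA.
have -> : (fun t => creal f t * creal (fun=> 1) t) = creal f.
  by apply/funext => t; rewrite /creal; apply: complexP; rewrite reimE/=; ring.
apply.
- exact: creal_ccont (lip_cst _).
- by move=> t; rewrite normc_creal normr1.
- have -> : fc (creal (fun=> 1)) = (fun n => (n == 0)%:R : R[i]).
    by apply/funext => n; rewrite fc_cst mulr1.
  by apply: psum_delta; exact: lt_trans p1.
Qed.

(** Hoelder's inequality in additive form: Young's inequality for |a|/tau and tau |b|. The free
    scale [tau] is tuned to the two bounds at the place of use. *)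
Lemma psum_pairing p q (a b : int -> R[i]) A B (tau : R) (r : seq int) :
  1 < p -> 1 < q -> p^-1 + q^-1 = 1 -> 0 < tau ->
  psum p a A -> psum q b B -> uniq r ->
  normc (\sum_(n <- r) a n * b (- n)) <= (tau^-1) `^ p * A + tau `^ q * B.
Proof.
move=> p1 q1 pq t0 ha hb ur.
have p0 : 0 < p by exact: lt_trans p1.
have q0 : 0 < q by exact: lt_trans q1.
apply: (le_trans (ler_normc_sum _ _ _)).
apply: (@le_trans _ _ (\sum_(n <- r) ((tau^-1) `^ p * normc (a n) `^ p + tau `^ q * normc (b (- n)) `^ q))).
  apply: ler_sum => n _; rewrite Normc.normcM.
  have ti : 0 <= tau^-1 by rewrite invr_ge0 ltW.
  rewrite -!powRM ?normc_ge0// ?(ltW t0)//.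
  rewrite (_ : normc (a n) * _ = (tau^-1 * normc (a n)) * (tau * normc (b (- n)))); last first.
    by field; rewrite gt_eqF.
  apply: (le_trans (conjugate_powR _ _ p0 q0 pq)); rewrite ?mulr_ge0 ?normc_ge0// ?(ltW t0)//.
  by apply: lerD; rewrite ler_piMr ?powR_ge0// invf_le1// ltW.
rewrite big_split/= -!mulr_sumr; apply: lerD; rewrite ler_wpM2l ?powR_ge0//; first exact: ha.
have := hb [seq - n | n <- r]; rewrite big_map; apply.
by rewrite map_inj_uniq//; exact: oppr_inj.
Qed.
End PSum.

(** * Products of polynomials in cos(9^j t) and their digit expansion *)

Section Digits.
Variable R : realType.

Lemma digits_inj (N : nat) (a b : nat -> nat) :
  (forall j, (a j < 9)%N) -> (forall j, (b j < 9)%N) ->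
  (\sum_(j < N) a j * 9 ^ j = \sum_(j < N) b j * 9 ^ j)%N ->
  forall j, (j < N)%N -> a j = b j.
Proof.
elim: N a b => [|N ih] a b a9 b9 // e.
have shift (c : nat -> nat) : (\sum_(j < N.+1) c j * 9 ^ j = c 0 + 9 * \sum_(j < N) c j.+1 * 9 ^ j)%N.
  rewrite big_ord_recl expn0 muln1 big_distrr/=; congr addn; apply: eq_bigr => j _.
  by rewrite /bump/= add1n expnS mulnCA.
move: e; rewrite !shift => e.
have e0 : a 0%N = b 0%N by have := a9 0%N; have := b9 0%N; lia.
have e1 : (\sum_(j < N) a j.+1 * 9 ^ j = \sum_(j < N) b j.+1 * 9 ^ j)%N by lia.
by case=> // j jN; exact: (ih (fun j => a j.+1) (fun j => b j.+1)).
Qed.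

(** Balanced base 9: the digits d - 4 range over -4, ..., 4, the frequencies of a quartic polynomial
    in cos. This explains the ratio 9: each frequency of a product of such factors comes from a
    single digit string. *)
Definition freq (N : nat) (d : {ffun 'I_N -> 'I_9}) : int :=
  \sum_(j < N) ((d j)%:Z - 4) * (9 ^ j)%N%:Z.

Lemma freq_inj N : injective (@freq N).
Proof.
move=> d e; rewrite /freq.
under eq_bigr do rewrite mulrBl; under [RHS]eq_bigr do rewrite mulrBl.
rewrite !sumrB => /addIr.
under eq_bigr do rewrite -PoszM; under [RHS]eq_bigr do rewrite -PoszM.
rewrite -!(big_morph _ PoszD (erefl (Posz 0))) => -[h].
pose ext (f : {ffun 'I_N -> 'I_9}) (j : nat) := if insub j is Some i then val (f i) else 0%N.
have extE f (j : 'I_N) : ext f j = f j by rewrite /ext valK.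
have ext9 f j : (ext f j < 9)%N by rewrite /ext; case: insub => // i; exact: ltn_ord.
apply/ffunP => j; apply: val_inj; rewrite /= -!extE.
apply: (@digits_inj N (ext d) (ext e)) => //.
by under eq_bigr do rewrite extE; under [RHS]eq_bigr do rewrite extE.
Qed.

Lemma fexp_sum (I : Type) (s : seq I) (l : I -> int) (t : R) :
  fexp (\sum_(i <- s) l i) t = \prod_(i <- s) fexp (l i) t.
Proof.
elim: s => [|i s ih]; first by rewrite !big_nil fexp0.
by rewrite !big_cons fexpD ih.
Qed.

Lemma prod_digits_expand N (p : 'I_9 -> R[i]) (t : R) :
  \prod_(j < N) \sum_(d < 9) p d * expi ((d%:Z - 4)%:~R * ((9 ^ j)%N%:R * t)) =
  \sum_(d : {ffun 'I_N -> 'I_9}) (\prod_(j < N) p (d j)) * fexp (freq d) t.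
Proof.
rewrite bigA_distr_bigA/=; apply: eq_bigr => d _.
rewrite big_split/= /freq fexp_sum; congr (_ * _); apply: eq_bigr => j _.
by rewrite /fexp intrM -pmulrn mulrA.
Qed.

(* Fourier coefficients of a quartic polynomial in [cos x]; the digit [d] stands
   for the frequency [d - 4]. *)
Definition cos_digit (A0 A1 A2 A3 A4 : R) (d : nat) : R :=
  nth 0 [:: A4 / 16; A3 / 8; A2 / 4 + A4 / 4; A1 / 2 + 3 * A3 / 8;
            A0 + A2 / 2 + 3 * A4 / 8;
            A1 / 2 + 3 * A3 / 8; A2 / 4 + A4 / 4; A3 / 8; A4 / 16] d.

Definition poly4 (A0 A1 A2 A3 A4 x : R) : R :=
  A0 + A1 * x + A2 * x ^+ 2 + A3 * x ^+ 3 + A4 * x ^+ 4.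

Lemma cos_poly_expand (A0 A1 A2 A3 A4 x : R) :
  Complex (poly4 A0 A1 A2 A3 A4 (cos x)) 0 =
  \sum_(d < 9) Complex (cos_digit A0 A1 A2 A3 A4 d) 0 * expi ((d%:Z - 4)%:~R * x).
Proof.
have eN (y : R) : expi (- y) = Complex (cos y) (- sin y) by rewrite /expi cosN sinN.
have e2 : expi (2 * x) = expi x * expi x by rewrite -expiD; congr expi; ring.
have e3 : expi (3 * x) = expi x * (expi x * expi x) by rewrite -!expiD; congr expi; ring.
have e4 : expi (4 * x) = expi x * expi x * (expi x * expi x) by rewrite -!expiD; congr expi; ring.
have eNk (k : R) : expi (- k * x) = (expi (k * x))^*%C by rewrite mulNr eN.
rewrite !big_ord_recl big_ord0 /= addr0 /bump/=.
have -> : ((0%:Z - 4)%:~R : R) = - 4 by rewrite intrB; ring.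
have -> : ((1%:Z - 4)%:~R : R) = - 3 by rewrite intrB; ring.
have -> : ((2%:Z - 4)%:~R : R) = - 2 by rewrite intrB; ring.
have -> : ((3%:Z - 4)%:~R : R) = - 1 by rewrite intrB; ring.
have -> : ((4%:Z - 4)%:~R : R) = 0 by rewrite intrB; ring.
have -> : ((5%:Z - 4)%:~R : R) = 1 by rewrite intrB; ring.
have -> : ((6%:Z - 4)%:~R : R) = 2 by rewrite intrB; ring.
have -> : ((7%:Z - 4)%:~R : R) = 3 by rewrite intrB; ring.
have -> : ((8%:Z - 4)%:~R : R) = 4 by rewrite intrB; ring.
rewrite !eNk e2 e3 e4 mul0r mul1r expi0 /expi /cos_digit /poly4 /=.
have s2 := sin2cos2 x; move: (cos x) (sin x) s2 => c s s2.
apply: complexP; rewrite !reimE/=; last by field.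
transitivity (A0 + A1 * c + A2 / 2 * (1 + c ^+ 2 - s ^+ 2) +
   A3 / 4 * (3 * c + c ^+ 3 - 3 * c * s ^+ 2) +
   A4 / 8 * (3 + 4 * (c ^+ 2 - s ^+ 2) + c ^+ 4 - 6 * c ^+ 2 * s ^+ 2 + (s ^+ 2) ^+ 2)); last by field.
by rewrite s2; field.
Qed.

Lemma lip_cos9 (j : nat) : lip (fun t : R => cos ((9 ^ j)%N%:R * t)).
Proof. exact: lip_cosn (9 ^ j)%N%:Z. Qed.

Lemma lip_poly4 (A0 A1 A2 A3 A4 : R) j : lip (fun t : R => poly4 A0 A1 A2 A3 A4 (cos ((9 ^ j)%N%:R * t))).
Proof.
have lX k : lip (fun t : R => cos ((9 ^ j)%N%:R * t) ^+ k).
  elim: k => [|k ih]; first exact: lip_cst.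
  rewrite (_ : (fun _ => _) = (fun t => cos ((9 ^ j)%N%:R * t) * cos ((9 ^ j)%N%:R * t) ^+ k)).
    by apply: lipM => //; exact: lip_cos9.
  by apply/funext => t; rewrite exprS.
rewrite /poly4; do 4 (apply: lipD; last by apply: lipZ; (exact: lX || exact: lip_cos9)).
exact: lip_cst.
Qed.

Definition trigsum (T : finType) (a : T -> R[i]) (l : T -> int) (t : R) : R[i] :=
  \sum_(x : T) a x * fexp (l x) t.

Lemma fc_trigsum (T : finType) (a : T -> R[i]) (l : T -> int) n :
  fc (trigsum a l) n = \sum_(x : T) a x * (l x == n)%:R.
Proof.
rewrite fc_sum => [|x]; last by apply: ccontinuousZ; exact: continuous_fexp.
apply: eq_bigr => x _; rewrite fcZ ?fc_fexp//; exact: continuous_fexp.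
Qed.

Lemma prod_poly4_expand N (A0 A1 A2 A3 A4 : R) :
  creal (fun t => \prod_(j < N) poly4 A0 A1 A2 A3 A4 (cos ((9 ^ j)%N%:R * t))) =
  trigsum (fun d : {ffun 'I_N -> 'I_9} =>
    \prod_(j < N) Complex (cos_digit A0 A1 A2 A3 A4 (d j)) 0) (@freq N).
Proof.
apply/funext => t.
rewrite /trigsum -(@prod_digits_expand N (fun d => Complex (cos_digit A0 A1 A2 A3 A4 d) 0)).
under [RHS]eq_bigr do rewrite -cos_poly_expand.
rewrite /creal; elim/big_rec2: _ => // j x y _ <-.
by apply: complexP; rewrite reimE/= ?mulr0 ?mul0r ?subr0 ?addr0.
Qed.

(** Only the string of digits 4 has frequency 0, so the factors behave like independent variables.
    The base of the power is the mean of one factor, cos^2 and cos^4 having means 1/2 and 3/8 and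
    odd powers mean 0. *)
Lemma mean_prod_poly4 N (A0 A1 A2 A3 A4 : R) :
  mean (fun t => \prod_(j < N) poly4 A0 A1 A2 A3 A4 (cos ((9 ^ j)%N%:R * t))) =
  (A0 + A2 / 2 + 3 * A4 / 8) ^+ N.
Proof.
set f := (fun t => _).
have -> : mean f = re (fc (creal f) 0).
  apply: eq_mean => t; have e : creal f t * fexp (- 0) t = creal f t.
    by rewrite oppr0 fexp0 mulr1.
  by rewrite e.
rewrite prod_poly4_expand fc_trigsum.
pose d4 : {ffun 'I_N -> 'I_9} := [ffun=> inord 4].
have f4 : freq d4 = 0 by rewrite /freq big1// => j _; rewrite ffunE inordK// subrr mul0r.
rewrite (bigD1 d4)//= f4 eqxx mulr1 [X in _ + X]big1 ?addr0; last first.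
  move=> d dd; have -> : (freq d == 0) = (d == d4) by rewrite -(inj_eq (@freq_inj N)) f4.
  by rewrite (negPf dd) mulr0.
under eq_bigr do rewrite ffunE inordK//.
rewrite prodr_const card_ord.
have H k (x : R) : Complex x 0 ^+ k = Complex (x ^+ k) 0.
  elim: k => // k ih; rewrite !exprS ih; apply: complexP; rewrite reimE/= ?mulr0 ?mul0r ?subr0 ?addr0//.
by rewrite H.
Qed.

Lemma psum_trigsum (T : finType) (p : R) (a : T -> R[i]) (l : T -> int) : 0 < p -> injective l ->
  psum p (fun n => \sum_(x : T) a x * (l x == n)%:R) (\sum_(x : T) normc (a x) `^ p).
Proof.
move=> p0 li s us.
have h n : normc (\sum_(x : T) a x * (l x == n)%:R) `^ p =
    \sum_(x : T) normc (a x) `^ p * (l x == n)%:R.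
  case: (pickP (fun x => l x == n)) => [x /eqP <-|nx].
    rewrite (bigD1 x)//= eqxx mulr1 big1 ?addr0; last first.
      by move=> y yx; rewrite (inj_eq li) (negPf yx) mulr0.
    rewrite (bigD1 x)//= eqxx mulr1 big1 ?addr0//.
    by move=> y yx; rewrite (inj_eq li) (negPf yx) mulr0.
  rewrite big1 => [|x _]; last by rewrite nx mulr0.
  by rewrite Normc.normc0 powR0 ?gt_eqF// big1// => x _; rewrite nx mulr0.
under eq_bigr do rewrite h.
rewrite exchange_big/=; apply: ler_sum => x _; rewrite -mulr_sumr ler_piMr ?powR_ge0//.
case: (boolP (l x \in s)) => [ls|ls].
  rewrite (bigD1_seq (l x))//= eqxx big1 ?addr0// => n; rewrite eq_sym => /negPf ->//.
rewrite big_seq big1// => n ns; case: eqP => // e; by rewrite e ns in ls.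
Qed.
End Digits.

(** * Elementary bounds for exp, and signed weights with vanishing moments *)

Section Weights.
Variable R : realType.

Lemma expR1_le4 : expR 1 <= 4 :> R.
Proof.
have h : 2^-1 <= expR (- 2^-1) :> R.
  by apply: le_trans (expR_ge1Dx _); lra.
have e2 : expR 2^-1 <= 2 :> R.
  by rewrite -[leLHS]invrK -expRN invf_ple ?posrE ?expR_gt0.
have -> : expR 1 = expR 2^-1 * expR 2^-1 :> R by rewrite -expRD; congr expR; lra.
have := expR_ge0 (2^-1 : R); nra.
Qed.

Lemma expR_ge2 : 2 <= expR 1 :> R.
Proof. by apply: le_trans (expR_ge1Dx _); lra. Qed.

(** With z = y/4, e^y is at most (1 - z)^(-4), and the claim becomes a polynomial inequality. The
    constant 3/4, rather than the 1/2 of the Taylor expansion, provides the room for it. *)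
Lemma expR_le_quadratic (y : R) : `|y| <= 4^-1 -> expR y <= 1 + y + 3 / 4 * y ^+ 2.
Proof.
rewrite ler_norml => /andP[y1 y2]; pose z := y / 4.
have yz : y = 4 * z by rewrite /z; field.
have z1 : - 16^-1 <= z by rewrite /z; lra.
have z2 : z <= 16^-1 by rewrite /z; lra.
have e1 : expR z * (1 - z) <= 1.
  by rewrite -[leRHS](expRxMexpNx_1 z) ler_wpM2l ?expR_ge0// expR_ge1Dx.
have -> : expR y = expR z ^+ 4 by rewrite yz -expRM_natl.
have z3 : 0 < 1 - z by lra.
have e4 : expR z ^+ 4 * (1 - z) ^+ 4 <= 1.
  by rewrite -exprMn exprn_ile1// mulr_ge0 ?expR_ge0 ?ltW.
rewrite -(ler_pM2r (exprn_gt0 4 z3)) (le_trans e4)// yz -subr_ge0.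
rewrite (_ : _ - 1 = z ^+ 2 * (2 - 28 * z + 57 * z ^+ 2 - 44 * z ^+ 3 + 12 * z ^+ 4)); last by field.
rewrite mulr_ge0 ?sqr_ge0//.
have z20 : 0 <= z ^+ 2 by exact: sqr_ge0.
have -> : z ^+ 3 = z ^+ 2 * z by ring.
have -> : z ^+ 4 = z ^+ 2 * z ^+ 2 by ring.
nra.
Qed.

Lemma onePinv_expr_le4 (M : nat) : (0 < M)%N -> (1 + M%:R^-1) ^+ M <= 4 :> R.
Proof.
move=> M0; apply: le_trans expR1_le4.
have M0' : 0 < M%:R :> R by rewrite ltr0n.
have -> : expR 1 = expR (M%:R^-1) ^+ M :> R by rewrite -expRM_natl mulfV ?gt_eqF.
by apply: lerXn2r; rewrite ?nnegrE ?expR_ge0 ?expR_ge1Dx// addr_ge0// invr_ge0 ltW.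
Qed.

(** A single term of the exponential series at M is at most e^M, and e <= 4. This makes the product
    of the M/j over j <= M at most exponential in M. *)
Lemma exprn_le_fact (M : nat) : (0 < M)%N -> M%:R ^+ M <= 4 ^+ M * M`!%:R :> R.
Proof.
case: M => // M _; rewrite -ler_pdivrMr ?ltr0n ?fact_gt0//.
apply: (@le_trans _ _ (expR M.+1%:R)).
  apply: le_trans (expR_ge1Dxn M _); rewrite ?ler0n//.
  by rewrite lerDr.
rewrite -[M.+1%:R]mulr1 expRM_natl; apply: lerXn2r; rewrite ?nnegrE ?expR_ge0//.
exact: expR1_le4.
Qed.

(* The weights are the coefficients of prod_(0 < j <= M) (lam^j - z) / (lam^j - 1),
   which is 1 at z = 1 and vanishes at z = lam^k for 0 < k <= M. *)
Lemma moment_weights (M : nat) (b : R) : (0 < M)%N -> 0 < b ->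
  exists (T : finType) (w c : T -> R),
  [/\ \sum_(A : T) w A = 1,
      forall k, (0 < k <= M)%N -> \sum_(A : T) w A * c A ^+ k = 0,
      \sum_(A : T) `|w A| <= 20 ^+ M &
      forall A, b <= c A <= 4 * b].
Proof.
move=> M0 b0; have M0' : 0 < M%:R :> R by rewrite ltr0n.
(* This ratio keeps all nodes within a factor 4, since lam^M <= 4, and yet lam^j - 1 >= j/M; the
   factors of the total variation are then at most 5M/j and multiply to at most 20^M. *)
pose lam : R := 1 + M%:R^-1.
have lam1 : 1 < lam by rewrite ltrDl invr_gt0.
have lam0 : 0 < lam by exact: lt_trans lam1.
pose den (j : 'I_M) := lam ^+ j.+1 - 1.
have lamD (j : 'I_M) : 1 + j.+1%:R / M%:R <= lam ^+ j.+1.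
  elim: (j.+1) => [|k ih]; first by rewrite mul0r addr0 expr0.
  rewrite exprS; apply: (@le_trans _ _ (lam * (1 + k%:R / M%:R))); last by rewrite ler_pM2l.
  rewrite /lam -natr1 -subr_ge0.
  rewrite (_ : _ - _ = k%:R * (M%:R^-1) ^+ 2); last by field; rewrite gt_eqF.
  by rewrite mulr_ge0// sqr_ge0.
have denM (j : 'I_M) : j.+1%:R / M%:R <= den j by rewrite /den lerBrDl.
have den0 j : 0 < den j by apply: lt_le_trans (denM j); rewrite divr_gt0.
have lam4 (j : nat) : (j <= M)%N -> lam ^+ j <= 4.
  move=> jM; apply: le_trans (onePinv_expr_le4 M0).
  by rewrite ler_weXn2l// ltW.
(* The product is expanded over subsets: [A j] tells whether the factor attached to lam^(j+1)
   contributes its term in z, so that [c A] is b lam^(#A). *)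
pose wt (j : 'I_M) (x : bool) := if x then - (den j)^-1 else lam ^+ j.+1 / den j.
pose w (A : {ffun 'I_M -> bool}) := \prod_(j < M) wt j (A j).
pose c (A : {ffun 'I_M -> bool}) := b * \prod_(j < M) (if A j then lam else 1).
have mom k : \sum_(A : {ffun 'I_M -> bool}) w A * c A ^+ k =
    b ^+ k * \prod_(j < M) ((lam ^+ j.+1 - lam ^+ k) / den j).
  transitivity (b ^+ k * \prod_(j < M) \sum_(x : bool) wt j x * (if x then lam else 1) ^+ k).
    rewrite bigA_distr_bigA/= mulr_sumr; apply: eq_bigr => A _.
    by rewrite big_split/= /c exprMn -prodrXl mulrCA.
  congr (_ * _); apply: eq_bigr => j _; rewrite big_bool/= expr1n.
  by field; rewrite gt_eqF.
exists {ffun 'I_M -> bool}, w, c; split.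
- have := mom 0%N; under eq_bigr do rewrite expr0 mulr1.
  move=> ->; rewrite expr0 mul1r big1// => j _; rewrite expr0 mulfV//; exact: lt0r_neq0 (den0 j).
- move=> k /andP[k0 kM]; rewrite mom.
  have kM' : (k.-1 < M)%N by rewrite prednK.
  by rewrite (bigD1 (Ordinal kM'))//= prednK// subrr !mul0r mulr0.
- have -> : \sum_A `|w A| = \prod_(j < M) ((lam ^+ j.+1 + 1) / den j).
    transitivity (\prod_(j < M) \sum_(x : bool) `|wt j x|).
      by rewrite bigA_distr_bigA/=; apply: eq_bigr => A _; rewrite normr_prod.
    apply: eq_bigr => j _; rewrite big_bool/= normrN normrM.
    rewrite (ger0_norm (exprn_ge0 _ (ltW lam0))) ger0_norm ?invr_ge0 ?(ltW (den0 j))//.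
    by rewrite [RHS]mulrDl mul1r addrC.
  apply: (@le_trans _ _ (\prod_(j < M) (5 * M%:R / j.+1%:R))).
    apply: ler_prod => j _; apply/andP; split.
      by rewrite divr_ge0 ?(ltW (den0 j))// addr_ge0// exprn_ge0// ltW.
    rewrite -mulrA; apply: ler_pM.
    - by rewrite addr_ge0// exprn_ge0// ltW.
    - by rewrite invr_ge0 ltW.
    - have := lam4 j.+1 (ltn_ord j); lra.
    - by rewrite -invf_div lef_pV2 ?posrE ?divr_gt0.
  rewrite big_split/= prodr_const card_ord prodfV -natr_prod.
  have -> : (\prod_(i < M) i.+1)%N = M`! by rewrite fact_prod big_add1 big_mkord.
  rewrite ler_pdivrMr ?ltr0n ?fact_gt0// exprMn.
  have -> : 20 = 5 * 4 :> R by lra.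
  by rewrite exprMn -mulrA ler_wpM2l ?exprn_ge0// exprn_le_fact.
- move=> A; rewrite /c; apply/andP; split.
    rewrite ler_peMr ?(ltW b0)//; elim/big_ind: _ => // [x y|j _]; first exact: mulr_ege1.
    by case: (A j); rewrite // ltW.
  rewrite mulrC ler_pM2r//; apply: (@le_trans _ _ (\prod_(j < M) lam)).
    apply: ler_prod => j _; case: (A j); rewrite ?(ltW lam0) ?lexx//= ?ler01 ?ltW//.
  by rewrite prodr_const card_ord lam4.
Qed.
End Weights.

(** * The average of lacunary cosines and the mixtures of Riesz products *)

Section AverageAndRiesz.
Variable R : realType.

Definition avgcos (N : nat) (t : R) : R := N%:R^-1 * \sum_(j < N) cos ((9 ^ j)%N%:R * t).

Lemma lip_avgcos N : lip (avgcos N).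
Proof. by apply: lipZ; apply: lip_sum => j; exact: lip_cos9. Qed.

Lemma avgcos_le1 N t : `|avgcos N t| <= 1.
Proof.
case: N => [|N]; first by rewrite /avgcos big_ord0 mulr0 normr0.
rewrite /avgcos normrM ger0_norm ?invr_ge0// ler_pdivrMl ?ltr0n// mulr1.
apply: (le_trans (ler_norm_sum _ _ _)).
apply: (@le_trans _ _ (\sum_(j < N.+1) 1)); last by rewrite sumr_const card_ord.
by apply: ler_sum => j _; exact: cos_max.
Qed.

(** The average has 2N distinct frequencies, each with coefficient 1/(2N); for p > 1 the resulting
    value tends to 0 as N grows. *)
Lemma psum_avgcos N p : (0 < N)%N -> 0 < p ->
  psum p (fc (creal (avgcos N))) ((2 * N%:R) `^ (1 - p)).
Proof.
move=> N0 p0; have N0' : 0 < 2 * N%:R :> R by rewrite mulr_gt0// ltr0n.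
pose l (x : 'I_N * bool) : int := if x.2 then (9 ^ x.1)%N%:Z else - (9 ^ x.1)%N%:Z.
have li : injective l.
  move=> [i a] [j b]; rewrite /l /=.
  have ei : (0 < 9 ^ i)%N by rewrite expn_gt0.
  have ej : (0 < 9 ^ j)%N by rewrite expn_gt0.
  have H : (9 ^ i = 9 ^ j -> i = j)%N.
    by move=> /eqP; rewrite eqn_exp2l// => /eqP/val_inj.
  case: a; case: b => h.
  - by rewrite (H _)//; lia.
  - by exfalso; lia.
  - by exfalso; lia.
  - by rewrite (H _)//; lia.
have -> : creal (avgcos N) = trigsum (fun=> Complex (2 * N%:R)^-1 0) l.
  apply/funext => t; rewrite /trigsum -(pair_bigA _ (fun i b => Complex (2 * N%:R)^-1 0 * fexp (l (i, b)) t))/=.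
  under eq_bigr do rewrite big_bool/=.
  have e (j : 'I_N) : Complex (2 * N%:R)^-1 0 * fexp (l (j, true)) t +
      Complex (2 * N%:R)^-1 0 * fexp (l (j, false)) t =
      Complex (N%:R^-1 * cos ((9 ^ j)%N%:R * t)) 0.
    rewrite /l/= /fexp mulrNz mulNr /expi cosN sinN -pmulrn.
    by apply: complexP; rewrite !reimE/=; [field; rewrite gt_eqF ?ltr0n|ring].
  under eq_bigr do rewrite e.
  rewrite /creal /avgcos mulr_sumr; elim/big_rec2: _ => // j x y _ ih.
  by rewrite -ih; apply: complexP; rewrite reimE/= ?addr0.
have -> : fc (trigsum (fun=> Complex (2 * N%:R)^-1 0) l) =
    fun n => \sum_(x : 'I_N * bool) Complex (2 * N%:R)^-1 0 * (l x == n)%:R :> R[i].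
  by apply/funext => n; rewrite fc_trigsum.
apply: psum_le (psum_trigsum _ p0 li) _.
rewrite normc_real sumr_const card_prod card_ord card_bool.
rewrite ger0_norm ?invr_ge0 ?(ltW N0')// -[leLHS]mulr_natl natrM [N%:R * _]mulrC.
move: (2 * N%:R) N0' => x x0; rewrite powRD ?(lt0r_neq0 x0) ?implybT// powRr1 ?(ltW x0)//.
by rewrite ler_pM2l// -(powR_inv1 (ltW x0)) -powRrM mulN1r.
Qed.

(** The factors 1 + 2c cos are written through [poly4] to share the digit expansion with the quartic
    products. *)
Definition riesz (N : nat) (c t : R) : R :=
  \prod_(j < N) poly4 1 (2 * c) 0 0 0 (cos ((9 ^ j)%N%:R * t)).

Lemma lip_riesz N c : lip (riesz N c).
Proof. by apply: lip_prod => j; exact: lip_poly4. Qed.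

Lemma sum_Complex (I : Type) (s : seq I) (F : I -> R) :
  \sum_(i <- s) Complex (F i) 0 = Complex (\sum_(i <- s) F i) 0 :> R[i].
Proof.
elim: s => [|i s ih]; first by rewrite !big_nil.
by rewrite !big_cons ih; apply: complexP; rewrite reimE/= ?addr0.
Qed.

Lemma creal_sum (T : finType) (w : T -> R) (f : T -> R -> R) :
  creal (fun t => \sum_A w A * f A t) = fun t => \sum_A Complex (w A) 0 * creal (f A) t.
Proof.
apply/funext => t; rewrite /creal; elim/big_rec2: _ => // A x y _ <-.
by apply: complexP; rewrite !reimE/=; ring.
Qed.

(* The digits 3, 4, 5 stand for the frequencies -1, 0, 1. *)
Definition digit345 (d : nat) : R := ((d == 3) || (d == 4) || (d == 5))%N%:R.

Lemma cos_digit_riesz (c : R) (d : 'I_9) :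
  cos_digit 1 (2 * c) 0 0 0 d = digit345 d * c ^+ (val d != 4%N).
Proof.
case: d => d; rewrite /cos_digit /digit345 /=.
by do 9 (case: d => [_|d] /=; first by field); lia.
Qed.

(** At an admissible digit string, the coefficient of a Riesz product is [c A] to the power of the
    number of digits other than 4; mixing turns it into a moment of the weights [w]. *)
Lemma fc_riesz_mix N (T : finType) (w c : T -> R) n :
  fc (creal (fun t => \sum_(A : T) w A * riesz N (c A) t)) n =
  \sum_(d : {ffun 'I_N -> 'I_9})
    Complex (\prod_(j < N) digit345 (d j) *
      \sum_(A : T) w A * c A ^+ (\sum_(j < N) (val (d j) != 4%N))) 0 * (freq d == n)%:R.
Proof.
rewrite creal_sum fc_sum; last by move=> A; apply: ccontinuousZ; apply: creal_ccont; exact: lip_riesz.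
transitivity (\sum_(A : T) \sum_(d : {ffun 'I_N -> 'I_9}) Complex (w A * (\prod_(j < N) digit345 (d j) *
   c A ^+ (\sum_(j < N) (val (d j) != 4%N)))) 0 * (freq d == n)%:R).
  apply: eq_bigr => A _; rewrite fcZ; last by apply: creal_ccont; exact: lip_riesz.
  rewrite prod_poly4_expand fc_trigsum mulr_sumr; apply: eq_bigr => d _.
  rewrite mulrA; congr (_ * _).
  under eq_bigr do rewrite cos_digit_riesz.
  have -> : \prod_(j < N) Complex (digit345 (d j) * c A ^+ (val (d j) != 4%N)) 0 =
     Complex (\prod_(j < N) (digit345 (d j) * c A ^+ (val (d j) != 4%N))) 0.
    elim/big_rec2: _ => // j x y _ ->; apply: complexP; rewrite !reimE/=; ring.
  by rewrite big_split/= prodrXr; apply: complexP; rewrite !reimE/=; ring.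
rewrite exchange_big/=; apply: eq_bigr => d _.
rewrite -mulr_suml; congr (_ * _); rewrite sum_Complex mulr_sumr; congr Complex.
by apply: eq_bigr => A _; rewrite mulrCA.
Qed.
End AverageAndRiesz.

(** * Estimates in l_q for the mixture and for the part that is cut off *)

Section KeyEstimates.
Variable R : realType.

Lemma exprn_powR (a q : R) k : 0 <= a -> (a ^+ k) `^ q = (a `^ q) ^+ k.
Proof. by move=> a0; rewrite -(powR_mulrn k a0) powRAC powR_mulrn ?powR_ge0. Qed.

Lemma digit_weights_sum (y : R) :
  \sum_(d < 9) digit345 R d * (8 * y) ^+ (val d != 4%N) = 1 + 16 * y.
Proof. by rewrite !big_ord_recl big_ord0 /digit345 /= /bump /=; ring. Qed.

(** The total [20 ^+ M] of the weights is absorbed because only moments of order k > M survive: 20^M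
    (4b)^k <= (80b)^k. With y = (80b)^q, the sum over all strings factors over the digits into (1 +
    16y)^N, which the hypothesis on N keeps below e^M <= 4^M, against a gain of 8^(-M). *)
Lemma psum_riesz_mix (N M : nat) (q b : R) (T : finType) (w c : T -> R) :
  0 < q -> 0 < b -> (16 * (80 * b) `^ q) * N%:R <= M%:R ->
  \sum_(A : T) w A = 1 ->
  (forall k, (0 < k <= M)%N -> \sum_(A : T) w A * c A ^+ k = 0) ->
  \sum_(A : T) `|w A| <= 20 ^+ M -> (forall A, b <= c A <= 4 * b) ->
  psum q (fun n => fc (creal (fun t => \sum_(A : T) w A * riesz N (c A) t)) n - (n == 0)%:R)
    (2^-1 ^+ M).
Proof.
move=> q0 b0 hN w1 wk wM cb; set y := (80 * b) `^ q.
have y0 : 0 < y by rewrite powR_gt0 ?mulr_gt0.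
pose k (d : {ffun 'I_N -> 'I_9}) := (\sum_(j < N) (val (d j) != 4%N))%N.
pose g (d : {ffun 'I_N -> 'I_9}) := \prod_(j < N) digit345 R (d j).
pose d4 : {ffun 'I_N -> 'I_9} := [ffun=> inord 4].
have f4 : freq d4 = 0 by rewrite /freq big1// => j _; rewrite ffunE inordK// subrr mul0r.
have k4 d : k d = 0%N -> d = d4.
  move=> /eqP; rewrite sum_nat_eq0 => /forallP h; apply/ffunP => j; apply: val_inj.
  by rewrite ffunE /= inordK//; apply/eqP; move: (h j); rewrite /= eqb0 negbK.
have kd4 : k d4 = 0%N by apply: big1 => j _; rewrite ffunE /= inordK.
have g4 : g d4 = 1 by apply: big1 => j _; rewrite ffunE /digit345 inordK.
pose x d := g d * (\sum_A w A * c A ^+ k d) - (d == d4)%:R.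
have E n : fc (creal (fun t => \sum_(A : T) w A * riesz N (c A) t)) n - (n == 0)%:R =
    \sum_(d : {ffun 'I_N -> 'I_9}) Complex (x d) 0 * (freq d == n)%:R.
  have -> : (n == 0)%:R = \sum_(d : {ffun 'I_N -> 'I_9}) (d == d4)%:R * (freq d == n)%:R :> R[i].
    rewrite (bigD1 d4)//= eqxx mul1r f4 eq_sym big1 ?addr0// => d /negPf ->.
    by rewrite mul0r.
  rewrite fc_riesz_mix -sumrB; apply: eq_bigr => d _; rewrite -mulrBl; congr (_ * _).
  rewrite -/(g d) -/(k d) /x; case: (d == d4); apply: complexP; rewrite !reimE//=; ring.
move=> s us; under eq_bigr do rewrite E.
apply: (le_trans (@psum_trigsum R _ q _ _ q0 (@freq_inj N) s us)).
have g01 d : g d = 0 \/ g d = 1.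
  rewrite /g; elim/big_ind: _ => [|u v|j _]; first by right.
    by move=> [->|->] [->|->]; rewrite ?mulr0 ?mul0r ?mulr1; [left|left|left|right].
  by rewrite /digit345; case: (_ || _); [right|left].
have g0 d : 0 <= g d by case: (g01 d) => ->.
(* Only the terms with [M < k d] survive, and there y^k <= 8^-M (8 y)^k. *)
apply: (@le_trans _ _ (\sum_(d : {ffun 'I_N -> 'I_9}) 8^-1 ^+ M * (g d * (8 * y) ^+ k d))).
  apply: ler_sum => d _; rewrite normc_real.
  have rhs0 : 0 <= 8^-1 ^+ M * (g d * (8 * y) ^+ k d).
    by rewrite !mulr_ge0 ?exprn_ge0// ?mulr_ge0 ?(ltW y0)// invr_ge0.
  rewrite /x; have [dE|dd] := eqVneq d d4.
    suff -> : g d * (\sum_A w A * c A ^+ k d) - true%:R = 0 by rewrite normr0 powR0 ?gt_eqF.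
    rewrite dE kd4 g4 mul1r; under eq_bigr do rewrite mulr1.
    by rewrite w1 subrr.
  rewrite subr0; case: (g01 d) => gd; rewrite gd in rhs0 *.
    by rewrite mul0r normr0 powR0 ?gt_eqF.
  rewrite !mul1r in rhs0 *; have kd : (0 < k d)%N.
    by rewrite lt0n; apply: contra dd => /eqP /k4 ->.
  have [kM|kM] := leqP (k d) M.
    by have := wk (k d); rewrite kd kM => /(_ isT) ->; rewrite normr0 powR0 ?gt_eqF.
  have b80 : 0 <= 80 * b by rewrite mulr_ge0// ltW.
  apply: (@le_trans _ _ (((80 * b) ^+ k d) `^ q)).
    apply: ge0_ler_powR; rewrite ?nnegrE ?exprn_ge0// ?(ltW q0)//.
    apply: (le_trans (ler_norm_sum _ _ _)).
    apply: (@le_trans _ _ (\sum_(A : T) `|w A| * (4 * b) ^+ k d)).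
      apply: ler_sum => A _; rewrite normrM ler_wpM2l//.
      have /andP[c1 c2] := cb A; have c0 : 0 <= c A := le_trans (ltW b0) c1.
      by rewrite ger0_norm ?exprn_ge0//; apply: lerXn2r; rewrite ?nnegrE// mulr_ge0// ltW.
    rewrite -mulr_suml (_ : 80 * b = 20 * (4 * b)); last by ring.
    rewrite [leRHS]exprMn ler_wpM2r ?exprn_ge0 ?mulr_ge0 ?(ltW b0)// (le_trans wM)//.
    by rewrite ler_weXn2l ?ler1n// ltnW.
  rewrite exprn_powR// -/y exprMn mulrA ler_peMl ?exprn_ge0 ?(ltW y0)//.
  rewrite -(subnK (ltnW kM)) exprD mulrCA -exprMn mulVf// expr1n mulr1.
  by rewrite exprn_ege1// ler1n.
rewrite -mulr_sumr.
have -> : \sum_(d : {ffun 'I_N -> 'I_9}) g d * (8 * y) ^+ k d = (1 + 16 * y) ^+ N.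
  under eq_bigr do rewrite -prodrXr -big_split/=.
  rewrite -(bigA_distr_bigA (fun (j : 'I_N) (d : 'I_9) => digit345 R d * (8 * y) ^+ (val d != 4%N)))/=.
  by under eq_bigr do rewrite digit_weights_sum; rewrite prodr_const card_ord.
apply: (@le_trans _ _ (8^-1 ^+ M * 4 ^+ M)).
  rewrite ler_wpM2l ?exprn_ge0 ?invr_ge0//.
  apply: (@le_trans _ _ (expR (16 * y) ^+ N)).
    by apply: lerXn2r; rewrite ?nnegrE ?expR_ge0 ?expR_ge1Dx// addr_ge0// mulr_ge0// ltW.
  rewrite -expRM_natr; apply: (@le_trans _ _ (expR M%:R)); first by rewrite ler_expR.
  rewrite -[M%:R]mulr1 expRM_natl; apply: lerXn2r; rewrite ?nnegrE ?expR_ge0//.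
  exact: expR1_le4.
by rewrite -exprMn (_ : 8^-1 * 4 = 2^-1)//; field.
Qed.

(* On {avgcos N <= b / 8} this majorizes the square of the Riesz product: there
   expR (b * c / 4) ^+ N dominates prod_j expR (2 c cos(9^j t)), and each factor
   expR (- 2 c x) is bounded by 1 - 2 c x + 3/4 (2 c x)^2; the quartic polynomial
   is (1 + 2 c x)^2 times that bound. *)
Definition riesz_tail (N : nat) (b c t : R) : R :=
  expR (b * c / 4) ^+ N *
  \prod_(j < N) poly4 1 (2 * c) (- c ^+ 2) (4 * c ^+ 3) (12 * c ^+ 4) (cos ((9 ^ j)%N%:R * t)).

Lemma lip_riesz_tail (N : nat) (b c : R) : lip (riesz_tail N b c).
Proof. by apply: lipZ; apply: lip_prod => j; exact: lip_poly4. Qed.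

Lemma riesz_tail_factor (c x : R) :
  poly4 1 (2 * c) (- c ^+ 2) (4 * c ^+ 3) (12 * c ^+ 4) x =
  (1 + 2 * c * x) ^+ 2 * (1 - 2 * c * x + 3 / 4 * (2 * c * x) ^+ 2).
Proof. by rewrite /poly4; field. Qed.

Lemma riesz_tail_ge0 (N : nat) (b c t : R) : 0 <= riesz_tail N b c t.
Proof.
rewrite mulr_ge0 ?exprn_ge0 ?expR_ge0//; apply: prodr_ge0 => j _.
rewrite riesz_tail_factor mulr_ge0 ?sqr_ge0//.
move: (2 * c * _) => u; nra.
Qed.

Lemma riesz_tail_major (N : nat) (b c t : R) : 0 < b -> b <= c -> c <= 8^-1 -> avgcos N t <= b / 8 ->
  riesz N c t ^+ 2 <= riesz_tail N b c t.
Proof.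
move=> b0 bc c8 ht; have c0 : 0 < c := lt_le_trans b0 bc.
pose K j := cos ((9 ^ j)%N%:R * t).
have [->|N0] := eqVneq N 0%N; first by rewrite /riesz /riesz_tail !big_ord0 expr1n expr0 mulr1.
rewrite /riesz_tail.
under eq_bigr do rewrite riesz_tail_factor.
rewrite big_split/= /riesz -prodrXl.
have -> : \prod_(j < N) poly4 1 (2 * c) 0 0 0 (cos ((9 ^ j)%N%:R * t)) ^+ 2 =
   \prod_(j < N) (1 + 2 * c * cos ((9 ^ j)%N%:R * t)) ^+ 2.
  by apply: eq_bigr => j _; rewrite /poly4; congr (_ ^+ 2); ring.
rewrite mulrCA ler_peMr//; first by apply: prodr_ge0 => j _; exact: sqr_ge0.
apply: (@le_trans _ _ (expR (b * c / 4) ^+ N * \prod_(j < N) expR (- (2 * c * K j)))).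
  rewrite -expR_sum -expRM_natl -expRD -[leLHS]expR0 ler_expR.
  rewrite sumrN -mulr_sumr.
  have : \sum_(j < N) K j <= b / 8 * N%:R.
    by move: ht; rewrite /avgcos mulrC ler_pdivrMr// ltr0n lt0n.
  move: (\sum_(_ < _) _) => S hS.
  have : 2 * c * S <= 2 * c * (b / 8 * N%:R) by rewrite ler_wpM2l// mulr_ge0// ltW.
  move: (N%:R) => n; lra.
rewrite ler_wpM2l ?exprn_ge0 ?expR_ge0//; apply: ler_prod => j _; rewrite expR_ge0/=.
have := @expR_le_quadratic R (- (2 * c * K j)); rewrite sqrrN; apply.
rewrite normrN normrM (le_trans (ler_piMr _ (cos_max _)))// ger0_norm ?mulr_ge0 ?(ltW c0)//.
lra.
Qed.

(** By independence the mean is the N-th power of e^(bc/4) (1 - c^2/2 + 9c^4/2). As c <= 1/8, the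
    second factor is at most e^(-42c^2/100); since bc/4 <= 25c^2/100, the exponent -17/100 remains,
    and b <= c. *)
Lemma mean_riesz_tail (N : nat) (b c : R) : 0 < b -> b <= c -> c <= 8^-1 ->
  mean (riesz_tail N b c) <= expR (- (17 / 100 * b ^+ 2)) ^+ N.
Proof.
move=> b0 bc c8; have c0 : 0 < c := lt_le_trans b0 bc.
rewrite /riesz_tail meanZ; last by apply: lip_cont; apply: lip_prod => j; exact: lip_poly4.
rewrite mean_prod_poly4 -exprMn.
have c2 : c ^+ 2 <= 64^-1.
  have -> : 64^-1 = 8^-1 ^+ 2 :> R by field.
  by rewrite ler_sqr ?nnegrE// ltW.
have c20 : 0 <= c ^+ 2 := sqr_ge0 c.
have bc2 : b * c <= c ^+ 2 by rewrite expr2 ler_wpM2r// ltW.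
have b2 : b ^+ 2 <= c ^+ 2 by rewrite ler_sqr ?nnegrE// ltW.
have h0 : 0 <= 1 + - c ^+ 2 / 2 + 3 * (12 * c ^+ 4) / 8.
  have -> : c ^+ 4 = c ^+ 2 * c ^+ 2 by rewrite -exprD.
  nra.
apply: lerXn2r; rewrite ?nnegrE ?mulr_ge0 ?expR_ge0//.
apply: (@le_trans _ _ (expR (b * c / 4) * expR (- (42 / 100 * c ^+ 2)))).
  rewrite ler_wpM2l ?expR_ge0// (le_trans _ (expR_ge1Dx _))//.
  have -> : c ^+ 4 = c ^+ 2 * c ^+ 2 by rewrite -exprD.
  nra.
by rewrite -expRD ler_expR; lra.
Qed.

(** Coefficients a of modulus at most 1 satisfy |a|^q <= |a|^2 for q >= 2, so Bessel's inequality
    already bounds the l_q sum. *)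
Lemma psum_of_energy (q E : R) (F : R -> R[i]) : 2 <= q -> ccontinuous F ->
  mean (fun t => normc (F t) ^+ 2) <= E -> E <= 1 -> psum q (fc F) E.
Proof.
move=> q2 cF hE E1 s us; apply: (le_trans _ hE); apply: le_trans (bessel cF us).
apply: ler_sum => n _; set a := normc _; have a0 : 0 <= a := normc_ge0 _.
have a1 : a <= 1.
  have := @bessel R F [:: n] cF isT; rewrite big_seq1 -/a => h.
  rewrite -(@ler_sqr _ a 1) ?nnegrE// expr1n (le_trans h)// (le_trans hE)//.
have [->|an] := eqVneq a 0; first by rewrite powR0 ?sqr_ge0// gt_eqF// (lt_le_trans _ q2).
by rewrite -powR_mulrn// ger_powR// lt0r an a0.
Qed.
End KeyEstimates.

(** * The key lemma *)

Section KeyLemma.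
Variable R : realType.

(** Cauchy-Schwarz for signed weights, from Jensen with exponent 2. It costs a factor [W], and the
    remaining sum of the |w A| a second one: hence 20^(2M) in the end. *)
Lemma sqr_mix_le (T : finType) (w f : T -> R) (W : R) : 0 < W -> \sum_A `|w A| <= W ->
  (\sum_A w A * f A) ^+ 2 <= W * \sum_A `|w A| * f A ^+ 2.
Proof.
move=> W0 wW; apply: (@le_trans _ _ ((\sum_A `|w A| * `|f A|) ^+ 2)).
  rewrite -[leLHS]real_normK ?num_real//.
  apply: lerXn2r; rewrite ?nnegrE ?normr_ge0//.
    by apply: sumr_ge0 => A _; rewrite mulr_ge0.
  by apply: (le_trans (ler_norm_sum _ _ _)); apply: ler_sum => A _; rewrite normrM.
have h0 : 0 <= \sum_A `|w A| * `|f A| by apply: sumr_ge0 => A _; rewrite mulr_ge0.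
have := @jensen_powR R 2%:R T (index_enum T) (fun A => `|w A|) (fun A => `|f A|) W.
rewrite ltr1n => /(_ isT (fun _ => normr_ge0 _) (fun _ => normr_ge0 _) wW W0).
rewrite powR_mulrn// (_ : 2%:R - 1 = 1%:R :> R); last by lra.
rewrite powRr1 ?(ltW W0)// => /le_trans; apply.
rewrite ler_wpM2l ?(ltW W0)//; apply: ler_sum => A _.
by rewrite powR_mulrn// real_normK ?num_real.
Qed.

Lemma mean_sum (I : Type) (s : seq I) (w : I -> R) (f : I -> R -> R) : (forall A, lip (f A)) ->
  mean (fun t => \sum_(A <- s) w A * f A t) = \sum_(A <- s) w A * mean (f A).
Proof.
move=> lf; elim: s => [|A s ih].
  by rewrite big_nil -[RHS](mean_cst 0); apply: eq_mean => t; rewrite big_nil.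
have lA := lipZ (w A) (lf A).
have ls : lip (fun t => \sum_(A <- s) w A * f A t) by apply: lip_sum => B; exact: lipZ.
rewrite big_cons -ih -(meanZ _ (lip_cont (lf A))) -(meanD (lip_cont lA) (lip_cont ls)).
by apply: eq_mean => t; rewrite big_cons.
Qed.

(** The quantity is a constant times r^(2-q), which tends to 0 because q > 2. It allows N = M r^2
    factors in [psum_riesz_mix] with b of order 1/r. *)
Lemma exists_ratio (q k : R) (n : nat) : 2 < q -> 0 < k ->
  exists r : nat, [/\ (0 < r)%N, (n <= r)%N & 16 * (k / r%:R) `^ q * r%:R ^+ 2 <= 1].
Proof.
move=> q2 k0; have q0 : 0 < q - 2 by rewrite subr_gt0.
pose K : R := 16 * k `^ q; have K0 : 0 < K by rewrite mulr_gt0// powR_gt0.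
pose r := (maxn n (Num.bound (K `^ (q - 2)^-1))).+1.
have r0 : (0 < r)%N by [].
have r0' : 0 < r%:R :> R by rewrite ltr0n.
exists r; split=> //; first by rewrite leqW// leq_maxl.
have h : K <= r%:R `^ (q - 2).
  have -> : K = (K `^ (q - 2)^-1) `^ (q - 2).
    by rewrite -powRrM mulVf ?powRr1 ?(ltW K0)// lt0r_neq0.
  apply: ge0_ler_powR; rewrite ?nnegrE ?powR_ge0 ?ler0n ?(ltW q0)//.
  apply: (le_trans (ltW (archi_boundP (powR_ge0 _ _)))).
  by rewrite ler_nat leqW// leq_maxr.
have -> : (k / r%:R) `^ q = k `^ q * r%:R ^- 2 * (r%:R `^ (q - 2))^-1.
  rewrite powRM ?invr_ge0 ?ler0n ?(ltW k0)// -mulrA; congr (_ * _).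
  rewrite -powR_inv1 ?ler0n// -powRrM mulN1r -(powR_invn _ (ler0n _ r)) -powRN -powRD.
    by congr powR; ring.
  by rewrite (lt0r_neq0 r0') implybT.
rewrite (_ : 16 * _ * _ = K * (r%:R `^ (q - 2))^-1 * (r%:R ^- 2 * r%:R ^+ 2)); last by rewrite /K; ring.
rewrite mulVf ?mulr1; last by rewrite expf_neq0// lt0r_neq0.
by rewrite ler_pdivrMr ?mul1r// powR_gt0.
Qed.

Lemma key_lemma (p q : R) : 1 < p -> 2 < q ->
  exists2 beta : R, 0 < beta <= 1 & forall e, 0 < e -> exists X u : R -> R,
  [/\ lip X, lip u, (forall t, `|X t| <= 1), psum p (fc (creal X)) e &
    psum q (fun n => fc (creal u) n - (n == 0)%:R) e /\ forall t, u t != 0 -> beta <= X t].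
Proof.
move=> p1 q2; have k800 : 0 < 80 * 10 :> R by rewrite mulr_gt0 ?ltr0n.
(* The number 80 * 10 is 80b times r, for b = 10/r; and r >= 320 gives b <= 1/32, so that every
   [c A <= 4 * b] stays below the 1/8 of the tail estimates. *)
have [r [r0 r320 hr]] := exists_ratio 320 q2 k800.
have q0 : 0 < q by exact: lt_trans q2.
have p0 : 0 < p by exact: lt_trans p1.
have r0' : 0 < r%:R :> R by rewrite ltr0n.
have r320' : 320 <= r%:R :> R by rewrite (ler_nat R 320).
pose b : R := 10 / r%:R; have b0 : 0 < b by rewrite divr_gt0.
have b32 : b <= 32^-1 by rewrite ler_pdivrMr//; lra.
(* The cutoff [chi] will rise from 0 at X = beta to 1 at X = 2 beta = b/8, the level up to which
   [riesz_tail_major] holds. As r is chosen from q alone, beta does not depend on [e]. *)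
pose beta := b / 16; have beta0 : 0 < beta by rewrite divr_gt0.
exists beta; first by rewrite beta0/= /beta; lra.
move=> e e0.
have p10 : 0 < p - 1 by rewrite subr_gt0.
(* The first bound makes (2N)^(1-p) at most [e]; the second makes 2^q times twice 2^(-M) at most
   [e], through the crude 2^(-M) <= 1/M. *)
have [M [M0 Mp Mq]] : exists M : nat,
    [/\ (0 < M)%N, e^-1 `^ (p - 1)^-1 <= M%:R & 2 `^ q * 2 / e <= M%:R].
  exists (maxn (Num.bound (e^-1 `^ (p - 1)^-1)) (Num.bound (2 `^ q * 2 / e))).+1; split=> //.
    apply: (le_trans (ltW (archi_boundP (powR_ge0 _ _)))).
    by rewrite ler_nat leqW// leq_maxl.
  apply: (le_trans (ltW (archi_boundP _))).
    by rewrite divr_ge0 ?(ltW e0)// mulr_ge0 ?powR_ge0.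
  by rewrite ler_nat leqW// leq_maxr.
have M0' : 0 < M%:R :> R by rewrite ltr0n.
have M2 : 2^-1 ^+ M <= M%:R^-1 :> R.
  rewrite exprVn lef_pV2 ?posrE ?exprn_gt0// -natrX ler_nat ltnW//; exact: ltn_expl.
have [N N0 NE] : exists2 N, (0 < N)%N & N%:R = M%:R * r%:R ^+ 2 :> R.
  by exists (M * r ^ 2)%N; rewrite ?natrM ?natrX// muln_gt0 M0 expn_gt0 r0.
have hN : (16 * (80 * b) `^ q) * N%:R <= M%:R.
  rewrite NE (_ : 80 * b = 80 * 10 / r%:R); last by rewrite /b mulrA.
  by rewrite mulrCA -[leRHS]mulr1 ler_pM2l.
have [T [w [c [w1 wk wM cb]]]] := moment_weights M0 b0.
pose ut t := \sum_(A : T) w A * riesz N (c A) t.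
have lut : lip ut by apply: lip_sum => A; apply: lipZ; exact: lip_riesz.
pose X := avgcos N : R -> R.
have lX : lip X by exact: lip_avgcos.
pose chi t := Num.max 0 (Num.min (beta^-1 * X t - 1) 1).
have lchi : lip chi.
  apply: lip_max (lip_cst _) _; apply: lip_min (lip_cst _).
  by apply: lipB (lip_cst _); exact: lipZ.
have chi01 t : 0 <= chi t <= 1 by rewrite /chi le_max lexx/= ge_max ler01 ge_min lexx orbT.
pose u t := ut t * chi t.
have lu : lip u by exact: lipM.
pose D t := ut t * (1 - chi t).
have lD : lip D by apply: lipM => //; apply: lipB => //; exact: lip_cst.
exists X, u; split=> //.
- exact: avgcos_le1.
- apply: psum_le (psum_avgcos N0 p0) _.
  have MN : M%:R <= 2 * N%:R :> R.
    rewrite NE mulrCA ler_peMr ?(ltW M0')//.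
    have : 1 <= r%:R ^+ 2 :> R by rewrite exprn_ege1// ler1n.
    by move: (r%:R ^+ 2) => x; lra.
  rewrite -opprB powRN -[leRHS]invrK lef_pV2 ?posrE ?powR_gt0 ?invr_gt0//; last first.
    by rewrite mulr_gt0// ltr0n.
  have ei : 0 <= e^-1 by rewrite invr_ge0 ltW.
  have -> : e^-1 = (e^-1 `^ (p - 1)^-1) `^ (p - 1).
    by rewrite -powRrM mulVf ?powRr1// lt0r_neq0.
  by apply: ge0_ler_powR; rewrite ?nnegrE ?powR_ge0 ?(ltW p10) ?(le_trans Mp)// mulr_ge0// ler0n.
- split; last first.
    move=> t; apply: contraNle => Xb; rewrite /u /chi max_l ?mulr0//.
    rewrite ge_min; apply/orP; left; rewrite subr_le0 mulrC ler_pdivrMr// mul1r.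
    exact: ltW.
  have h1 := psum_riesz_mix q0 b0 hN w1 wk wM cb; rewrite -/ut in h1.
  have h2 : psum q (fc (creal D)) (2^-1 ^+ M).
    apply: psum_of_energy; [exact: ltW|exact: creal_ccont| |]; last first.
      by rewrite exprn_ile1// invf_le1// ler1n.
    apply: (@le_trans _ _ (mean (fun t => \sum_(A : T) (20 ^+ M * `|w A|) * riesz_tail N b (c A) t))).
      have lS : lip (fun t => \sum_(A : T) (20 ^+ M * `|w A|) * riesz_tail N b (c A) t).
        by apply: lip_sum => A; apply: lipZ; exact: lip_riesz_tail.
      apply: ler_mean (lip_cont lS) _.
        apply: eq_cont (lip_cont (lipM lD lD)) => t.
        by rewrite normc_creal real_normK ?num_real// expr2.
      move=> t; rewrite normc_creal real_normK ?num_real// /D.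
      have S0 : 0 <= \sum_(A : T) (20 ^+ M * `|w A|) * riesz_tail N b (c A) t.
        apply: sumr_ge0 => A _; apply: mulr_ge0; last exact: riesz_tail_ge0.
        by rewrite mulr_ge0 ?exprn_ge0.
      have [Xb|Xb] := leP (X t) (b / 8); last first.
        suff -> : chi t = 1 by rewrite subrr mulr0 expr0n.
        rewrite /chi min_r ?max_r// lerBrDl mulrC ler_pdivlMr// /beta.
        by move: Xb; lra.
      apply: (@le_trans _ _ (ut t ^+ 2)).
        rewrite exprMn ler_piMr ?sqr_ge0// exprn_ile1//; have := chi01 t; lra.
      apply: (le_trans (sqr_mix_le _ (exprn_gt0 M (ltr0n _ 20)) wM)).
      rewrite mulr_sumr; apply: ler_sum => A _; rewrite mulrA ler_wpM2l ?mulr_ge0 ?exprn_ge0//.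
      have /andP[c1 c2] := cb A.
      by apply: riesz_tail_major => //; lra.
    rewrite mean_sum; last by move=> A; exact: lip_riesz_tail.
    apply: (@le_trans _ _ (\sum_(A : T) (20 ^+ M * `|w A|) * expR (- (17 / 100 * b ^+ 2)) ^+ N)).
      apply: ler_sum => A _; rewrite ler_wpM2l ?mulr_ge0 ?exprn_ge0//.
      have /andP[c1 c2] := cb A.
      by apply: mean_riesz_tail => //; lra.
    rewrite -mulr_suml -mulr_sumr.
    (* Here N b^2 = 100M turns the exponent into -17M. With e >= 2 the whole bound is (400/2^17)^M,
       well below 2^(-M). *)
    have -> : expR (- (17 / 100 * b ^+ 2)) ^+ N = (expR (- 1) ^+ 17) ^+ M :> R.
      rewrite -expRM_natl -exprM -[RHS]expRM_natl NE natrM; congr expR.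
      by rewrite /b; field; rewrite gt_eqF.
    apply: (@le_trans _ _ ((20 ^+ M * 20 ^+ M) * (2^-1 ^+ 17) ^+ M)).
      apply: ler_pM; rewrite ?mulr_ge0 ?exprn_ge0 ?expR_ge0//.
      - by apply: sumr_ge0 => A _.
      - by rewrite ler_wpM2l ?exprn_ge0.
      - apply: lerXn2r; rewrite ?nnegrE ?exprn_ge0 ?expR_ge0//.
        apply: lerXn2r; rewrite ?nnegrE ?expR_ge0//.
        by rewrite expRN lef_pV2 ?posrE ?expR_gt0// expR_ge2.
    rewrite -!exprMn; apply: lerXn2r; rewrite ?nnegrE//.
    rewrite !exprS expr0; lra.
  apply: (@psum_le _ _ _ (2 `^ q * (2^-1 ^+ M + 2^-1 ^+ M))); last first.
    rewrite (_ : 2^-1 ^+ M + 2^-1 ^+ M = 2 * 2^-1 ^+ M); last by rewrite mulr_natl mulr2n.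
    rewrite mulrA; apply: (@le_trans _ _ (2 `^ q * 2 / M%:R)).
      by rewrite ler_wpM2l// mulr_ge0// powR_ge0.
    by rewrite ler_pdivrMr// [e * _]mulrC -ler_pdivrMr.
  apply: eq_psum (psumD (ltW q0) h1 (psumN h2)) => n /=.
  rewrite addrAC; congr (_ - _); rewrite -fcB; try exact: creal_ccont.
  by apply: eq_fc => t; apply: complexP; rewrite reimE/= /D /u; ring.
Qed.
End KeyLemma.

(** * The inductive construction *)

Section Construction.
Variables (R : realType) (p q beta : R).
Hypotheses (p1 : 1 < p) (q2 : 2 < q) (beta01 : 0 < beta <= 1).
Hypothesis key : forall e, 0 < e -> exists X u : R -> R,
  [/\ lip X, lip u, (forall t, `|X t| <= 1), psum p (fc (creal X)) e &
    psum q (fun n => fc (creal u) n - (n == 0)%:R) e /\ forall t, u t != 0 -> beta <= X t].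

Let kappa := 1 - beta / 2.
(** The triangle inequality for [psum] costs a factor 2^q in l_q, and 2^p in l_p. Dividing the
    budget by [K] at each stage compensates for it: if K e' <= e, then 2^q (e + K e') <= K e. *)
Let K := 2 * 2 `^ q : R.

(* [sg], [sf] and [sS] approximate g, f and the multipliers whose products with f
   tend to 0; the later modifications of the three functions are bounded in terms
   of the budget [se]. *)
Record stage := Stage { sg : R -> R; sf : R -> R; sS : R -> R; se : R }.

(** The last group calibrates the budget. All later changes of g + f together have p-th power sum at
    most 2^p (K e + K e); the clause on [A] keeps it below 2^(-n) after multiplication by 1/(g + f).
    All later changes of f add up to at most 2e in the sup norm; the clause on [B] does the same for
    their product with S. *)
Definition stage_inv (n : nat) (s : stage) : Prop :=
  [/\ [/\ lip (sg s), lip (sf s) & lip (sS s)],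
      (exists2 r, 0 < r & forall t, r <= sg s t),
      (forall t, 0 <= sf s t) /\ (forall t, sf s t * sS s t = 0),
      (forall t, sf s t = 0 -> sg s t <= kappa ^+ n) &
      [/\ 0 < se s,
        (exists A, (forall r : seq int, uniq r ->
            \sum_(k <- r) normc (fc (creal (fun t => (sg s t + sf s t)^-1)) k) <= A) /\
          A `^ p * (2 `^ p * (K * se s + K * se s)) <= 2^-1 ^+ n) &
        (exists B, (forall t, `|sS s t| <= B) /\ B * (2 * se s) <= 2^-1 ^+ n)]].

(** The increments of f are nonnegative so that a zero of the limit is a zero of f at every stage,
    where [stage_inv] bounds g. *)
Definition stage_step (n : nat) (s s' : stage) : Prop :=
  [/\ (forall t, `|sg s' t - sg s t| <= kappa ^+ n),
      psum p (fc (creal (fun t => sg s' t - sg s t))) (se s),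
      (forall t, 0 <= sf s' t - sf s t <= se s) /\
        psum p (fc (creal (fun t => sf s' t - sf s t))) (se s),
      psum q (fc (creal (fun t => sS s' t - sS s t))) (se s) &
      K * se s' <= se s].

Lemma small_budget (n : nat) (g f S : R -> R) (r emax : R) :
  lip g -> lip f -> lip S -> 0 < r -> (forall t, r <= g t) -> (forall t, 0 <= f t) ->
  0 < emax ->
  exists e, [/\ 0 < e, e <= emax,
        (exists A, (forall s : seq int, uniq s ->
            \sum_(k <- s) normc (fc (creal (fun t => (g t + f t)^-1)) k) <= A) /\
          A `^ p * (2 `^ p * (K * e + K * e)) <= 2^-1 ^+ n) &
        (exists B, (forall t, `|S t| <= B) /\ B * (2 * e) <= 2^-1 ^+ n)].
Proof.
move=> lg lf lS r0 gr f0 em0.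
have K0 : 0 < K by rewrite mulr_gt0// powR_gt0.
have lgf : lip (fun t => (g t + f t)^-1).
  by apply: (lip_inv r0) (lipD lg lf) => t; rewrite -[r]addr0 lerD.
have [A A0 hA] := lip_fc_summable lgf.
have [B B0 hB] := lip_bound lS.
pose c1 := A `^ p * (2 `^ p * (K + K)).
have c10 : 0 <= c1 by rewrite !mulr_ge0 ?powR_ge0// addr_ge0// ltW.
pose h : R := 2^-1 ^+ n; have h0 : 0 < h by rewrite exprn_gt0// invr_gt0.
pose D := 1 + c1 + B * 2.
have D0 : 0 < D by rewrite /D -addrA ltr_pwDl// addr_ge0// mulr_ge0.
pose e := Num.min emax (h / D).
have e0 : 0 < e by rewrite lt_min em0 divr_gt0.
have eh : e * D <= h by rewrite -ler_pdivlMr// ge_min lexx orbT.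
exists e; split=> //; first by rewrite ge_min lexx.
  exists A; split=> //; rewrite -/h; apply: le_trans eh.
  rewrite (_ : _ * (_ * _) = e * c1); last by rewrite /c1; ring.
  by rewrite ler_wpM2l ?(ltW e0)// /D -addrA addrCA lerDl addr_ge0// mulr_ge0.
exists B; split=> //; rewrite -/h; apply: le_trans eh.
rewrite mulrA mulrC ler_wpM2l ?(ltW e0)// /D lerDr addr_ge0//.
Qed.

Lemma stage_start (emax : R) : 0 < emax -> exists s,
  [/\ stage_inv 0 s, se s <= emax, sg s = (fun=> 1), sf s = (fun=> 0) & sS s = (fun=> 1)].
Proof.
move=> em0; have l1 := lip_cst (1 : R); have l0 := lip_cst (0 : R).
have [e [e0 eem hA hB]] := small_budget 0 l1 l0 l1 ltr01 (fun _ => lexx 1) (fun _ => lexx 0) em0.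
exists (Stage (fun=> 1) (fun=> 0) (fun=> 1) e); split=> //; split=> //=.
- by exists 1.
- by split=> // t; rewrite mul0r.
Qed.

Lemma stage_next n s : stage_inv n s -> exists s', stage_inv n.+1 s' /\ stage_step n s s'.
Proof.
case: s => g f S e [/= [lg lf lS] [r r0 gr] [f0 fS] fg [e0 _ _]].
have /andP[b0 b1] := beta01.
have p0 : 0 < p by exact: lt_trans p1.
have q0 : 0 < q by exact: lt_trans q2.
have q1 : 1 < q by apply: lt_trans q2; rewrite ltr1n.
have K0 : 0 < K by rewrite mulr_gt0// powR_gt0.
have k0 : 0 < kappa by rewrite /kappa; lra.
pose tg t := Num.min (g t) (kappa ^+ n).
have ltg : lip tg by apply: lip_min lg (lip_cst _).
have [A1 A10 hA1] := lip_fc_summable ltg.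
have [A2 A20 hA2] := lip_fc_summable lS.
(* The precision e/M survives multiplication by [tg] and by S, whose coefficients have l_1 norms at
   most A1 and A2; the term 1 keeps M positive. *)
pose M := 1 + A1 `^ p + A2 `^ q.
have M0 : 0 < M by rewrite /M -addrA ltr_pwDl// addr_ge0// powR_ge0.
have [X [u [lX lu X1 pX [pu uX]]]] := key (divr_gt0 e0 M0).
pose phi t := Num.max (beta - X t) 0.
have lphi : lip phi by apply: lip_max (lip_cst _); apply: lipB => //; exact: lip_cst.
have phi0 t : 0 <= phi t by rewrite le_max lexx orbT.
have phi2 t : phi t <= 2.
  by have := X1 t; rewrite ler_norml ge_max ler0n andbT => /andP[? _]; lra.
have phiu t : phi t * u t = 0.
  have [->|/uX bX] := eqVneq (u t) 0; first by rewrite mulr0.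
  by rewrite /phi max_r ?mul0r// subr_le0.
have [B hB] := psum_lip p1 lphi; have B0 := psum_ge0 hB.
(* Scaling by eta <= 1 multiplies the p-th power sum by eta^p <= eta, so one smallness condition
   serves both the sup norm (phi <= 2) and the coefficients of phi. *)
have [eta [eta0 eta1 etaB]] : exists eta : R, [/\ 0 < eta, 2 * eta <= e & eta `^ p * B <= e].
  pose eta := Num.min 1 (e / (2 + B)).
  have B2 : 0 < 2 + B by rewrite ltr_pwDl.
  have h0 : 0 < eta by rewrite lt_min ltr01 divr_gt0.
  have h1 : eta <= 1 by rewrite ge_min lexx.
  have h2 : eta * (2 + B) <= e by rewrite -ler_pdivlMr// ge_min lexx orbT.
  have h3 : eta `^ p <= eta by apply: ge1r_powR; [rewrite h0 h1|exact: ltW].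
  exists eta; split=> //.
    by apply: le_trans h2; rewrite mulrC ler_pM2l// lerDl.
  apply: le_trans h2; apply: (@le_trans _ _ (eta * B)); first exact: ler_wpM2r.
  by rewrite ler_pM2l// lerDr.
pose g' t := g t - 2^-1 * (tg t * X t).
pose f' t := f t + eta * phi t.
pose S' t := S t * u t.
have lg' : lip g' by apply: lipB lg (lipZ _ (lipM ltg lX)).
have lf' : lip f' by apply: lipD lf (lipZ _ lphi).
have lS' : lip S' by exact: lipM.
have tg0 t : 0 < tg t by rewrite lt_min exprn_gt0// (lt_le_trans r0 (gr t)).
have tgg t : tg t <= g t by rewrite ge_min lexx.
have tgk t : tg t <= kappa ^+ n by rewrite ge_min lexx orbT.
have X2 t : - 1 <= X t <= 1 by rewrite -ler_norml.
(* Since X <= 1 and tg <= g, at most half of g is removed: every stage stays bounded below by a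
   positive constant and g + f remains invertible. *)
have gr' t : r / 2 <= g' t.
  rewrite /g'; have : tg t * X t <= tg t.
    by rewrite ler_piMr ?(ltW (tg0 t))//; case/andP: (X2 t).
  have := tgg t; have := gr t; move: (tg t * X t) (g t) (tg t) => a b c ? ? ?; lra.
have f'0 t : 0 <= f' t by rewrite addr_ge0// mulr_ge0// ltW.
have r20 : 0 < r / 2 by rewrite divr_gt0.
have [e' [e'0 e'e hA hB']] := small_budget n.+1 lg' lf' lS' r20 gr' f'0 (divr_gt0 e0 K0).
have MM A : 0 <= A -> A <= M -> A * (e / M) <= e.
  by move=> A0 AM; rewrite mulrCA ler_piMr ?(ltW e0)// ler_pdivrMr// mul1r.
have f'z t : f' t = 0 -> f t = 0 /\ phi t = 0.
  move=> h; have h1 := f0 t; have h2 : 0 <= eta * phi t by rewrite mulr_ge0// ltW.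
  have h3 : f t = 0 by move: h; rewrite /f'; lra.
  split=> //; have : eta * phi t = 0 by move: h; rewrite /f'; lra.
  by move/eqP; rewrite mulf_eq0 gt_eqF//= => /eqP.
exists (Stage g' f' S' e'); split.
  split=> //=; first by exists (r / 2).
  - split=> // t; rewrite /f' /S'.
    transitivity ((f t * S t) * u t + eta * S t * (phi t * u t)); first by ring.
    by rewrite fS phiu mul0r mulr0 addr0.
  (* A zero of f' is a zero of f with X >= beta. There g <= kappa^n, so the minimum in [tg] is g
     itself, and g' = g (1 - X/2) <= kappa g. *)
  - move=> t /f'z [/fg gk ph]; have bX : beta <= X t.
      by have : beta - X t <= phi t; [rewrite le_max lexx|rewrite ph subr_le0].
    have tE : tg t = g t by rewrite /tg min_l.
    rewrite /g' tE exprSr /kappa -/kappa.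
    apply: (@le_trans _ _ (g t * kappa)).
      have g0 : 0 <= g t by exact: le_trans (ltW r0) (gr t).
      have : g t * beta <= g t * X t by rewrite ler_wpM2l.
      rewrite /kappa; move: (g t * X t) => a; lra.
    by rewrite ler_wpM2r// ltW.
split=> /=.
- move=> t; rewrite /g' addrAC subrr add0r normrN !normrM.
  have := X1 t; rewrite (ger0_norm (ltW (tg0 t))) ger0_norm ?invr_ge0// => hX.
  apply: le_trans (tgk t).
  have : tg t * `|X t| <= tg t by rewrite ler_piMr// ltW.
  have a0 : 0 <= tg t * `|X t| by rewrite mulr_ge0// ltW.
  have := tg0 t; lra.
- apply: (@psum_le _ _ _ (normc (Complex (- 2^-1 : R) 0) `^ p * (A1 `^ p * (e / M)))); last first.
    apply: (@le_trans _ _ (A1 `^ p * (e / M))).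
      apply: ler_piMl.
        by rewrite mulr_ge0 ?powR_ge0// divr_ge0// ltW.
      rewrite normc_real normrN ger0_norm ?invr_ge0//.
      apply: (@le_trans _ _ (1 `^ p)); last by rewrite powR1.
      by apply: ge0_ler_powR; rewrite ?nnegrE ?invr_ge0 ?(ltW p0)// invf_le1// ler1n.
    by apply: MM; [exact: powR_ge0|rewrite /M addrAC lerDr addr_ge0// powR_ge0].
  have h := psum_mul p1 ltg hA1 (creal_ccont lX) (C := 1) _ pX.
  apply: eq_psum (psumZ _ (h _)) => [n0|t]; last by rewrite normc_creal.
  rewrite -fcZ; last by apply: ccontinuousM; exact: creal_ccont.
  by apply: eq_fc => t; apply: complexP; rewrite !reimE/= /g'; ring.
- split=> [t|].
    rewrite /f' addrAC subrr add0r mulr_ge0 ?(ltW eta0)//=.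
    apply: le_trans eta1; rewrite mulrC ler_wpM2r ?(ltW eta0)//.
  apply: (@psum_le _ _ _ (normc (Complex eta 0) `^ p * B)).
    apply: eq_psum (psumZ (Complex eta 0) hB) => k; rewrite -fcZ; last exact: creal_ccont.
    by apply: eq_fc => t; apply: complexP; rewrite !reimE/= /f'; ring.
  by rewrite normc_real ger0_norm// ltW.
- apply: (@psum_le _ _ _ (A2 `^ q * (e / M))); last first.
    by apply: MM; [exact: powR_ge0|rewrite /M lerDr addr_ge0// powR_ge0].
  have lu1 : lip (fun t => u t - 1) by apply: lipB lu (lip_cst _).
  have [C C0 hC] := lip_bound lu1.
  have h : psum q (fc (creal (fun t => u t - 1))) (e / M).
    apply: eq_psum pu => k; rewrite -[(k == 0)%:R]mulr1 -(fc_cst (1 : R)) -fcB; try exact: creal_ccont (lip_cst _).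
      by apply: eq_fc => t; apply: complexP; rewrite !reimE/=; ring.
    exact: creal_ccont.
  have h2 := psum_mul q1 lS hA2 (creal_ccont lu1) (C := C) _ h.
  apply: eq_psum (h2 _) => [k|t]; last by rewrite normc_creal.
  by apply: eq_fc => t; apply: complexP; rewrite !reimE/= /S'; ring.
- by rewrite mulrC -ler_pdivlMr.
Qed.

Lemma stage_sequence (emax : R) : 0 < emax -> exists s : nat -> stage,
  [/\ forall n, stage_inv n (s n), forall n, stage_step n (s n) (s n.+1),
      se (s 0%N) <= emax & [/\ sg (s 0%N) = (fun=> 1), sf (s 0%N) = (fun=> 0) & sS (s 0%N) = (fun=> 1)]].
Proof.
move=> em0; have [s0 [i0 e0 g0 f0 S0]] := stage_start em0.
(* The successor is made total so that the recursion can be written before the invariant is proved;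
   a stage violating it is sent to itself. *)
have nxt n s : {s' : stage | stage_inv n s -> stage_inv n.+1 s' /\ stage_step n s s'}.
  apply: cid; have [h|h] := pselect (stage_inv n s); last by exists s.
  by have [s' h'] := stage_next h; exists s'.
pose s := fix s n := if n is m.+1 then projT1 (nxt m (s m)) else s0.
have inv n : stage_inv n (s n).
  by elim: n => //= n ih; case: (nxt n (s n)) => /= s' /(_ ih) [].
exists s; split=> // n /=.
by case: (nxt n (s n)) => /= s' /(_ (inv n)) [].
Qed.
End Construction.

(** * Passage to the limit, and the link with [lp] and [fourier_coef] *)

Section Limits.
Variable R : realType.

(** The intervals of radius [c n] around [u n] meet pairwise; the supremum of their left ends lies
    in all of them, which yields the limit together with its rate. *)
Lemma nested_limit (u c : nat -> R) : (forall m n, (m <= n)%N -> `|u n - u m| <= c m) ->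
  exists l, forall n, `|l - u n| <= c n.
Proof.
move=> h; pose E := [set x | exists n, x = u n - c n].
have c0 n : 0 <= c n by apply: le_trans (h n n (leqnn n)).
have ub n x : E x -> x <= u n + c n.
  move=> [m ->]; have [mn|/ltnW nm] := leqP m n.
    have := h m n mn; rewrite ler_norml => /andP[h1 h2].
    by have := c0 n; lra.
  have := h n m nm; rewrite ler_norml => /andP[h1 h2].
  by have := c0 m; lra.
have E0 : E !=set0 by exists (u 0%N - c 0%N), 0%N.
exists (sup E) => n.
have h1 : u n - c n <= sup E.
  by apply: ub_le_sup; [exists (u 0%N + c 0%N) => x Ex; exact: ub|exists n].
have h2 : sup E <= u n + c n by apply: ge_sup => // x Ex; exact: ub.
by rewrite ler_norml; apply/andP; split; lra.
Qed.

Lemma uniform_limit_continuous (h : nat -> R -> R) (g : R -> R) (c : nat -> R) :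
  (forall n, continuous (h n)) -> (forall n t, `|g t - h n t| <= c n) ->
  (forall e, 0 < e -> exists n, c n <= e) -> continuous g.
Proof.
move=> ch hc c0 x; apply/cvgrPdist_le => /= e e0.
have [n hn] := c0 (e / 3) (divr_gt0 e0 (ltr0n _ 3)).
have e3 : 0 < e / 3 by rewrite divr_gt0.
near=> y.
have h1 : `|h n x - h n y| <= e / 3.
  by near: y; apply: cvgr_dist_le => //; exact: ch.
have := hc n x; have := hc n y; rewrite [`|g y - _|]distrC => h2 h3.
have -> : g x - g y = (g x - h n x) + (h n x - h n y) + (h n y - g y) by ring.
apply: (le_trans (ler_normD _ _)); have := ler_normD (g x - h n x) (h n x - h n y); lra.
Unshelve. all: by end_near. Qed.

(** The first increment is split off from those that follow, so that the factor 2^p is absorbed at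
    each step of the induction and does not accumulate: 2^p (e m + K e (m+1)) <= 2^p (2 e m) <= K e
    m. *)
Lemma psum_telescope (p K : R) (h : nat -> R -> R) (e : nat -> R) : 1 < p ->
  2 * 2 `^ p <= K -> (forall n, lip (h n)) -> (forall n, 0 <= e n) ->
  (forall n, psum p (fc (creal (fun t => h n.+1 t - h n t))) (e n)) ->
  (forall n, K * e n.+1 <= e n) ->
  forall k m, psum p (fc (creal (fun t => h (m + k)%N t - h m t))) (K * e m).
Proof.
move=> p1 pK lh e0 he eK; have p0 : 0 < p by exact: lt_trans p1.
have K0 : 0 <= K by apply: le_trans pK; rewrite mulr_ge0 ?powR_ge0.
elim=> [|k ih] m.
  apply: (@psum_le _ _ _ 0); last by rewrite mulr_ge0.
  apply: eq_psum (psum0 p0) => n; rewrite -[LHS](mulr0 ((n == 0)%:R)) -(fc_cst (0 : R)).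
  by apply: eq_fc => t; rewrite addn0 /creal subrr.
apply: (@psum_le _ _ _ (2 `^ p * (e m + K * e m.+1))); last first.
  apply: (@le_trans _ _ (2 `^ p * (e m + e m))); first by rewrite ler_wpM2l ?powR_ge0// lerD2l.
  rewrite (_ : 2 `^ p * _ = (2 * 2 `^ p) * e m); last by ring.
  by rewrite ler_wpM2r.
apply: eq_psum (psumD (ltW p0) (he m) (ih m.+1)) => n.
rewrite -fcD; try by apply: creal_ccont; exact: lipB.
apply: eq_fc => t; apply: complexP; rewrite reimE/= ?addr0// addnS addSn; ring.
Qed.

(** Uniform convergence gives convergence of each coefficient, so the telescoped bound passes to the
    limit by [psum_lim]. *)
Lemma psum_fc_limit (p K : R) (h : nat -> R -> R) (g : R -> R) (e c : nat -> R) : 1 < p ->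
  2 * 2 `^ p <= K -> (forall n, lip (h n)) -> (forall n, 0 <= e n) ->
  (forall n, psum p (fc (creal (fun t => h n.+1 t - h n t))) (e n)) ->
  (forall n, K * e n.+1 <= e n) -> continuous g ->
  (forall n t, `|g t - h n t| <= c n) ->
  (forall m d, 0 < d -> exists2 n, (m <= n)%N & c n <= d) ->
  forall m, psum p (fc (creal (fun t => g t - h m t))) (K * e m).
Proof.
move=> p1 pK lh e0 he eK cg hc c0 m; apply: psum_lim => // s d d0.
have [n mn hn] := c0 m (d / 2) (divr_gt0 d0 (ltr0n _ 2)).
exists (fc (creal (fun t => h n t - h m t))).
  by rewrite -(subnKC mn); exact: psum_telescope.
move=> k _.
have c1 : continuous (fun t => g t - h m t) by apply: sub_cont => //; exact: lip_cont.
have c2 : continuous (fun t => h n t - h m t) by apply: sub_cont; exact: lip_cont.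
have c3 : continuous (fun t => g t - h n t) by apply: sub_cont => //; exact: lip_cont.
rewrite -fcB; try exact: ccontinuous_real.
have -> : d = 2 * (d / 2) by field.
rewrite (@eq_fc _ _ (creal (fun t => g t - h n t))); last first.
  by move=> t; apply: complexP; rewrite !reimE/=; ring.
apply: ler_normc_fc; first exact: ccontinuous_real.
by move=> t; rewrite normc_creal (le_trans (hc n t)).
Qed.

Lemma psum_lp_sum (p B : R) (F : int -> R[i]^o) : psum p F B -> (lp_sum p F <= B%:E)%E.
Proof.
move=> h; apply: ge_ereal_sup => _ [A [finA _] <-].
rewrite fsbig_finite//= sumEFin lee_fin; apply: h; exact: finmap.fset_uniq.
Qed.

Lemma lp_sum_psum (p B : R) (F : int -> R[i]^o) : (lp_sum p F <= B%:E)%E -> psum p F B.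
Proof.
move=> h s us; rewrite -lee_fin (le_trans _ h)//; apply: esum_ge.
by exists [set` s]; [split=> //; exact: finite_seq|rewrite -fsbig_seq// sumEFin].
Qed.

Lemma lp_sum_ge0 (p : R) (F : int -> R[i]^o) : (0 <= lp_sum p F)%E.
Proof. by apply: esum_ge0 => n _; rewrite lee_fin powR_ge0. Qed.

Lemma lp_sumE (p : R) (F : int -> R[i]^o) : (lp_sum p F < +oo)%E ->
  exists2 x : R, 0 <= x & lp_sum p F = x%:E.
Proof.
have := lp_sum_ge0 p F; case: (lp_sum p F) => [x| |]//.
by rewrite lee_fin => x0 _; exists x.
Qed.

Lemma psum_lp (p B : R) (F : int -> R[i]^o) : psum p F B -> lp p F.
Proof. by move=> /psum_lp_sum h; rewrite /lp/= (le_lt_trans h)// ltry. Qed.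

Lemma psum_lp_norm (p B e : R) (F : int -> R[i]^o) : 0 < p -> 0 < e -> psum p F B ->
  B < e `^ p -> (lp_norm p F < e%:E)%E.
Proof.
move=> p0 e0 h Be; have [x x0 xE] := lp_sumE (psum_lp h).
have xB : x <= B by have := psum_lp_sum h; rewrite xE lee_fin.
rewrite /lp_norm xE poweR_EFin lte_fin.
have -> : e = (e `^ p) `^ p^-1 by rewrite -powRrM mulfV ?powRr1 ?(ltW e0)// gt_eqF.
apply: gt0_ltr_powR; rewrite ?invr_gt0 ?nnegrE ?powR_ge0//.
exact: le_lt_trans Be.
Qed.

Lemma lp_norm_psum (p e : R) (F : int -> R[i]^o) : 0 < p -> 0 < e ->
  (lp_norm p F < e%:E)%E -> psum p F (e `^ p).
Proof.
move=> p0 e0 h; apply: lp_sum_psum.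
have pi0 : p^-1 != 0 by rewrite invr_eq0 gt_eqF.
have fin : (lp_sum p F < +oo)%E by apply: (lty_poweRy pi0); apply: lt_trans h _; rewrite ltry.
have [x x0 xE] := lp_sumE fin.
move: h; rewrite /lp_norm xE poweR_EFin lte_fin lee_fin => h.
have -> : x = (x `^ p^-1) `^ p by rewrite -powRrM mulVf ?powRr1// gt_eqF.
by apply: ge0_ler_powR; rewrite ?nnegrE ?powR_ge0// ltW.
Qed.

(** [r] carries all but [e] of the sum. If there were no such list, x - e would bound every finite
    sum, hence the full sum x. *)
Lemma lp_tail (p e : R) (H : int -> R[i]^o) : 0 < p -> lp p H -> 0 < e ->
  exists2 r : seq int, uniq r & psum p (fun n => if n \in r then 0 else H n) e.
Proof.
move=> p0 lH e0; have [x x0 xE] := lp_sumE lH.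
have [r ur hr] : exists2 r : seq int, uniq r & x - e < \sum_(n <- r) normc (H n) `^ p.
  apply: contrapT => hn.
  have : psum p H (x - e).
    by move=> r ur; rewrite leNgt; apply/negP => hr; apply: hn; exists r.
  by move/psum_lp_sum; rewrite xE lee_fin; lra.
exists r => // s us.
have hx : psum p H x by apply: lp_sum_psum; rewrite xE.
have u2 : uniq (r ++ [seq n <- s | n \notin r]).
  rewrite cat_uniq ur filter_uniq// andbT /= -all_predC.
  by apply/allP => n; rewrite mem_filter => /andP[].
have := hx _ u2; rewrite big_cat/= big_filter => h.
rewrite (bigID (fun n => n \in r))/= big1 ?add0r; last first.
  by move=> n ->; rewrite Normc.normc0 powR0 ?gt_eqF.
rewrite (eq_bigr (fun n => normc (H n) `^ p)) => [|n /negPf ->//].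
by lra.
Qed.

Lemma fourier_coefE (F : R -> R[i]^o) n : fourier_coef F n = fc F n.
Proof.
rewrite /fourier_coef /fc /cmean /mean /Cintegral /fexp.
have e t : expi (- (n%:~R * t)) = expi ((- n)%:~R * t) :> R[i] by rewrite mulrNz mulNr.
apply: complexP; rewrite ?reM ?imM /= ?mul0r ?subr0 ?addr0; congr (_ * _);
by apply: eq_Rintegral => t _; rewrite e.
Qed.

Lemma circle_continuous_creal (f : R -> R) : continuous f -> periodic f (2 * pi) ->
  circle_continuous (creal f : R -> R[i]^o).
Proof.
move=> cf pf; split; last by move=> t; rewrite /creal pf.
move=> x; apply/cvgrPdist_lt => /= e e0.
have [e1 e2] : im e = 0 /\ 0 < re e by move: e0; rewrite ltcE/= => /andP[/eqP -> ->].
near=> y.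
have -> : e = Complex (re e) 0 by rewrite -e1; case: (e).
rewrite /creal (_ : Complex _ _ - _ = Complex (f x - f y) 0); last first.
  by apply: complexP; rewrite !reimE/= ?subr0.
rewrite normc_def -normcE normc_real ltcR.
by near: y; apply: cvgr_dist_lt => //; exact: cf.
Unshelve. all: by end_near. Qed.
End Limits.

(** * Criteria for being and for not being a generator *)

Section Generators.
Variable R : realType.
Implicit Types (p q : R) (G : int -> R[i]^o).

Lemma linear_span_translates G (T : Type) (s : seq T) (a : T -> R[i]) (k : T -> int) :
  linear_span [set translate k G | k in [set: int]]
    (\sum_(x <- s) a x *: translate (k x) G).
Proof.
exists (size s), (fun i => a (tnth (in_tuple s) i)), (fun i => translate (k (tnth (in_tuple s) i)) G).
by split=> [i|]; [exists (k (tnth (in_tuple s) i))|rewrite big_tnth].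
Qed.

(** It suffices to approximate the delta at 0, since its translates span the finitely supported
    sequences. An approximant of the delta is convolved with the finite part of [H], and Young's
    inequality controls the error. *)
Lemma generator_of_delta p G B : 1 < p -> psum p G B ->
  (forall e, 0 < e -> exists (a : int -> R[i]) (r : seq int),
     psum p (fun m => (m == 0)%:R - \sum_(n <- r) a n * G (m - n)) e) ->
  generator p G.
Proof.
move=> p1 hG happ H lH e e0; have p0 : 0 < p by exact: lt_trans p1.
(* Two errors of size [d] add up to 2^p (2d) = e^p/2, strictly below e^p. *)
pose d : R := e `^ p / (4 * 2 `^ p).
have d0 : 0 < d by rewrite divr_gt0 ?mulr_gt0 ?powR_gt0.
have [r ur hr] := lp_tail p0 lH d0.
pose A := \sum_(k <- r) normc (H k).
have A0 : 0 <= A by apply: sumr_ge0 => k _; exact: normc_ge0.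
have A1 : 0 < A `^ p + 1 by rewrite ltr_pwDr ?powR_ge0.
have [a [r' hQ]] := happ _ (divr_gt0 d0 A1).
pose P : int -> R[i]^o := \sum_(x <- [seq (k, n) | k <- r, n <- r']) (H x.1 * a x.2) *: translate (x.1 + x.2) G.
have PE m : P m = \sum_(k <- r) H k * \sum_(n <- r') a n * G (m - k - n).
  rewrite /P fct_sumE big_allpairs; apply: eq_bigr => k _; rewrite mulr_sumr; apply: eq_bigr => n _.
  by rewrite -[LHS]/(H k * a n * G (m - (k + n))) opprD addrA mulrA.
exists P; first exact: linear_span_translates.
have hd : psum p (fun m => \sum_(k <- r) H k * ((m - k == 0)%:R - \sum_(n <- r') a n * G (m - k - n)))
    (A `^ p * (d / (A `^ p + 1))).
  by apply: (psum_young p1 (lexx A) hQ).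
have := psumD (ltW p0) hr hd.
move=> /(@eq_psum _ _ _ (fun m => (H - P) m)) h.
apply: (psum_lp_norm p0 e0 (h _)) => [m|]; last first.
  apply: (@le_lt_trans _ _ (2 `^ p * (d + d))).
    rewrite ler_wpM2l ?powR_ge0// lerD2l mulrCA ler_piMr ?(ltW d0)//.
    by rewrite ler_pdivrMr// mul1r lerDl.
  rewrite (_ : 2 `^ p * (d + d) = e `^ p / 2).
    by have := powR_gt0 p e0; lra.
  by rewrite /d; field; rewrite gt_eqF ?powR_gt0.
have -> : (H - P) m = H m - P m by [].
rewrite PE; under eq_bigr do rewrite mulrBr; rewrite sumrB addrA; congr (_ - _).
have [mr|mr] := boolP (m \in r).
  rewrite add0r (bigD1_seq m)//= subrr eqxx mulr1 big1 ?addr0// => k km.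
  by rewrite subr_eq0 eq_sym (negPf km) mulr0.
rewrite big_seq big1 ?addr0// => k kr; rewrite subr_eq0.
have -> : (m == k) = false by apply: contraNF mr => /eqP ->.
by rewrite mulr0.
Qed.

(** Multiplication of [F] by [h] is imitated by a finite combination of translates of the
    coefficients of F. The error is the convolution with the tail of the coefficients of [h], which
    is small in l_1. *)
Lemma psum_truncate p (h : R -> R) (F : R -> R[i]) C B e : 1 < p -> lip h -> ccontinuous F ->
  (forall t, normc (F t) <= C) -> psum p (fc F) B -> 0 < e ->
  exists N, psum p (fun m => fc (fun t => creal h t * F t) m -
    \sum_(n <- zrange N) fc (creal h) n * fc F (m - n)) e.
Proof.
move=> p1 lh cF FC hB e0; have p0 : 0 < p by exact: lt_trans p1.
have B0 := psum_ge0 hB; have B1 : 0 < B + 1 by rewrite ltr_pwDr.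
pose d := (e / (B + 1)) `^ p^-1.
have d0 : 0 < d by rewrite powR_gt0 ?divr_gt0.
have [N hN] := lip_fc_tail_small lh d0.
exists N; apply: psum_lim => // s eps eps0.
have [N1 hN1] := fc_mul lh cF FC eps0.
pose M := maxn N N1.
exists (fun m => \sum_(n <- [seq n <- zrange M | (N < `|n|)%N]) fc (creal h) n * fc F (m - n)).
  apply: (@psum_le _ _ _ (d `^ p * B)); last first.
    rewrite /d -powRrM mulVf ?gt_eqF// powRr1 ?divr_ge0 ?(ltW e0) ?(ltW B1)//.
    by rewrite mulrAC -mulrA ler_piMr ?(ltW e0)// ler_pdivrMr// mul1r lerDl.
  apply: (psum_young p1 _ hB); apply: (hN N _ (leqnn N)).
    exact: filter_uniq (zrange_uniq _).
  by move=> n; rewrite mem_filter => /andP[].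
move=> m _; apply: le_trans (hN1 M m (leq_maxr _ _)).
rewrite -addrA -opprD le_eqVlt; apply/orP; left; apply/eqP.
rewrite [X in _ = normc (_ - X)](bigID (fun n : int => (N < `|n|)%N))/= big_filter.
rewrite -[X in _ = normc (_ - (_ + X))]big_filter (perm_big _ (perm_filter_zrange (leq_maxl N N1))).
by rewrite [X in fc _ _ - X]addrC.
Qed.

(** Duality, with the [F n] in place of a limit functional. A combination of translates close to the
    delta gives a function g = 1 - P f, P a trigonometric polynomial, with small coefficients in
    l_p, so its pairing with [F n] is at most 1/8. Up to 1/32 this pairing is the coefficient at 0
    of F n g, which differs by at most 1/32 from that of [F n] because F n f is small; the sum stays
    below 1/4. *)
Lemma not_generator p q (f : R -> R) (F : nat -> R -> R) (B : R) :
  1 < p -> 1 < q -> p^-1 + q^-1 = 1 -> continuous f -> (exists C, forall t, `|f t| <= C) ->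
  (forall n, lip (F n)) -> (forall n, psum q (fc (creal (F n))) B) ->
  (forall n, 4^-1 <= normc (fc (creal (F n)) 0)) ->
  (forall n t, `|F n t * f t| <= 2^-1 ^+ n) ->
  ~ generator p (fc (creal f)).
Proof.
move=> p1 q1 pq cf [C fC] lF FB F0 Ff hgen.
have p0 : 0 < p by exact: lt_trans p1.
have q0 : 0 < q by exact: lt_trans q1.
have B0 : 0 <= B := psum_ge0 (FB 0%N).
(* [tau] makes the l_q half of [psum_pairing] at most 1/16, as [B] does not depend on n; [e] is then
   chosen so that the l_p half equals 1/16. *)
pose tau := (1 + 16 * B) `^ q^-1.
have tau0 : 0 < tau by rewrite powR_gt0// ltr_pwDl// mulr_ge0.
have tq : (tau^-1) `^ q * B <= 16^-1.
  have B16 : 0 < 1 + 16 * B by rewrite ltr_pwDl// mulr_ge0.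
  have tqE : tau `^ q = 1 + 16 * B.
    by rewrite /tau -powRrM mulVf ?powRr1 ?(ltW B16)// gt_eqF.
  rewrite -(powR_inv1 (ltW tau0)) -powRrM mulN1r powRN tqE mulrC ler_pdivrMr//.
  by lra.
pose e := (16 * tau `^ p)^-1 `^ p^-1.
have tp0 : 0 < tau `^ p by rewrite powR_gt0.
have e0 : 0 < e by rewrite powR_gt0// invr_gt0 mulr_gt0.
have te : tau `^ p * e `^ p = 16^-1.
  rewrite /e -powRrM mulVf ?gt_eqF// powRr1; last by rewrite invr_ge0 mulr_ge0// ltW.
  by field; rewrite gt_eqF.
pose dl : int -> R[i]^o := fun n => (n == 0)%:R.
have ldl : lp p dl by apply: (@psum_lp R p 1 dl); exact: psum_delta.
have [P [m [c [v [vk PE]]]] hP] := hgen dl ldl e e0.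
have [k hk] : exists k : 'I_m -> int, forall i, v i = translate (k i) (fc (creal f)).
  have /choice[k hk] : forall i, exists k : int, v i = translate k (fc (creal f)).
    by move=> i; have [k _ <-] := vk i; exists k.
  by exists k.
pose g t := 1 - \sum_(i < m) c i * (fexp (k i) t * creal f t).
have ccf := ccontinuous_real cf.
have cterm i : ccontinuous (fun t => fexp (k i) t * creal f t).
  by apply: ccontinuousM => //; exact: continuous_fexp.
have csum : ccontinuous (fun t => \sum_(i < m) c i * (fexp (k i) t * creal f t)).
  by apply: ccontinuous_sum => i; apply: ccontinuousZ.
have cg : ccontinuous g.
  by apply: ccontinuousD; [exact: ccontinuous_cst|exact: ccontinuousN].
have gE n : fc g n = (dl - P) n.
  rewrite fcB//; last exact: ccontinuous_cst.
  have -> : fc (fun=> 1) n = dl n :> R[i].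
    by rewrite -[RHS]mulr1 /dl -[X in _ * X]/(Complex 1 0) -fc_cst.
  have -> : (dl - P) n = dl n - P n by [].
  congr (_ - _); rewrite fc_sum; last by move=> i; exact: ccontinuousZ.
  rewrite PE fct_sumE; apply: eq_bigr => i _; rewrite fcZ// fc_mul_fexp.
  by rewrite hk /translate.
have hg : psum p (fc g) (e `^ p).
  by apply: eq_psum (lp_norm_psum p0 e0 hP) => n; rewrite gE.
pose A := \sum_(i < m) normc (c i).
have A0 : 0 <= A by apply: sumr_ge0 => i _; exact: normc_ge0.
have C0 : 0 <= C := le_trans (normr_ge0 _) (fC 0).
have gC t : normc (g t) <= 1 + A * C.
  apply: (le_trans (ler_normcD _ _)); rewrite Normc.normc1 lerD2l normcN.
  apply: (le_trans (ler_normc_sum _ _ _)); rewrite mulr_suml; apply: ler_sum => i _.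
  by rewrite !Normc.normcM normc_fexp mul1r ler_wpM2l ?normc_ge0// normc_creal.
(* The index is chosen after the combination, whose coefficients may have any total size [A]. *)
have [n hn] : exists n : nat, 2 * (A * 2^-1 ^+ n) <= 32^-1.
  exists (Num.bound (64 * A)).
  have h : 64 * A <= 2 ^+ (Num.bound (64 * A)).
    apply: (le_trans (ltW (archi_boundP _))); first by rewrite mulr_ge0.
    by rewrite -natrX ler_nat ltnW// ltn_expl.
  move: (Num.bound _) h => n h.
  have : 0 < 2 ^+ n :> R by rewrite exprn_gt0.
  move=> h2; rewrite exprVn mulrA (ler_pdivrMr _ _ h2).
  move: (2 ^+ n) h => z h; clear -h; lra.
have cF := creal_ccont (lF n).
have [N hN] := @fc_mul R (F n) g (1 + A * C) 32^-1 (lF n) cg gC (ltac:(by rewrite invr_gt0)).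
have h1 : normc (\sum_(j <- zrange N) fc (creal (F n)) j * fc g (- j)) <= 16^-1 + 16^-1.
  apply: (le_trans (psum_pairing q1 p1 _ tau0 (FB n) hg (zrange_uniq N))).
    by rewrite addrC.
  by rewrite te lerD.
have h2 := hN N 0 (leqnn N).
have h3 : normc (fc (fun t => creal (F n) t * g t) 0 - fc (creal (F n)) 0) <= 32^-1.
  rewrite -fcB//; last by apply: ccontinuousM.
  apply: le_trans hn; apply: ler_normc_fc.
    by apply: ccontinuousD; [exact: ccontinuousM|exact: ccontinuousN].
  move=> t; have -> : creal (F n) t * g t - creal (F n) t =
      - \sum_(i < m) c i * (fexp (k i) t * (creal (F n) t * creal f t)).
    rewrite /g mulrBr mulr1 addrAC subrr add0r mulr_sumr; congr (- _).
    by apply: eq_bigr => i _; ring.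
  rewrite normcN (le_trans (ler_normc_sum _ _ _))// mulr_suml; apply: ler_sum => i _.
  rewrite Normc.normcM ler_wpM2l ?normc_ge0// Normc.normcM normc_fexp mul1r Normc.normcM.
  by rewrite !normc_creal -normrM.
have := F0 n.
move: h1 h2 h3; set a := fc (creal (F n)) 0; set x := fc _ 0; set y := \sum_(_ <- _) _.
rewrite (_ : \sum_(n0 <- _) _ = y); last by apply: eq_bigr => j _; rewrite sub0r.
move=> h1 h2 h3.
have : normc a <= normc (x - a) + normc (x - y) + normc y.
  have -> : normc a = normc ((a - x) + ((x - y) + y)) by congr (normc _); ring.
  rewrite (normcB x a); apply: (le_trans (ler_normcD _ _)).
  by rewrite -[leRHS]addrA lerD2l ler_normcD.
clearbody a x y; move: h1 h2 h3; move: (normc a) (normc y) (normc (x - a)) (normc (x - y)).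
clear=> u v w z; lra.
Qed.
End Generators.

(** * The limits of the stages *)

Lemma geometric_small (R : realType) (k C e : R) : 0 <= k < 1 -> 0 <= C -> 0 < e ->
  exists N : nat, forall n, (N <= n)%N -> C * k ^+ n <= e.
Proof.
move=> /andP[k0 k1] C0 e0; have C1 : 0 < C + 1 by rewrite ltr_pwDr.
have kn : `|k| < 1 by rewrite ger0_norm.
have /cvgrPdist_le/(_ (e / (C + 1)) (divr_gt0 e0 C1)) [N _ hN] := cvg_expr kn.
exists N => n Nn; have := hN n Nn; rewrite /= sub0r normrN ger0_norm ?exprn_ge0// => h.
apply: (@le_trans _ _ (C * (e / (C + 1)))); first by rewrite ler_wpM2l.
by rewrite mulrCA ler_piMr ?(ltW e0)// ler_pdivrMr// mul1r lerDl.
Qed.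

Lemma half_itv (R : realType) : 0 <= (2^-1 : R) < 1.
Proof. by apply/andP; split; lra. Qed.

Section StageLimit.
Variables (R : realType) (p q beta : R) (s : nat -> stage R).
Hypotheses (p1 : 1 < p) (pq : p <= q) (beta01 : 0 < beta <= 1).
Hypothesis inv : forall n, stage_inv p q beta n (s n).
Hypothesis stp : forall n, stage_step p q beta n (s n) (s n.+1).

Let kappa := 1 - beta / 2.
Let K : R := 2 * 2 `^ q.
Let C : R := (1 - kappa)^-1.
Let g n := sg (s n).
Let f n := sf (s n).
Let S n := sS (s n).
Let e n := se (s n).

Let kap : 0 <= kappa < 1.
Proof. by case/andP: beta01 => b0 b1; rewrite /kappa; apply/andP; split; lra. Qed.

Let k1 : 0 < 1 - kappa.
Proof. by case/andP: kap => _ ?; rewrite subr_gt0. Qed.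

Let C0 : 0 < C.
Proof. by rewrite invr_gt0. Qed.

Let q0 : 0 < q.
Proof. by apply: lt_le_trans pq; exact: lt_trans p1. Qed.

Let K2 : 2 <= K.
Proof. by rewrite /K ler_peMr// -[leLHS](powRr0 (2 : R)) ler_powR// ?ler1n// ltW. Qed.

Let Kp : 2 * 2 `^ p <= K.
Proof. by rewrite /K ler_pM2l// ler_powR// ler1n. Qed.

Let lg n : lip (g n).
Proof. by have [[h _ _] _ _ _ _] := inv n; exact: h. Qed.

Let lf n : lip (f n).
Proof. by have [[_ h _] _ _ _ _] := inv n; exact: h. Qed.

Let lS n : lip (S n).
Proof. by have [[_ _ h] _ _ _ _] := inv n; exact: h. Qed.

Let g_ge0 n t : 0 <= g n t.
Proof. by have [_ [r r0 h] _ _ _] := inv n; exact: le_trans (ltW r0) (h t). Qed.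

Let f_ge0 n t : 0 <= f n t.
Proof. by have [_ _ [h _] _ _] := inv n; exact: h. Qed.

Let f_small_g n t : f n t = 0 -> g n t <= kappa ^+ n.
Proof. by have [_ _ _ h _] := inv n; exact: h. Qed.

Let e_gt0 n : 0 < e n.
Proof. by have [_ _ _ _ [h _ _]] := inv n; exact: h. Qed.

Let e_step n : K * e n.+1 <= e n.
Proof. by have [_ _ _ _ h] := stp n; exact: h. Qed.

Let e_half n : 2 * e n.+1 <= e n.
Proof. by apply: le_trans (e_step n); rewrite ler_wpM2r// ltW. Qed.

(** The induction carries the exact geometric sum C (kappa^m - kappa^n), whose last term is then
    dropped. *)
Let g_cauchy m n t : (m <= n)%N -> `|g n t - g m t| <= C * kappa ^+ m.
Proof.
move=> /subnKC <-; move: (n - m)%N => k.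
have kk j : 0 <= kappa ^+ j by rewrite exprn_ge0//; case/andP: kap.
apply: (@le_trans _ _ (C * (kappa ^+ m - kappa ^+ (m + k)))); last first.
  by rewrite ler_wpM2l ?(ltW C0)// lerBlDr lerDl.
elim: k => [|k ih]; first by rewrite addn0 !subrr normr0 mulr0.
have [hs _ _ _ _] := stp (m + k)%N; have := hs t; rewrite -/(g _) addnS => h.
rewrite (_ : g (m + k).+1 t - g m t =
  (g (m + k).+1 t - g (m + k)%N t) + (g (m + k)%N t - g m t)); last by ring.
apply: (le_trans (ler_normD _ _)); apply: (le_trans (lerD h ih)).
rewrite exprS -subr_ge0 (_ : _ - _ = 0)//.
by rewrite /C; field; rewrite gt_eqF.
Qed.

(** As 2 e (n+1) <= e n, the increment at stage n is at most 2 e n - 2 e (n+1), which telescopes. *)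
Let f_cauchy m n t : (m <= n)%N -> 0 <= f n t - f m t <= 2 * e m - 2 * e n.
Proof.
move=> /subnKC <-; move: (n - m)%N => k.
elim: k => [|k /andP[ih1 ih2]]; first by rewrite addn0 !subrr lexx.
have [_ _ [hs _] _ _] := stp (m + k)%N; have /andP[] := hs t.
rewrite -/(f _) -/(e _) -/(f (m + k)%N) addnS => h1 h2.
have h3 := e_half (m + k)%N; have h4 := e_gt0 (m + k)%N.
apply/andP; split; lra.
Qed.

Let f_dist m n t : (m <= n)%N -> `|f n t - f m t| <= 2 * e m.
Proof.
move=> mn; have /andP[h1 h2] := f_cauchy t mn; rewrite ger0_norm//.
by have h3 := e_gt0 n; lra.
Qed.

Let e_geometric n : e n <= e 0%N * 2^-1 ^+ n.
Proof.
elim: n => [|n ih]; first by rewrite expr0 mulr1.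
rewrite exprS; have := e_half n; move: (2^-1 ^+ n) ih => z ? ?; lra.
Qed.

Let g_rate d : 0 < d -> exists N : nat, forall n, (N <= n)%N -> C * kappa ^+ n <= d.
Proof. by move=> d0; apply: geometric_small => //; exact: ltW. Qed.

Let f_rate d : 0 < d -> exists N : nat, forall n, (N <= n)%N -> 2 * e n <= d.
Proof.
move=> d0; have e20 : 0 <= 2 * e 0%N by rewrite mulr_ge0// ltW.
have [N hN] := geometric_small (half_itv R) e20 d0.
exists N => n /hN; apply: le_trans; rewrite -mulrA ler_pM2l//.
Qed.

Let limit_periodic (u : nat -> R -> R) (l : R -> R) (c : nat -> R) :
  (forall n, lip (u n)) -> (forall t n, `|l t - u n t| <= c n) ->
  (forall d, 0 < d -> exists N : nat, forall n, (N <= n)%N -> c n <= d) -> periodic l (2 * pi).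
Proof.
move=> lu hl hc t; apply/eqP; rewrite -subr_eq0 -normr_le0; apply/ler_addgt0Pr => d d0.
have [N /(_ N (leqnn N)) hN] := hc (d / 2) (divr_gt0 d0 (ltr0n _ 2)).
have := hl t N; have := hl (t + 2 * pi) N; rewrite (lu N).1 => h1; rewrite distrC => h2.
rewrite (_ : _ - _ = (l (t + 2 * pi) - u N t) + (u N t - l t)); last by ring.
by apply: (le_trans (ler_normD _ _)); lra.
Qed.

Let limit_bounded (u : nat -> R -> R) (l : R -> R) (c : nat -> R) :
  (forall n, lip (u n)) -> (forall t n, `|l t - u n t| <= c n) -> exists B, forall t, `|l t| <= B.
Proof.
move=> lu hl; have [B _ hB] := lip_bound (lu 0%N); exists (c 0%N + B) => t.
by rewrite -[l t](subrK (u 0%N t)) (le_trans (ler_normD _ _))// lerD.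
Qed.

(** Since f increases with the stage, a zero of its limit is a zero at every stage; there g n <=
    kappa^n for all n, and the limit of g vanishes. *)
Lemma stage_limit : exists gl fl : R -> R,
  [/\ [/\ continuous gl, periodic gl (2 * pi) & exists B, forall t, `|gl t| <= B],
      [/\ continuous fl, periodic fl (2 * pi) & exists B, forall t, `|fl t| <= B],
      [/\ forall t, 0 <= gl t, forall t, 0 <= fl t & forall t, fl t = 0 -> gl t = 0],
      (forall n, psum p (fc (creal (fun t => gl t - sg (s n) t))) (K * se (s n))) /\
      (forall n, psum p (fc (creal (fun t => fl t - sf (s n) t))) (K * se (s n))) &
      forall t n, `|fl t - sf (s n) t| <= 2 * se (s n)].
Proof.
have /choice[gl hgl] : forall t, exists l, forall n, `|l - g n t| <= C * kappa ^+ n.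
  by move=> t; apply: nested_limit => m n mn; exact: g_cauchy.
have /choice[fl hfl] : forall t, exists l, forall n, `|l - f n t| <= 2 * e n.
  by move=> t; apply: nested_limit => m n mn; exact: f_dist.
have cgl : continuous gl.
  apply: (@uniform_limit_continuous R g gl (fun n => C * kappa ^+ n)) => [n|n t|d d0].
  - exact: lip_cont.
  - exact: hgl.
  - by have [N hN] := g_rate d0; exists N; exact: hN.
have cfl : continuous fl.
  apply: (@uniform_limit_continuous R f fl (fun n => 2 * e n)) => [n|n t|d d0].
  - exact: lip_cont.
  - exact: hfl.
  - by have [N hN] := f_rate d0; exists N; exact: hN.
have f_le n t : f n t <= fl t.
  apply/ler_addgt0Pr => d d0; have [N hN] := f_rate d0.
  have := hfl t (maxn n N); rewrite ler_norml => /andP[h1 _].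
  have /andP[h2 _] := f_cauchy t (leq_maxl n N).
  have h3 := hN _ (leq_maxr n N); lra.
have fl0 t : 0 <= fl t := le_trans (f_ge0 0%N t) (f_le 0%N t).
have gl0 t : 0 <= gl t.
  apply/ler_addgt0Pr => d d0; have [N hN] := g_rate d0.
  have := hgl t N; rewrite ler_norml => /andP[h1 _].
  have h2 := g_ge0 N t; have h3 := hN N (leqnn N); lra.
exists gl, fl; split.
- by split=> //; [exact: (limit_periodic lg hgl g_rate)|exact: (limit_bounded lg hgl)].
- by split=> //; [exact: (limit_periodic lf hfl f_rate)|exact: (limit_bounded lf hfl)].
- split=> // t ft; apply/eqP; rewrite eq_le gl0 andbT; apply/ler_addgt0Pr => d d0; rewrite add0r.
  have d2 : 0 < d / 2 by rewrite divr_gt0.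
  have [N1 hN1] := g_rate d2; have [N2 hN2] := geometric_small kap ler01 d2.
  pose N := maxn N1 N2.
  have h1 := hN1 N (leq_maxl _ _); have := hN2 N (leq_maxr _ _); rewrite mul1r => h2.
  have fN : f N t = 0 by apply/eqP; rewrite eq_le f_ge0 andbT -ft f_le.
  have h4 := f_small_g fN; have := hgl t N; rewrite ler_norml => /andP[_ h3].
  lra.
- split=> m.
    apply: (@psum_fc_limit R p K g gl e (fun n => C * kappa ^+ n)) => // [n|n|m' d d0].
    + exact: ltW.
    + by have [_ h _ _ _] := stp n; exact: h.
    + have [N hN] := g_rate d0.
      by exists (maxn m' N); [exact: leq_maxl|apply: hN; exact: leq_maxr].
  apply: (@psum_fc_limit R p K f fl e (fun n => 2 * e n)) => // [n|n|m' d d0].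
  + exact: ltW.
  + by have [_ _ [_ h] _ _] := stp n; exact: h.
  + have [N hN] := f_rate d0.
    by exists (maxn m' N); [exact: leq_maxl|apply: hN; exact: leq_maxr].
- exact: hfl.
Qed.

(** With h = 1/(g M + f M) one has h G - 1 = h D, where D is the whole change after stage M; the
    budget of that stage was made to bound its p-th power sum by 2^(-M). Truncating the coefficients
    of h then gives a combination of translates close to the delta. *)
Lemma limit_generator (gl fl : R -> R) (G := fun t => gl t + fl t) : continuous gl -> continuous fl ->
  (exists B, forall t, `|gl t| <= B) -> (exists B, forall t, `|fl t| <= B) ->
  (forall n, psum p (fc (creal (fun t => gl t - sg (s n) t))) (K * se (s n))) ->
  (forall n, psum p (fc (creal (fun t => fl t - sf (s n) t))) (K * se (s n))) ->
  (exists B, psum p (fc (creal G)) B) /\ generator p (fc (creal G)).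
Proof.
move=> cgl cfl [b1 hb1] [b2 hb2] hg hf; have p0 : 0 < p by exact: lt_trans p1.
have cG : continuous G by exact: add_cont.
have dg n : continuous (fun t => gl t - g n t) by apply: sub_cont => //; exact: lip_cont.
have df n : continuous (fun t => fl t - f n t) by apply: sub_cont => //; exact: lip_cont.
pose D n t := (gl t - g n t) + (fl t - f n t).
have cD n : continuous (D n) by exact: add_cont.
have hD n : psum p (fc (creal (D n))) (2 `^ p * (K * e n + K * e n)).
  apply: eq_psum (psumD (ltW p0) (hg n) (hf n)) => k; rewrite -fcD; [|exact: ccontinuous_real (dg n)|exact: ccontinuous_real (df n)].
  by apply: eq_fc => t; apply: complexP; rewrite !reimE/= ?addr0.
have lgf n : lip (fun t => g n t + f n t) := lipD (lg n) (lf n).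
have [B hB] : exists B, psum p (fc (creal G)) B.
  have [B1 h1] := psum_lip p1 (lgf 0%N); eexists; apply: eq_psum (psumD (ltW p0) (hD 0%N) h1) => k.
  rewrite -fcD; [|exact: ccontinuous_real|exact: creal_ccont].
  by apply: eq_fc => t; apply: complexP; rewrite !reimE/= /G /D; ring.
split; first by exists B.
apply: (generator_of_delta p1 hB) => d d0.
have d2 : 0 < d / (2 * 2 `^ p) by rewrite divr_gt0// mulr_gt0// powR_gt0.
have [M /(_ M (leqnn M))] := geometric_small (half_itv R) ler01 d2; rewrite mul1r => hd.
have [_ [r r0 gr] _ _ [_ [A [hA Ae]] _]] := inv M.
pose h t := (g M t + f M t)^-1.
have gfr t : r <= g M t + f M t by rewrite -[leLHS]addr0; exact: lerD (gr t) (f_ge0 M t).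
have lh : lip h by exact: lip_inv r0 gfr (lgf M).
have [BD hBD] : exists B, forall t, normc (creal (D M) t) <= B.
  have [b _ hb] := lip_bound (lgf M); exists (b1 + b2 + b) => t; rewrite normc_creal.
  have -> : D M t = gl t + fl t - (g M t + f M t) by rewrite /D; ring.
  apply: (le_trans (ler_normB _ _)); apply: lerD => //.
  by apply: (le_trans (ler_normD _ _)); exact: lerD.
have h1 := psum_mul p1 lh hA (ccontinuous_real (cD M)) hBD (hD M).
have hBG t : normc (creal G t) <= b1 + b2.
  by rewrite normc_creal (le_trans (ler_normD _ _))// lerD.
have [N hN] := psum_truncate p1 lh (ccontinuous_real cG) hBG hB d2.
exists (fc (creal h)), (zrange N).
apply: (@psum_le _ _ _ _ _ (eq_psum _ (psumD (ltW p0) (psumN h1) hN))).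
  move=> n /=; rewrite addrA; congr (_ - _).
  rewrite -[(n == 0)%:R]mulr1 -[X in _ = _ * X]/(Complex (1 : R) 0) -fc_cst.
  have chG : ccontinuous (fun t => creal h t * creal G t).
    by apply: ccontinuousM; [exact: creal_ccont|exact: ccontinuous_real].
  have chD : ccontinuous (fun t => creal h t * creal (D M) t).
    by apply: ccontinuousM; [exact: creal_ccont|exact: ccontinuous_real].
  rewrite addrC -fcB//; apply: eq_fc => t; apply: complexP; rewrite !reimE/=; last by ring.
  by rewrite /D /G /h; field; rewrite gt_eqF//; exact: lt_le_trans (gfr t).
apply: (@le_trans _ _ (2 `^ p * (d / (2 * 2 `^ p) + d / (2 * 2 `^ p)))).
  by rewrite ler_wpM2l ?powR_ge0// lerD2r; exact: le_trans hd.
by rewrite le_eqVlt; apply/orP; left; apply/eqP; field; rewrite gt_eqF ?powR_gt0.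
Qed.

(** The initial budget keeps the coefficient at 0 of S n - 1 within 1/4, so that of S n has modulus
    at least 3/4. As f n S n = 0, the product S n fl equals S n (fl - f n), which the budget of
    stage n bounds by 2^(-n). *)
Lemma limit_not_generator (fl : R -> R) : p^-1 + q^-1 = 1 ->
  sS (s 0%N) = (fun=> 1) -> se (s 0%N) <= 4^-1 `^ q / K -> continuous fl ->
  (exists B, forall t, `|fl t| <= B) -> (forall t n, `|fl t - sf (s n) t| <= 2 * se (s n)) ->
  ~ generator p (fc (creal fl)).
Proof.
move=> pqE S0E ee cfl bfl hfl; have q1 : 1 < q by exact: lt_le_trans pq.
have hS m : psum q (fc (creal (fun t => S m t - 1))) (K * e 0%N).
  have -> : (fun t => S m t - 1) = (fun t => S (0 + m)%N t - S 0%N t) by rewrite /S S0E.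
  apply: (@psum_telescope R q K S e q1 (lexx K) lS (fun n => ltW (e_gt0 n)) _ e_step) => n.
  by have [_ _ _ h _] := stp n; exact: h.
have c1 : ccontinuous (creal (fun=> 1 : R)) by exact: creal_ccont (lip_cst _).
have fc1 k : fc (creal (fun=> 1 : R)) k = (k == 0)%:R by rewrite fc_cst mulr1.
apply: (@not_generator R p q fl S (2 `^ q * (K * e 0%N + 1)) p1 q1 pqE cfl bfl) => // [n|n|n t].
- apply: eq_psum (psumD (ltW q0) (hS n) (psum_delta q0)) => k; rewrite -fc1 -fcD//.
    by apply: eq_fc => t; apply: complexP; rewrite !reimE/=; ring.
  by apply: creal_ccont; apply: lipB (lS n) (lip_cst _).
- have h4 : normc (fc (creal (fun t => S n t - 1)) 0) <= 4^-1.
    rewrite leNgt; apply/negP => h6.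
    have : 4^-1 `^ q < normc (fc (creal (fun t => S n t - 1)) 0) `^ q.
      by apply: gt0_ltr_powR; rewrite ?nnegrE ?invr_ge0 ?normc_ge0.
    rewrite ltNge (le_trans (psum_bound 0 (hS n)))// mulrC -ler_pdivlMr//.
    exact: lt_le_trans K2.
  have E : fc (creal (fun t => S n t - 1)) 0 = fc (creal (S n)) 0 - 1.
    rewrite -[X in _ = _ - X](fc1 0) -fcB//; last exact: creal_ccont.
    by apply: eq_fc => t; apply: complexP; rewrite !reimE/=; ring.
  rewrite E in h4; have := ler_normcD (fc (creal (S n)) 0) (- (fc (creal (S n)) 0 - 1)).
  rewrite (_ : _ + - (_ - 1) = 1); last by ring.
  by rewrite normcN Normc.normc1; move: (normc _) (normc _) h4 => u v; lra.
- have [_ _ [_ fS] _ [_ _ [B [hB Be]]]] := inv n.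
  have -> : S n t * fl t = S n t * (fl t - f n t) by rewrite mulrBr [S n t * f n t]mulrC fS subr0.
  rewrite normrM; apply: le_trans Be.
  exact: (ler_pM (normr_ge0 _) (normr_ge0 _) (hB t) (hfl t n)).
Qed.
End StageLimit.

Unset Implicit Arguments.

Theorem theorem3p1 (R : realType) (p : R) (hp : 1 < p < 2) :
  exists f g : R -> R[i]^o,
    [/\ circle_continuous f,
        circle_continuous g,
        [set t | f t = 0] = [set t | g t = 0],
        lp p (fourier_coef f) /\ lp p (fourier_coef g)
      & generator p (fourier_coef g) /\ ~ generator p (fourier_coef f)].
Proof.
have /andP[p1 p2] := hp; have p0 : 0 < p by exact: lt_trans p1.
pose q := p / (p - 1).
have p10 : 0 < p - 1 by rewrite subr_gt0.
have pqE : p^-1 + q^-1 = 1 by rewrite /q invf_div; field; rewrite gt_eqF.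
have q2 : 2 < q by rewrite /q ltr_pdivlMr//; lra.
have pq : p <= q by exact: ltW (lt_trans p2 q2).
have [beta beta01 key] := key_lemma p1 q2.
have em0 : 0 < 4^-1 `^ q / (2 * 2 `^ q) by rewrite divr_gt0 ?mulr_gt0 ?powR_gt0 ?invr_gt0.
have [s [inv stp e0 [_ sf0 S0]]] := stage_sequence p1 q2 beta01 key em0.
have [g [f [[cg pg bg] [cf pf bf] [g0 f0 fg0] [hg hf] fl]]] := stage_limit p1 pq beta01 inv stp.
have [[B hB] gen] := limit_generator p1 inv cg cf bg bf hg hf.
have ngen := limit_not_generator p1 pq inv stp pqE S0 e0 cf bf fl.
have E (h : R -> R) : fourier_coef (creal h : R -> R[i]^o) = fc (creal h).
  by apply/funext => n; exact: fourier_coefE.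
exists (creal f), (creal (fun t => g t + f t)); rewrite !E; split; last by split.
- exact: circle_continuous_creal.
- apply: circle_continuous_creal => [|t]; first exact: add_cont.
  by rewrite pg pf.
(* Both summands are nonnegative, so the sum vanishes only where each of them does. *)
- have z (x : R) : Complex x 0 = 0 <-> x = 0 by split=> [[]|->].
  apply/seteqP; split=> t /= /z h; apply/z.
    by rewrite h (fg0 t h) addr0.
  by move/eqP: h; rewrite (paddr_eq0 (g0 t) (f0 t)) => /andP[_ /eqP].
- split; last exact: psum_lp hB.
  (* The initial f is 0, so the total change since the initial stage is [f] itself. *)
  apply: (@psum_lp R p (2 * 2 `^ q * se (s 0%N))); apply: eq_psum (hf 0%N) => n.
  by apply: eq_fc => t; rewrite sf0 /creal subr0.
Qed.
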